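(* Assume: (A3) for all $\theta\in\Theta$, $P_\theta$ is $\pi$-irreducible and aperiodic, and there exist a function $V:\mathsf{X}\to[1,+\infty)$ and, for each $\theta\in\Theta$, constants $b_\theta<\infty$, $\delta_\theta\in(0,1)$, $\lambda_\theta\in(0,1)$ and a probability measure $\nu_\theta$ on $\mathsf{X}$ such that $$P_\theta V\le\lambda_\theta V+b_\theta,\qquad P_\theta(x,\cdot)\ge\delta_\theta\,\nu_\theta(\cdot)\,\mathbf{1}_{\{V\le c_\theta\}}(x),\qquad c_\theta=2b_\theta(1-\lambda_\theta)^{-1}-1;$$ (A4) $\sum_{k=1}^\infty k^{-1}(L_{\theta_k}\vee L_{\theta_{k-1}})^6\,D_V(\theta_k,\theta_{k-1})\,V(X_k)<+\infty$ $\mathbb{P}$-a.s.; (A5)(a) $\limsup_n\pi_{\theta_n}(V)<+\infty$ $\mathbb{P}$-a.s.; (A5)(b) for some $\alpha>1$, $\sum_{k=0}^\infty(k+1)^{-\alpha}L_{\theta_k}^{2\alpha}\,P_{\theta_k}V^\alpha(X_k)<+\infty$ $\mathbb{P}$-a.s. Let $F:\mathsf{X}\times\Theta\to\mathbb{R}$ be a measurable function such that: (i) $\sup_\theta\|F(\cdot,\theta)\|_V<+\infty$; (ii) $\sum_{k=1}^\infty k^{-1}L_{\theta_{k-1}}^2\,\|F(\cdot,\theta_k)-F(\cdot,\theta_{k-1})\|_V\,V(X_k)<+\infty$ $\mathbb{P}$-a.s.; (iii) $\lim_{n\to\infty}\int\pi_{\theta_n}(dx)F(x,\theta_n)$ exists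 $\mathbb{P}$-a.s. Then $$\lim_{n\to\infty}\frac1n\sum_{k=0}^{n-1}F(X_k,\theta_k)=\lim_{n\to\infty}\int\pi_{\theta_n}(dx)F(x,\theta_n)\qquad\mathbb{P}\text{-a.s.}$$
   Context: $(\Theta,\mathcal{T})$ is a measurable space, $(\mathsf{X},\mathcal{X})$ a general state space, $\pi$ a fixed (target) probability distribution on it, and $\{P_\theta,\theta\in\Theta\}$ a collection of Markov transition kernels on $(\mathsf{X},\mathcal{X})$. $\{(X_n,\theta_n),n\ge0\}$ is an $\mathsf{X}\times\Theta$-valued process on a filtered probability space $(\Omega,\mathcal{A},\{\mathcal{F}_n\},\mathbb{P})$, $(X_n,\theta_n)$ is $\mathcal{F}_n$-adapted, and $\mathbb{E}[f(X_{n+1})\mid\mathcal{F}_n]=P_{\theta_n}f(X_n)$ for every bounded measurable $f$. For $V:\mathsf{X}\to[1,\infty)$: $\|f\|_V=\sup_x|f(x)|/V(x)$; $\|\mu_1-\mu_2\|_V=\sup\{|\mu_1(f)-\mu_2(f)|:\|f\|_V\le1\}$; $D_V(\theta,\theta')=\sup_{x}\|P_\theta(x,\cdot)-P_{\theta'}(x,\cdot)\|_V/V(x)$. Under (A3), each $P_\theta$ has a unique invariant probability $\pi_\theta$, and there are finite constants $C_\theta$ and $\rho_\theta\in(0,1)$ with $\|P_\theta^n(x,\cdot)-\pi_\theta\|_V\le C_\theta\rho_\theta^nV(x)$ for all $n\ge 0$, $x\in\mathsf{X}$; such constants are fixed (they may be chosen so that $C_\theta\vee(1-\rho_\theta)^{-1}\le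 C\{b_\theta\vee\delta_\theta^{-1}\vee(1-\lambda_\theta)^{-1}\}^\gamma$ with $C,\gamma>0$ independent of $\theta$), and $L_\theta=C_\theta\vee(1-\rho_\theta)^{-1}$.
   Formalization: The kernels are assumed jointly measurable, i.e. (x,θ) ↦ P_θ(x,A) is measurable for every measurable A; without this, which the setting leaves implicit, the claim fails (e.g. when Θ carries the trivial σ-algebra). *)

(* Defs.v *)
From HB Require Import structures.
From mathcomp Require Import all_boot all_order all_algebra.
From mathcomp Require Import all_classical all_reals all_analysis.
From mathcomp Require Import measurable_realfun.

Set Implicit Arguments.
Unset Strict Implicit.
Unset Printing Implicit Defensive.

Import Order.TTheory GRing.Theory Num.Theory.
Import numFieldNormedType.Exports.

Local Open Scope classical_set_scope.
Local Open Scope ring_scope.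

Section weighted_norms.
Context {d : measure_display} {T : measurableType d} {R : realType}.
Implicit Types (V f : T -> R) (mu : {measure set T -> \bar R}).

Definition Vnorm V f : \bar R :=
  ereal_sup (range (fun x => (`|f x| / V x)%:E)).

(* An infinite integral makes the corresponding term +oo, since oo - oo = -oo
   on \bar R; so, for V positive and measurable, a finite value entails that V
   is integrable for both measures. *)
Definition Vdist V mu1 mu2 : \bar R :=
  ereal_sup [set (`| \int[mu1]_x (f x)%:E - \int[mu2]_x (f x)%:E |)%E
            | f in [set f : T -> R | measurable_fun setT f /\
                                     (Vnorm V f <= 1)%E]].

End weighted_norms.

Section markov_kernels.
Context {d : measure_display} {T : measurableType d} {R : realType}.
Implicit Types (K : R.-pker T ~> T) (V : T -> R).

Fixpoint kiter K (n : nat) : R.-spker T ~> T :=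
  if n is m.+1 then mkcomp_noparam (kiter K m) K
  else kdirac (@measurable_id _ T setT).

Definition irreducible (phi : probability T R) K : Prop :=
  forall A, measurable A -> (0 < phi A)%E ->
  forall x, exists2 n : nat, (0 < n)%N & (0 < kiter K n x A)%E.

(* d-cycles in the sense of Meyn and Tweedie: up to a null set of a maximal
   irreducibility measure, i.e. up to a set that is null for every
   irreducibility measure. *)
Definition kcycle K (n : nat) (D : 'I_n -> set T) : Prop :=
  [/\ forall i, measurable (D i),
      trivIset [set: 'I_n] D,
      forall i x, D i x -> K x (D (ordS i)) = 1%E &
      forall phi : probability T R, irreducible phi K ->
        phi (~` \bigcup_(i in [set: 'I_n]) D i) = 0%E].

Definition aperiodic K : Prop :=
  forall (n : nat) (D : 'I_n -> set T), kcycle K D -> (n <= 1)%N.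

Definition invariant_prob K (mu : probability T R) : Prop :=
  forall A, measurable A -> (\int[mu]_x K x A)%E = mu A.

Definition drift K V (b lam : R) : Prop :=
  forall x, (\int[K x]_y (V y)%:E <= (lam * V x + b)%:E)%E.

Definition minorization K (nu : probability T R) (delta : R) (S : set T) :
    Prop :=
  forall x A, measurable A -> (delta%:E * nu A * (\1_S x)%:E <= K x A)%E.

End markov_kernels.

Section kernel_families.
Context {d d' : measure_display} {T : measurableType d}
  {Theta : measurableType d'} {R : realType}.
Implicit Types (P : Theta -> R.-pker T ~> T) (V : T -> R).

Definition jointly_measurable P : Prop :=
  forall A, measurable A ->
    measurable_fun [set: T * Theta] (fun z => P z.2 z.1 A).

Definition DV V P (t t' : Theta) : \bar R :=
  ereal_sup (range (fun x => (Vdist V (P t x) (P t' x) * ((V x)^-1)%:E)%E)).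

Definition drift_minorization V P : Prop :=
  forall t, exists (b delta lam : R) (nu : probability T R),
    [/\ 0 < delta < 1, 0 < lam < 1, drift (P t) V b lam &
        minorization (P t) nu delta
          [set x | V x <= 2 * b * (1 - lam)^-1 - 1]].

Definition geometrically_ergodic V P (piT : Theta -> probability T R)
    (C rho : Theta -> R) : Prop :=
  forall t, 0 < rho t < 1 /\
    forall (n : nat) x,
      (Vdist V (kiter (P t) n x) (piT t) <= (C t * rho t ^+ n * V x)%:E)%E.

Definition Lcst (C rho : Theta -> R) (t : Theta) : R :=
  Num.max (C t) (1 - rho t)^-1.

End kernel_families.

Section processes.
Context {d : measure_display} {Omega : measurableType d} {R : realType}.

Definition measurable_wrt (G : set (set Omega)) {d' : measure_display}
    {S : measurableType d'} (Y : Omega -> S) : Prop :=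
  forall B, measurable B -> G (Y @^-1` B).

Definition filtration (Flt : nat -> set (set Omega)) : Prop :=
  [/\ forall n, sigma_algebra setT (Flt n),
      forall n, Flt n `<=` measurable &
      forall m n : nat, (m <= n)%N -> Flt m `<=` Flt n].

Definition is_cond_exp (Pr : probability Omega R) (G : set (set Omega))
    (Y Z : Omega -> R) : Prop :=
  [/\ Pr.-integrable setT (EFin \o Y), Pr.-integrable setT (EFin \o Z),
      measurable_wrt G Z &
      forall A, G A -> \int[Pr]_(w in A) Y w = \int[Pr]_(w in A) Z w].

Definition controlled_markov {dT dTh : measure_display}
    {T : measurableType dT} {Theta : measurableType dTh}
    (Pr : probability Omega R) (Flt : nat -> set (set Omega))
    (P : Theta -> R.-pker T ~> T)
    (X : nat -> Omega -> T) (th : nat -> Omega -> Theta) : Prop :=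
  (forall n, measurable_wrt (Flt n) (fun w => (X n w, th n w))) /\
  (forall (n : nat) (f : T -> R), measurable_fun setT f -> bounded_fun f ->
     is_cond_exp Pr (Flt n) (fun w => f (X n.+1 w))
       (fun w => \int[P (th n w) (X n w)]_y f y)).

End processes.

(* Main.v *)
Require Import Defs.
From HB Require Import structures.
From mathcomp Require Import all_boot all_order all_algebra.
From mathcomp Require Import all_classical all_reals all_analysis.
From mathcomp Require Import measurable_realfun.
From mathcomp Require polyrcf.
From mathcomp Require Import ring lra zify.

Set Implicit Arguments.
Unset Strict Implicit.
Unset Printing Implicit Defensive.

Import Order.TTheory GRing.Theory Num.Theory.
Import numFieldNormedType.Exports.

Local Open Scope classical_set_scope.
Local Open Scope ring_scope.

(** Since |F| <= kappa V, F is the difference of the nonnegative functions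
    F + kappa V and kappa V, so it is enough to treat a function f between 0 and a
    multiple of V, and to show that the running mean of f(X_k, th_k) - pi_(th_k)(f) tends to 0
    ([centred_run_mean_cvg0]); Cesaro's theorem then gives the limit.

    For each parameter t the Poisson equation g - P_t g = f - pi_t(f) has a
    solution of size L_t^2 V, which moves little with t ([poisson_eq],
    [poisson_sol_perturb]). It splits the centred value x_k of f at time k + 1 as
      x_k = m_k + (p_k - p_(k+1)) + r_k,
    where m_k = g_(th_k)(X_(k+1)) - P g_(th_k)(X_k) is a martingale increment,
    p_k = P g_(th_k)(X_k) telescopes, and r_k is the effect of the change of
    parameter. The hypotheses [A4] and [F_var] make the series of r_k / k
    absolutely convergent, and [A5b] makes the series of
    (|m_k| / k)^alpha and (|p_k| / k)^alpha converge, through their conditional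
    expectations ([compensated_series_lty]).

    For alpha > 2 such a moment condition does not suffice for the strong law
    of a general martingale. The argument rests instead on a lower bound for x:
    f >= 0, and [A5a] bounds pi_(th_k)(f). The running mean N satisfies
    N_(n+1) - N_n = (x_n - N_n) / (n + 1). Let j + 2 >= alpha. Along N, a function
    that behaves like |N|^(2j+2) has a drift - N wgt(N) / n, where wgt(N) is the
    signed power of order 2j + 1, a martingale increment wgt(N) m_n / n, and a
    second-order error of order h^2 |N|^(2j), where h = (|x_n| + 2) / n. By
    Young's inequality the error is at most
      delta h |N|^(2j+2) + C h^(j+2).
    The last term is summable, but the first one contains
    delta |N|^(2j+2) |x_n| / n, which is not. Because x_n is bounded below, |x_n|
    can be replaced by x_n up to a constant, and the resulting term is of first
    order in the increment of N: it is cancelled by subtracting a small multiple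
    of |N|^(2j+2) from the derivative of the Lyapunov function ([lyap],
    [lyap_step]).

    The Lyapunov function is nonnegative, so the martingale that remains is
    bounded below along each path, hence converges almost surely
    ([bounded_below_martingale_cvg]). Then the Lyapunov function converges along
    N and the series of N wgt(N) / n is finite; as the harmonic series diverges,
    the limit is 0 ([run_mean_cvg0]). *)

(** * A Lyapunov function for running means *)

Section lyapunov_function.
Context {R : realType}.
Implicit Types (a b c x y z g h delta K : R) (j n : nat).

Definition clip z := Num.max (-1) (Num.min 1 z).

Variant clip_spec z : R -> Prop :=
| ClipGe of 1 <= z : clip_spec z 1
| ClipLe of z <= -1 : clip_spec z (-1)
| ClipId of -1 <= z <= 1 : clip_spec z z.

Lemma clipP z : clip_spec z (clip z).
Proof.
rewrite /clip; have [z1|z1] := leP 1 z.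
  by rewrite max_r; [exact: ClipGe|lra].
have [z2|z2] := leP z (-1); first exact: ClipLe.
by apply: ClipId; lra.
Qed.

Lemma clip_bound z : -1 <= clip z <= 1.
Proof. by case: clipP; lra. Qed.

Lemma clip_norm_le1 z : `|clip z| <= 1.
Proof. by rewrite ler_norml clip_bound. Qed.

Lemma clip_lip y z : `|clip y - clip z| <= `|y - z|.
Proof.
have := ler_norm (y - z); have := ler_norm (z - y); rewrite (distrC z y).
by rewrite ler_norml; case: (clipP y); case: (clipP z); lra.
Qed.

Lemma clip_homo : {homo clip : x y / x <= y}.
Proof. by move=> x y; case: (clipP x); case: (clipP y); lra. Qed.

Lemma clip_id z : -1 <= z <= 1 -> clip z = z.
Proof. by case: clipP; lra. Qed.

Lemma clip0 : clip 0 = 0.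
Proof. by rewrite clip_id//; lra. Qed.

Lemma clip_ge1 z : 1 <= z -> clip z = 1.
Proof. by case: clipP; lra. Qed.

Lemma clip_leN1 z : z <= -1 -> clip z = -1.
Proof. by case: clipP; lra. Qed.

Lemma pow_lip n a x y : `|x| <= a -> `|y| <= a ->
  `|y ^+ n.+1 - x ^+ n.+1| <= n.+1%:R * a ^+ n * `|y - x|.
Proof.
move=> xa ya; have a0 : 0 <= a by apply: le_trans xa.
elim: n => [|n IH]; first by rewrite !expr1 expr0 !mul1r.
have -> : y ^+ n.+2 - x ^+ n.+2 =
    y * (y ^+ n.+1 - x ^+ n.+1) + (y - x) * x ^+ n.+1 by rewrite !exprS; ring.
apply: le_trans (ler_normD _ _) _; rewrite !normrM normrX.
have h1 : `|y| * `|y ^+ n.+1 - x ^+ n.+1| <= a * (n.+1%:R * a ^+ n * `|y - x|).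
  by apply: ler_pM.
have h2 : `|y - x| * `|x| ^+ n.+1 <= `|y - x| * a ^+ n.+1.
  by apply: ler_wpM2l => //; apply: lerXn2r; rewrite ?nnegrE.
apply: le_trans (lerD h1 h2) _.
rewrite le_eqVlt; apply/orP; left; apply/eqP.
by rewrite -[n.+2%:R]natr1 !exprS; ring.
Qed.

(** The powers |z|^(2j+1) with the sign of z, and |z|^(2j+2), both frozen outside
    [-1, 1]. Boundedness keeps the weight of the martingale increments bounded. *)
Definition wgt j z := clip z ^+ j.*2.+1.
Definition chi j z := clip z ^+ j.*2.+2.

Lemma chiE j z : chi j z = wgt j z * clip z.
Proof. by rewrite /chi exprSr. Qed.

Lemma chi_ge0 j z : 0 <= chi j z.
Proof. by rewrite /chi -doubleS -muln2 mulnC exprM exprn_ge0// sqr_ge0. Qed.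

Lemma wgt_norm_le1 j z : `|wgt j z| <= 1.
Proof. by rewrite /wgt normrX exprn_ile1// clip_norm_le1. Qed.

Lemma wgtE j z : wgt j z = clip z * clip z ^+ j.*2.
Proof. by rewrite /wgt exprS. Qed.

Lemma exprn_double_ge0 j x : 0 <= x ^+ j.*2.
Proof. by rewrite -muln2 mulnC exprM exprn_ge0// sqr_ge0. Qed.

(** The factor 1 + |z| lets a multiple of the restoring drift [wgt j z * z] absorb
    errors of size [chi j z] and [chi j z * z] alike. *)
Lemma chi_le_wgtM j z : chi j z * (1 + `|z|) <= 2 * (wgt j z * z).
Proof.
rewrite chiE; have [z1|z1] := leP 1 z.
  by rewrite /wgt clip_ge1// !expr1n ger0_norm; lra.
have [z2|z2] := leP z (-1).
  rewrite /wgt clip_leN1// exprS -muln2 mulnC exprM sqrrN expr1n expr1n.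
  by rewrite ler0_norm; lra.
rewrite -subr_ge0.
have -> : 2 * (wgt j z * z) - wgt j z * clip z * (1 + `|z|) =
    z ^+ j.*2 * z ^+ 2 * (1 - `|z|).
  by rewrite wgtE clip_id; [ring | lra].
apply: mulr_ge0; first by rewrite mulr_ge0 ?exprn_double_ge0 ?sqr_ge0.
by rewrite subr_ge0 ler_norml; lra.
Qed.

Lemma wgtM_ge0 j z : 0 <= wgt j z * z.
Proof.
have := chi_le_wgtM j z; have : 0 <= chi j z * (1 + `|z|).
  by rewrite mulr_ge0 ?chi_ge0// addr_ge0.
lra.
Qed.

Lemma chi_le_wgt j z : chi j z <= wgt j z * z.
Proof.
rewrite chiE; have [z1|z1] := leP 1 z.
  by rewrite /wgt clip_ge1// !expr1n; lra.
have [z2|z2] := leP z (-1).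
  by rewrite /wgt clip_leN1// exprS -muln2 mulnC exprM sqrrN expr1n expr1n; lra.
by rewrite clip_id; lra.
Qed.

(** The derivative of the Lyapunov function. The term [delta * chi j z] produces
    the drift that cancels the part of the second-order error proportional to
    the new value of the sequence. *)
Definition slope j delta z := wgt j z - delta * chi j z.

Definition primitive_poly j delta : {poly R} :=
  (j.*2.+2%:R^-1) *: 'X^(j.*2.+2) - (delta / j.*2.+3%:R) *: 'X^(j.*2.+3).

(** The primitive of [slope] that vanishes at 0; it is affine on either side of
    [-1, 1], where [slope] is constant. *)
Definition lyap j delta z :=
  slope j delta z * (z - clip z) + (primitive_poly j delta).[clip z].

Lemma derivXS n : ('X^(n.+1) : {poly R})^`() = 'X^n *+ n.+1.
Proof. exact: derivXn. Qed.

Lemma primitive_poly_deriv j delta c :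
  ((primitive_poly j delta)^`()).[c] = c ^+ j.*2.+1 - delta * c ^+ j.*2.+2.
Proof.
rewrite /primitive_poly derivB !derivZ !derivXS.
rewrite hornerD hornerN !hornerZ !hornerMn !hornerXn.
rewrite -(mulr_natr (c ^+ j.*2.+1)) -(mulr_natr (c ^+ j.*2.+2)).
have : j.*2.+2%:R != 0 :> R by rewrite pnatr_eq0.
have : j.*2.+3%:R != 0 :> R by rewrite pnatr_eq0.
move: (j.*2.+2%:R : R) (j.*2.+3%:R : R) => u v v0 u0.
move: (c ^+ _) (c ^+ _) => s t.
by field; rewrite u0 v0.
Qed.

Lemma slope_clip j delta z : slope j delta (clip z) = slope j delta z.
Proof. by rewrite /slope /wgt /chi clip_id ?clip_bound. Qed.

(** On [-1, 1] the derivative of [slope] is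
    z^(2j) (2j + 1 - delta (2j + 2) z), which is nonnegative for delta <= 1/2. *)
Lemma slope_homo j delta : 0 <= delta <= 2^-1 ->
  {homo slope j delta : x y / x <= y}.
Proof.
move=> d01.
suff main x y : -1 <= x -> x < y -> y <= 1 -> slope j delta x <= slope j delta y.
  move=> x y; rewrite le_eqVlt => /predU1P[->//|xy].
  have [cxy|] := ltP (clip x) (clip y).
    rewrite -(slope_clip j delta x) -(slope_clip j delta y); apply: main => //.
      by case/andP: (clip_bound x).
    by case/andP: (clip_bound y).
  move=> cyx; rewrite -(slope_clip j delta x) -(slope_clip j delta y).
  suff -> : clip x = clip y by [].
  by apply/eqP; rewrite eq_le cyx clip_homo// ltW.
move=> x1 xy y1.
pose p : {poly R} := 'X^(j.*2.+1) - delta *: 'X^(j.*2.+2).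
have pE c : -1 <= c <= 1 -> slope j delta c = p.[c].
  by move=> c1; rewrite /slope /wgt /chi clip_id// /p hornerD hornerN hornerZ !hornerXn.
rewrite !pE; try lra.
have [c cxy /eqP] := polyrcf.poly_mvt p xy.
rewrite subr_eq => /eqP ->; rewrite lerDr mulr_ge0//; last lra.
have {}cxy : x < c < y by move: cxy; rewrite in_itv.
rewrite /p derivB derivZ !derivXS.
rewrite hornerD hornerN !hornerZ !hornerMn !hornerXn exprSr.
rewrite -(mulr_natr (c ^+ j.*2)) -(mulr_natr (_ * c)).
have -> : c ^+ j.*2 * j.*2.+1%:R - delta * (c ^+ j.*2 * c * j.*2.+2%:R) =
   c ^+ j.*2 * (j.*2.+1%:R - delta * j.*2.+2%:R * c) by ring.
rewrite mulr_ge0 ?exprn_double_ge0// subr_ge0.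
have j0 : (0:R) <= j%:R by [].
have j1 : j.*2.+2%:R = 2 * j%:R + 2 :> R.
  by rewrite -muln2 -addn2 natrD natrM mulrC.
have j2 : j.*2.+1%:R = 2 * j%:R + 1 :> R.
  by rewrite -muln2 -addn1 natrD natrM mulrC.
have : delta * j.*2.+2%:R <= j%:R + 1.
  apply: le_trans (_ : 2^-1 * j.*2.+2%:R <= _); last by rewrite j1; lra.
  by apply: ler_wpM2r => //; lra.
have : 0 <= delta * j.*2.+2%:R by rewrite mulr_ge0//; lra.
rewrite j2; set u := delta * _ => u0 u1; nra.
Qed.

Lemma slope0 j delta : slope j delta 0 = 0.
Proof. by rewrite /slope /wgt /chi clip0 !expr0n /=; lra. Qed.

(** The tangent inequality at y: by the mean value theorem on [-1, 1] and
    affinity outside it, [lyap] is convex because [slope] is nondecreasing. *)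
Lemma lyap_convex j delta x y : 0 <= delta <= 2^-1 ->
  lyap j delta y - lyap j delta x <= slope j delta y * (y - x).
Proof.
move=> d01; have hom := slope_homo j d01.
have Q a b : -1 <= a <= 1 -> -1 <= b <= 1 ->
    (primitive_poly j delta).[b] - (primitive_poly j delta).[a] <=
      slope j delta b * (b - a).
  move=> a1 b1.
  have sE c : -1 <= c <= 1 -> ((primitive_poly j delta)^`()).[c] = slope j delta c.
    by move=> c1; rewrite primitive_poly_deriv /slope /wgt /chi clip_id.
  have [ab|ba|->] := ltgtP a b; last by rewrite !subrr mulr0.
  - have [c cab ->] := polyrcf.poly_mvt (primitive_poly j delta) ab.
    have {}cab : a < c < b by move: cab; rewrite in_itv.
    rewrite sE; last lra.
    by apply: ler_wpM2r; [lra|apply: hom; lra].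
  - have [c cab] := polyrcf.poly_mvt (primitive_poly j delta) ba.
    have {}cab : b < c < a by move: cab; rewrite in_itv.
    rewrite sE; last lra.
    have : slope j delta b <= slope j delta c by apply: hom; lra.
    by move=> h1 h2; nra.
have := Q _ _ (clip_bound x) (clip_bound y); rewrite slope_clip => Qxy.
suff : (slope j delta y - slope j delta x) * (x - clip x) <= 0.
  by rewrite /lyap; nra.
have [z1|z1] := leP 1 x.
  rewrite (clip_ge1 z1) mulr_le0_ge0 ?subr_ge0// subr_le0.
  rewrite -(slope_clip _ _ x) -(slope_clip _ _ y) (clip_ge1 z1).
  by apply: hom; case/andP: (clip_bound y).
have [z2|z2] := leP x (-1).
  rewrite (clip_leN1 z2) mulr_ge0_le0 ?subr_ge0//; last lra.
  rewrite -(slope_clip _ _ x) -(slope_clip _ _ y) (clip_leN1 z2).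
  by apply: hom; case/andP: (clip_bound y).
by rewrite clip_id; [rewrite subrr mulr0|lra].
Qed.

Lemma lyap0 j delta : lyap j delta 0 = 0.
Proof.
by rewrite /lyap slope0 mul0r clip0 add0r /primitive_poly hornerD hornerN !hornerZ !hornerXn !expr0n !mulr0 subrr.
Qed.

Lemma lyap_ge0 j delta z : 0 <= delta <= 2^-1 -> 0 <= lyap j delta z.
Proof.
by move=> /(lyap_convex j z 0); rewrite slope0 lyap0 mul0r sub0r oppr_le0.
Qed.

Lemma slopeE j delta z : slope j delta z = wgt j z * (1 - delta * clip z).
Proof. by rewrite /slope chiE; ring. Qed.

Lemma lyap_le j delta z : 0 <= delta <= 2^-1 ->
  lyap j delta z <= 2 * (wgt j z * z).
Proof.
move=> d01; have := lyap_convex j 0 z d01; rewrite lyap0 !subr0 => /le_trans; apply.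
have := wgtM_ge0 j z; rewrite slopeE; have := clip_bound z.
set c := clip z; set w := wgt j z => c1 wz.
have -> : w * (1 - delta * c) * z = w * z * (1 - delta * c) by ring.
have h : 0 <= 1 + delta * c by nra.
have := mulr_ge0 wz h; lra.
Qed.

(** The tangent inequality between z and z / 2 shows that [lyap] increases by a
    definite amount along that segment: a small value of [lyap] forces a small
    z. *)
Lemma lyap_ge j delta z : 0 <= delta <= 2^-1 ->
  2^-1 * chi j (z / 2) <= lyap j delta z.
Proof.
move=> d01; have := lyap_convex j z (z / 2) d01.
have := lyap_ge0 j (z/2) d01; have := chi_le_wgt j (z / 2).
have -> : slope j delta (z / 2) * (z / 2 - z) = - (wgt j (z/2) * (z/2)) * (1 - delta * clip (z / 2)).
  by rewrite slopeE; field.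
have := clip_bound (z / 2); have := chi_ge0 j (z / 2).
set c := clip _; set w := wgt j _ * _ => x0 c1; set X := chi _ _ in x0 * => Xw l0.
have h : 2^-1 <= 1 - delta * c by nra.
have w0 : 0 <= w by lra.
have := mulr_ge0 w0 (_ : 0 <= 1 - delta * c - 2^-1); lra.
Qed.

(** Two cases: the first term on the right dominates if g <= delta a^2, the second
    one otherwise. *)
Lemma young_gap j a g delta : 0 <= g -> 0 < delta ->
  g * a ^+ j.*2 <= delta * a ^+ j.*2.+2 + g ^+ j.+1 / delta ^+ j.
Proof.
move=> g0 d0.
have -> : a ^+ j.*2 = (a ^+ 2) ^+ j by rewrite -exprM mulnC muln2.
have -> : a ^+ j.*2.+2 = (a ^+ 2) ^+ j.+1 by rewrite -exprM mulnC muln2.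
have : 0 <= a ^+ 2 by exact: sqr_ge0.
move: (a ^+ 2) => s s0; have [gs|gs] := leP g (delta * s).
  apply: le_trans (_ : delta * s * s ^+ j <= _).
    by apply: ler_wpM2r => //; exact: exprn_ge0.
  by rewrite exprS mulrA lerDl divr_ge0 ?exprn_ge0// ltW.
apply: le_trans (_ : g ^+ j.+1 / delta ^+ j <= _); last first.
  by rewrite lerDr mulr_ge0 ?exprn_ge0// ltW.
rewrite exprS -mulrA -expr_div_n; apply: ler_wpM2l => //.
apply: lerXn2r; rewrite ?nnegrE// ?divr_ge0 ?(ltW d0)//.
by rewrite ler_pdivlMr// mulrC ltW.
Qed.

Lemma young_odd j x b delta : 0 < delta ->
  `|x| ^+ j.+1 * `|b| <= delta * `|x| ^+ j.+2 + `|b| ^+ j.+2 / delta ^+ j.+1.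
Proof.
move=> d0; move: `|x| (normr_ge0 x) `|b| (normr_ge0 b) => s s0 g g0.
have [gs|gs] := leP g (delta * s).
  apply: le_trans (_ : s ^+ j.+1 * (delta * s) <= _).
    by apply: ler_wpM2l => //; exact: exprn_ge0.
  by rewrite (exprSr s j.+1) mulrCA lerDl divr_ge0 ?exprn_ge0// (ltW d0).
apply: le_trans (_ : g ^+ j.+2 / delta ^+ j.+1 <= _); last first.
  by rewrite lerDr mulr_ge0 ?exprn_ge0// ltW.
rewrite (exprSr g j.+1) mulrAC -expr_div_n; apply: ler_wpM2r => //.
apply: lerXn2r; rewrite ?nnegrE// ?divr_ge0 ?(ltW d0)//.
by rewrite ler_pdivlMr// mulrC ltW.
Qed.

End lyapunov_function.

(** * One step of the running mean *)

Section lyapunov_step.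
Context {R : realType}.
Implicit Types (a b c x y z g h delta K : R) (j n : nat).

Lemma wgt_lip j a y z : `|clip y| <= a -> `|clip z| <= a ->
  `|wgt j y - wgt j z| <= j.*2.+1%:R * a ^+ j.*2 * `|clip y - clip z|.
Proof. by move=> ya za; exact: pow_lip. Qed.

Lemma slope_lip j delta a y z : 0 <= delta <= 2^-1 -> a <= 2 ->
    `|clip y| <= a -> `|clip z| <= a ->
  `|slope j delta y - slope j delta z| <=
    4 * j.+1%:R * a ^+ j.*2 * `|clip y - clip z|.
Proof.
move=> d01 a2 ya za; have a0 : 0 <= a by apply: le_trans ya.
have -> : slope j delta y - slope j delta z =
    (wgt j y - wgt j z) - delta * (chi j y - chi j z) by rewrite /slope; ring.
apply: le_trans (ler_normB _ _) _; rewrite normrM (ger0_norm (_ : 0 <= delta)); last lra.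
have h1 := wgt_lip j ya za.
have h2 : `|chi j y - chi j z| <= j.*2.+2%:R * a ^+ j.*2.+1 * `|clip y - clip z|.
  exact: pow_lip.
have j1 : j.*2.+2%:R = 2 * j.+1%:R :> R by rewrite -doubleS -muln2 natrM mulrC.
have j2 : j.*2.+1%:R = 2 * j.+1%:R - 1 :> R by rewrite -j1 -[j.*2.+2%:R]natr1; ring.
move: h1 h2; rewrite j1 j2; set v := `|clip y - clip z|.
have J1 : 1 <= j.+1%:R :> R by rewrite ler1n.
move: (j.+1%:R : R) J1 => J J1.
rewrite exprS; set A := a ^+ j.*2; move=> h1 h2.
have A0 : 0 <= A by exact: exprn_double_ge0.
have v0 : 0 <= v by exact: normr_ge0.
have Av0 : 0 <= A * v by rewrite mulr_ge0.
have h3 : delta * `|chi j y - chi j z| <= 2^-1 * (2 * J * (a * A) * v).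
  by apply: ler_pM => //; lra.
have h4 : a * (A * v) <= 2 * (A * v) by apply: ler_wpM2r.
have h5 : J * (a * (A * v)) <= J * (2 * (A * v)) by apply: ler_wpM2l => //; lra.
have : 0 <= J * (A * v) by rewrite mulr_ge0//; lra.
nra.
Qed.

Lemma exprnD_le n a b : 0 <= a -> 0 <= b ->
  (a + b) ^+ n <= 2 ^+ n * (a ^+ n + b ^+ n).
Proof.
move=> a0 b0; have [ab|/ltW ba] := leP a b.
  apply: le_trans (_ : (2 * b) ^+ n <= _).
    by apply: lerXn2r; rewrite ?nnegrE; lra.
  by rewrite exprMn ler_wpM2l ?exprn_ge0// lerDr exprn_ge0.
apply: le_trans (_ : (2 * a) ^+ n <= _).
  by apply: lerXn2r; rewrite ?nnegrE; lra.
by rewrite exprMn ler_wpM2l ?exprn_ge0// lerDl exprn_ge0.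
Qed.

(** The second-order error of one step. Far from [-1, 1] the clipped value does
    not move at all; near it the increment of the mean is at most [h], so the
    two derivatives vary by at most a constant times h (|N| + g)^(2j), and Young's
    inequality separates N from g. *)
Lemma variation_bound j (eta : R) : 0 < eta -> exists2 C : R, 0 <= C &
  forall delta N x (n : R) b, 0 <= delta <= 2^-1 -> 4 <= n ->
    let N' := N + (x - N) / n in
    let h := (`|x| + 2) / n in
    let g := h + `|b| in
    g <= 2^-1 ->
    (slope j delta N' - slope j delta N) * (N' - N) + (wgt j N' - wgt j N) * b
    <= h * (eta * chi j N + C * g ^+ j.+1).
Proof.
move=> eta0; pose J : R := 4 * j.+1%:R; pose e1 := eta / 2 ^+ j.*2.+2.
have J1 : 4 <= J by rewrite /J ler_peMr// ler1n.
have J2 : j.*2.+1%:R <= J.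
  have -> : j.*2.+1%:R = 2 * j.+1%:R - 1 :> R.
    by rewrite -addn1 -[j.+1]addn1 !natrD -muln2 natrM; ring.
  by rewrite /J; have : 0 <= j.+1%:R :> R by []; lra.
have e10 : 0 < e1 by rewrite divr_gt0// exprn_gt0.
have C0 : 0 <= eta + J ^+ j.+1 / e1 ^+ j.
  by rewrite addr_ge0 ?(ltW eta0)// divr_ge0// exprn_ge0//; lra.
exists (eta + J ^+ j.+1 / e1 ^+ j) => //.
move=> delta N x n b d01 n4 N' h g g2.
have n0 : 0 < n by lra.
have h0 : 0 < h by rewrite /h divr_gt0//; have := normr_ge0 x; lra.
have gh : h <= g by rewrite /g lerDl.
have xn : `|x / n| <= h.
  rewrite /h normrM normfV (gtr0_norm n0) ler_pM2r ?invr_gt0//; lra.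
have nV : 0 < n^-1 <= 4^-1 by rewrite invr_gt0 n0 lef_pV2 ?posrE.
have N'E : N' = N * (1 - n^-1) + x / n by rewrite /N'; ring.
have rhs0 : 0 <= h * (eta * chi j N + (eta + J ^+ j.+1 / e1 ^+ j) * g ^+ j.+1).
  apply: mulr_ge0; first exact: ltW.
  apply: addr_ge0; apply: mulr_ge0; rewrite ?chi_ge0 ?(ltW eta0)//.
  by rewrite exprn_ge0//; lra.
have same : clip N' = clip N ->
    (slope j delta N' - slope j delta N) * (N' - N) + (wgt j N' - wgt j N) * b
    <= h * (eta * chi j N + (eta + J ^+ j.+1 / e1 ^+ j) * g ^+ j.+1).
  by move=> cE; rewrite /slope /wgt /chi cE !subrr !mul0r addr0.
move: (xn); rewrite ler_norml => xn'.
have [N2|N2] := leP 2 N.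
  by apply: same; rewrite !clip_ge1//; [lra|rewrite N'E; nra].
have [N2'|N2'] := leP N (-2).
  by apply: same; rewrite !clip_leN1//; [lra|rewrite N'E; nra].
have NN : `|N' - N| <= h.
  rewrite /N' /h addrC addKr normrM normfV (gtr0_norm n0) ler_pM2r ?invr_gt0//.
  by apply: le_trans (ler_normB _ _) _; rewrite lerD2l ler_norml; lra.
pose a := `|clip N| + g.
have cNN := le_trans (clip_lip N' N) NN.
have aN : `|clip N| <= a by rewrite /a lerDl; lra.
have aN' : `|clip N'| <= a.
  rewrite /a -(subrK (clip N) (clip N')) addrC.
  by apply: le_trans (ler_normD _ _) _; rewrite lerD2l; lra.
have a2 : a <= 2 by rewrite /a; have := clip_norm_le1 N; lra.
have a0 : 0 <= a by rewrite (le_trans _ aN).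
have A0 : 0 <= a ^+ j.*2 by exact: exprn_double_ge0.
have L1 : `|slope j delta N' - slope j delta N| <= J * a ^+ j.*2 * h.
  apply: le_trans (slope_lip j d01 a2 aN' aN) _.
  by apply: ler_wpM2l => //; rewrite mulr_ge0//; rewrite -/J; lra.
have L2 : `|wgt j N' - wgt j N| <= J * a ^+ j.*2 * h.
  apply: le_trans (wgt_lip j aN' aN) _.
  apply: ler_pM => //; first by rewrite mulr_ge0.
  by apply: ler_wpM2r.
have E1 : (slope j delta N' - slope j delta N) * (N' - N) <= J * a ^+ j.*2 * h * h.
  by apply: le_trans (ler_norm _) _; rewrite normrM ler_pM.
have E2 : (wgt j N' - wgt j N) * b <= J * a ^+ j.*2 * h * `|b|.
  by apply: le_trans (ler_norm _) _; rewrite normrM ler_wpM2r.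
have E3 : J * a ^+ j.*2 * h * h + J * a ^+ j.*2 * h * `|b| = h * (J * g * a ^+ j.*2).
  by rewrite /g; ring.
apply: le_trans (lerD E1 E2) _; rewrite E3; apply: ler_wpM2l; first exact: ltW.
have g0 : 0 <= g by lra.
have Jg : 0 <= J * g by rewrite mulr_ge0//; lra.
apply: le_trans (young_gap j a Jg e10) _.
have /(ler_wpM2l (ltW e10)) E4 := exprnD_le j.*2.+2 (normr_ge0 (clip N)) g0.
apply: le_trans (lerD E4 (lexx _)) _.
have -> : e1 * (2 ^+ j.*2.+2 * (`|clip N| ^+ j.*2.+2 + g ^+ j.*2.+2)) =
    eta * (`|clip N| ^+ j.*2.+2 + g ^+ j.*2.+2).
  rewrite mulrA /e1 divfK//; apply: expf_neq0; lra.
have -> : `|clip N| ^+ j.*2.+2 = chi j N by rewrite -normrX ger0_norm// chi_ge0.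
have g1 : g ^+ j.*2.+2 <= g ^+ j.+1.
  have jj : (j.+1 <= j.*2.+2)%N by rewrite -addnn !ltnS leqW// leq_addr.
  have g1 : g <= 1 by lra.
  exact: (ler_wiXn2l g0 g1 jj).
rewrite exprMn mulrDr mulrDl -!addrA lerD2l [J ^+ _ * _ / _]mulrAC lerD2r.
by rewrite ler_wpM2l// ltW.
Qed.

(** The convexity inequality replaces the increment of [lyap] by
    [slope N' * (x - N) / n], and freezing the slope at N costs the error of
    [variation_bound]. Writing x through the martingale increment turns
    [wgt N * x / n] into [wgt N * m / n] and a telescoping part, which is put on
    the left-hand side. The small constant delta is chosen so that half of the
    drift [wgt N * N / n] absorbs all terms in [delta * chi N]. *)
Lemma lyap_step j K : 0 <= K -> exists delta C, [/\ 0 < delta <= 2^-1, 0 <= C &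
  forall N x (m p p' r n : R), 4 <= n -> - K <= x -> x = m + p - p' + r ->
    let N' := N + (x - N) / n in
    let b := p / (n - 1) in
    let g := (`|x| + 2 + `|p'|) / n in
    g <= 2^-1 ->
    (lyap j delta N' + wgt j N' * (p' / n)) - (lyap j delta N + wgt j N * b) <=
    wgt j N * m / n - 2^-1 * (wgt j N * N / n) +
      (`|r| / n + C * g ^+ j.+2 + C * `|b| ^+ j.*2.+2)].
Proof.
move=> K0; pose delta : R := (4 * (2 * K + 3))^-1.
have d0 : 0 < delta by rewrite invr_gt0; lra.
have d2 : delta <= 2^-1 by rewrite lef_pV2 ?posrE; lra.
have [C0 C00 var] := variation_bound j d0.
exists delta, (C0 + (delta ^+ j.*2.+1)^-1); split; first by rewrite d0.
  by rewrite addr_ge0// invr_ge0 exprn_ge0// ltW.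
move=> N x m p p' r n n4 xK xE N' b g g2.
have d01 : 0 <= delta <= 2^-1 by rewrite (ltW d0).
have n0 : 0 < n by lra.
have nV : 0 < n^-1 by rewrite invr_gt0.
have hg : (`|x| + 2) / n + `|p' / n| = g.
  by rewrite normrM normfV (gtr0_norm n0) -mulrDl.
have := var delta N x n (p' / n) d01 n4; rewrite -/N' /= hg => /(_ g2).
set h := (`|x| + 2) / n; set X := chi j N; set E := _ + _ => Eb.
have X0 : 0 <= X by exact: chi_ge0.
have conv := lyap_convex j N N' d01.
(* the bound on h is what makes positivity of x + K useful: the part of the
   error that is proportional to x is cancelled by the slope correction *)
have hx : h <= (x + 2 * K + 2) / n.
  by rewrite /h ler_pM2r//; have [x0|x0] := leP 0 x; [rewrite ger0_norm//|rewrite ltr0_norm//]; lra.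
have hle : h <= g by rewrite /g /h ler_pM2r// lerDl.
have g0 : 0 <= g by rewrite -hg addr_ge0// /h divr_ge0 ?(ltW n0)// addr_ge0.
have Eb2 : E <= delta * X * ((x + 2 * K + 2) / n) + C0 * g ^+ j.+2.
  apply: le_trans Eb _; rewrite mulrDr; apply: lerD.
    by rewrite mulrC; apply: ler_wpM2l => //; apply: mulr_ge0 => //; exact: ltW.
  rewrite mulrCA; apply: ler_wpM2l => //; rewrite (exprS g j.+1).
  by apply: ler_wpM2r => //; exact: exprn_ge0.
set w := wgt j N in E Eb Eb2 *; set w' := wgt j N' in E Eb Eb2 *.
have odd : - (w * b / n) <= delta * X / n + `|b| ^+ j.*2.+2 / delta ^+ j.*2.+1.
  have yo := young_odd j.*2 (clip N) b d0.
  have wb : `|w * b| <= delta * X + `|b| ^+ j.*2.+2 / delta ^+ j.*2.+1.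
    rewrite normrM /w /wgt normrX; apply: le_trans yo _; rewrite lerD2r ler_pM2l//.
    by rewrite -normrX ger0_norm// chi_ge0.
  apply: le_trans (_ : (delta * X + `|b| ^+ j.*2.+2 / delta ^+ j.*2.+1) / n <= _).
    by rewrite -mulNr ler_pM2r// (le_trans _ wb)// -normrN ler_norm.
  rewrite mulrDl lerD2l ler_piMr//; last by rewrite invf_le1//; lra.
  by rewrite divr_ge0 ?exprn_ge0// ltW.
have pE : p = b * (n - 1) by rewrite /b divfK//; lra.
have mE : w * m / n = w * x / n - w * b + w * b / n + w * (p' / n) - w * r / n.
  have -> : m = x - b * (n - 1) + p' - r by rewrite -pE xE; ring.
  by field; lra.
have wr : w * r / n <= `|r| / n.
  rewrite ler_pM2r//; apply: le_trans (ler_norm _) _.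
  by rewrite normrM ler_piMl// wgt_norm_le1.
have dN : delta * X * (N + 2 * K + 3) <= 2^-1 * (w * N).
  have XN : X * (N + 2 * K + 3) <= (2 * K + 3) * (X * (1 + `|N|)).
    rewrite mulrCA ler_wpM2l//; have := ler_norm N; have := normr_ge0 N; nra.
  have := chi_le_wgtM j N; rewrite -/X -/w => XN2.
  have XN3 : X * (N + 2 * K + 3) <= (2 * K + 3) * (2 * (w * N)).
    by apply: le_trans XN _; rewrite ler_wpM2l//; lra.
  rewrite -mulrA; apply: le_trans (ler_wpM2l (ltW d0) XN3) _.
  by rewrite le_eqVlt; apply/orP; left; apply/eqP; rewrite /delta; field; lra.
have {}dN : delta * X * (N + 2 * K + 3) / n <= 2^-1 * (w * N / n).
  by rewrite (mulrA 2^-1) ler_pM2r.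
have {}conv : lyap j delta N' - lyap j delta N <=
    w * x / n - w * N / n - delta * X * x / n + delta * X * N / n +
    (slope j delta N' - slope j delta N) * (N' - N).
  apply: le_trans conv _; rewrite le_eqVlt; apply/orP; left; apply/eqP.
  have DE : N' - N = (x - N) / n by rewrite /N'; ring.
  rewrite DE {3}/slope -/w -/X; ring.
have Cb : `|b| ^+ j.*2.+2 / delta ^+ j.*2.+1 <=
    (C0 + (delta ^+ j.*2.+1)^-1) * `|b| ^+ j.*2.+2.
  by rewrite mulrDl [leLHS]mulrC lerDr mulr_ge0// exprn_ge0.
have Cg : C0 * g ^+ j.+2 <= (C0 + (delta ^+ j.*2.+1)^-1) * g ^+ j.+2.
  by rewrite ler_wpM2r ?exprn_ge0// lerDl invr_ge0 exprn_ge0// (ltW d0).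
move: Cb Cg; set C := C0 + _ => Cb Cg.
have dNE : delta * X * (N + 2 * K + 3) / n =
  delta * X * N / n - delta * X * x / n + delta * X * ((x + 2 * K + 2) / n) + delta * X / n.
  by ring.
have EE : E = (slope j delta N' - slope j delta N) * (N' - N) + (w' * (p' / n) - w * (p' / n)).
  by rewrite /E; ring.
move: conv odd mE wr dN Eb2 Cb Cg; rewrite dNE EE.
clearbody w w' N' b g X C; move: (slope j delta N' - _) (lyap _ _ _) (lyap _ _ _).
move: (`|b| ^+ _ / _) (C0 * _) (C * _) (C * _) (`|r| / n) (w * r / n) (p' / n) => ? ? ? ? ? ? ? ? ? ?.
clear; lra.
Qed.

End lyapunov_step.

(** * Running means along a path *)

Section nonneg_series.
Context {R : realType}.
Implicit Types u v : R^nat.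

Lemma series_bounded_cvg u B : (forall n, 0 <= u n) ->
  (forall n, series u n <= B) -> cvgn (series u).
Proof.
move=> u0 uB; apply: nondecreasing_is_cvgn; first exact: nondecreasing_series.
by exists B => _ [n _ <-].
Qed.

Lemma cvg_seq_bound u : cvgn u -> exists B, forall n, `|u n| <= B.
Proof.
move=> /cvg_seq_bounded [M [_ /(_ (M + 1))]].
rewrite ltrDl => /(_ ltr01) uM.
by exists (M + 1) => n; exact: uM.
Qed.

Lemma cvg0_small u e : u @ \oo --> (0 : R) -> 0 < e ->
  exists n0, forall n, (n0 <= n)%N -> `|u n| <= e.
Proof.
move=> /cvgrPdist_le /[apply] -[n0 _ h]; exists n0 => n n0n.
by have := h n n0n; rewrite sub0r normrN.
Qed.

End nonneg_series.

Section pathwise.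
Context {R : realType}.
Variables (j : nat) (K : R) (x m p r : R^nat).

Definition run_mean n : R := n%:R^-1 * series x n.

Definition mart_incr k := wgt j (run_mean k) * m k / k.+1%:R.

Lemma run_meanS n :
  run_mean n.+1 = run_mean n + (x n - run_mean n) / n.+1%:R.
Proof.
rewrite /run_mean seriesSr; case: n => [|n].
  by rewrite /series /= big_geq// mulr0 !add0r subr0 mulrC.
have n0 : n.+1%:R != 0 :> R by rewrite pnatr_eq0.
have n1 : n.+2%:R != 0 :> R by rewrite pnatr_eq0.
have -> : n.+2%:R = n.+1%:R + 1 :> R by rewrite natr1.
rewrite -natr1 in n1.
move: (n.+1%:R : R) n0 n1 (series x n.+1) (x n.+1) => a a0 a1 ? ?.
by field; rewrite a0 a1.
Qed.

Hypothesis K0 : 0 <= K.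
Hypothesis x_decomp : forall n, x n = m n + p n - p n.+1 + r n.
Hypothesis x_low : exists n0, forall n, (n0 <= n)%N -> - K <= x n.
Let g k := (`|x k| + 2 + `|p k.+1|) / k.+1%:R.
Hypothesis g_sum : cvgn (series (fun k => g k ^+ j.+2)).
Hypothesis r_sum : cvgn (series (fun k => `|r k| / k.+1%:R)).
Hypothesis mart_cvg :
  (exists B, forall n, B <= series mart_incr n) -> cvgn (series mart_incr).

Let g0 k : 0 <= g k.
Proof. by rewrite divr_ge0// !addr_ge0. Qed.

Let g_small : exists n0, forall k, (n0 <= k)%N -> g k <= 2^-1.
Proof.
have e0 : 0 < (2^-1 : R) ^+ j.+2 by rewrite exprn_gt0.
have [n0 h] := cvg0_small (cvg_series_cvg_0 g_sum) e0.
exists n0 => k /h; rewrite ger0_norm ?exprn_ge0//.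
by rewrite ler_pXn2r// nnegrE.
Qed.

Let p_le_g k : `|p k.+1 / k.+1%:R| <= g k.
Proof.
rewrite normrM normfV (ger0_norm (_ : 0 <= k.+1%:R))// ler_pM2r ?invr_gt0//.
by rewrite lerDr addr_ge0.
Qed.

(** Adding up the steps, the Lyapunov function is nonnegative, so the martingale
    transform is bounded below and converges by [mart_cvg]. What is left is
    nonincreasing and bounded below up to convergent series; hence the Lyapunov
    function converges along the running means and its drift is summable. A
    positive limit would make the drift comparable to the harmonic series. *)
Theorem run_mean_cvg0 : run_mean @ \oo --> 0.
Proof.
have [delta [C [d01 C0 step]]] := lyap_step j K0.
have d02 : 0 <= delta <= 2^-1 by case/andP: d01 => /ltW -> ->.
pose Psi k := lyap j delta (run_mean k) + wgt j (run_mean k) * (p k / k%:R).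
pose v k := 2^-1 * (wgt j (run_mean k) * run_mean k / k.+1%:R).
pose a k := `|r k| / k.+1%:R + C * g k ^+ j.+2 + C * g k.-1 ^+ j.+2.
have v0 k : 0 <= v k by rewrite mulr_ge0// divr_ge0// wgtM_ge0.
have a0 k : 0 <= a k.
  apply: addr_ge0; last by apply: mulr_ge0 => //; exact: exprn_ge0.
  apply: addr_ge0; first exact: divr_ge0.
  by apply: mulr_ge0 => //; exact: exprn_ge0.
have [n1 xlow] := x_low; have [n2 gsm] := g_small.
pose n0 := (n1 + n2 + 4)%N.
have gsm' k : (n0 <= k)%N -> g k.-1 <= 2^-1.
  by move=> nk; apply: gsm; rewrite /n0 in nk; lia.
have bg k : (n0 <= k)%N -> `|p k / k%:R| <= g k.-1.
  by case: k => [|k] nk; [rewrite /n0 in nk; lia|exact: p_le_g].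
have stepk k : (n0 <= k)%N -> Psi k.+1 - Psi k <= mart_incr k - v k + a k.
  move=> nk.
  have k4 : 4 <= k.+1%:R :> R by rewrite ler_nat /n0 in nk *; lia.
  have xk : - K <= x k by apply: xlow; rewrite /n0 in nk; lia.
  have := step (run_mean k) _ _ _ _ _ _ k4 xk (x_decomp k).
  rewrite -run_meanS /= -/(g k) => /(_ (gsm _ _)) -/(_ _) h.
  have {}h := h (leq_trans _ nk).
  rewrite (_ : k.+1%:R - 1 = k%:R) in h; last by rewrite -natr1 addrK.
  apply: le_trans (h _) _; first by rewrite /n0; lia.
  rewrite lerD2l /a -!addrA lerD2l lerD2l; apply: ler_wpM2l => //.
  have b1 := bg k nk; have gk := gsm' k nk.
  apply: le_trans (_ : g k.-1 ^+ j.*2.+2 <= _).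
    by apply: lerXn2r => //; rewrite nnegrE.
  apply: ler_wiXn2l => //; first by lra.
  by rewrite !ltnS -addnn leq_addr.
have [SA aS] : exists SA, forall n, series a n <= SA.
  have [Br hr] := cvg_seq_bound r_sum; have [Bg hg] := cvg_seq_bound g_sum.
  exists (Br + C * Bg + C * (g 0 ^+ j.+2 + Bg)) => n.
  rewrite /series /= !big_split /= -!mulr_sumr; apply: lerD; first apply: lerD.
  - exact: le_trans (ler_norm _) (hr n).
  - by apply: ler_wpM2l => //; exact: le_trans (ler_norm _) (hg n).
  - apply: ler_wpM2l => //; case: n => [|n].
      rewrite big_geq// addr_ge0 ?exprn_ge0//.
      by rewrite (le_trans _ (hg 0%N)).
    rewrite big_nat_recl//= lerD2l.
    exact: le_trans (ler_norm _) (hg n).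
have a_cvg : cvgn (series a) by exact: series_bounded_cvg aS.
pose E k := Psi k - series mart_incr k - series a k + series v k.
have E_le k : (n0 <= k)%N -> E k.+1 <= E k.
  by move=> nk; have := stepk k nk; rewrite /E !seriesSr; lra.
have E_n0 k : (n0 <= k)%N -> E k <= E n0.
  elim: k => [|k IH]; first by rewrite leqn0 => /eqP ->.
  rewrite leq_eqVlt => /predU1P[<-//|]; rewrite ltnS => nk.
  exact: le_trans (E_le k nk) (IH nk).
have Psi_low k : (n0 <= k)%N -> -1 <= Psi k.
  move=> nk; rewrite /Psi.
  have : `|wgt j (run_mean k) * (p k / k%:R)| <= 1 * 2^-1.
    by rewrite normrM ler_pM ?wgt_norm_le1// (le_trans (bg k nk))// gsm'.
  by rewrite ler_norml; have := lyap_ge0 j (run_mean k) d02; lra.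
have sv0 k : 0 <= series v k by rewrite /series /= sumr_ge0.
have sa0 k : 0 <= series a k by rewrite /series /= sumr_ge0.
have D_cvg : cvgn (series mart_incr).
  apply: mart_cvg.
  exists (Num.min (-1 - E n0 - SA) (- \sum_(0 <= k < n0) `|mart_incr k|)) => n.
  rewrite ge_min; have [nn|nn] := leqP n0 n.
    have := E_n0 n nn; have := Psi_low n nn; have := aS n; have := sv0 n.
    by have := sa0 n; rewrite /E => h1 h2 h3 h4 h5; apply/orP; left; lra.
  apply/orP; right; rewrite lerNl; apply: le_trans (ler_norm _) _.
  rewrite normrN; apply: le_trans (ler_norm_sum _ _ _) _.
  by rewrite [leRHS](big_cat_nat (n := n))//= ?(ltnW nn)// lerDl sumr_ge0.
have [BD hD] := cvg_seq_bound D_cvg.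
have v_cvg : cvgn (series v).
  apply: (@series_bounded_cvg _ _ (E n0 + BD + SA + 1)) => // n.
  have vn : series v n <= series v (n + n0)%N.
    by apply: nondecreasing_series => //; rewrite leq_addr.
  apply: le_trans vn _; set k := (n + n0)%N.
  have nk : (n0 <= k)%N by rewrite leq_addl.
  have := E_n0 k nk; have := Psi_low k nk; have := aS k; have := hD k.
  by rewrite /E ler_norml => /andP[h1 h2] h3 h4 h5; lra.
have E_cvg : cvgn E.
  have : cvgn (fun n => E (n + n0)%N).
    apply: nonincreasing_is_cvgn.
      apply/nonincreasing_seqP => n; rewrite addSn; apply: E_le; exact: leq_addl.
    exists (-1 - BD - SA) => _ [n _ <-].
    set k := (n + n0)%N; have nk : (n0 <= k)%N by rewrite leq_addl.
    have := Psi_low k nk; have := aS k; have := hD k; have := sv0 k.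
    by rewrite /E ler_norml => h0 /andP[h1 h2] h3 h4; lra.
  by move=> /cvg_ex[l hl]; apply/cvg_ex; exists l; rewrite -(cvg_shiftn n0).
have b_cvg : (fun k => wgt j (run_mean k) * (p k / k%:R)) @ \oo --> 0.
  have gc : (fun k => g k ^+ j.+2) @ \oo --> (0 : R) := cvg_series_cvg_0 g_sum.
  apply/cvgrPdist_le => e e0.
  have e1 : 0 < e ^+ j.+2 by rewrite exprn_gt0.
  have [n3 h] := cvg0_small gc e1.
  exists (n3 + n0).+1 => // -[//|k] /= nk.
  rewrite sub0r normrN normrM -[leRHS]mul1r ler_pM ?wgt_norm_le1//.
  apply: le_trans (p_le_g k) _.
  have : `|g k ^+ j.+2| <= e ^+ j.+2 by apply: h; lia.
  by rewrite ger0_norm ?exprn_ge0// ler_pXn2r// nnegrE// ltW.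
pose L k := lyap j delta (run_mean k).
have LE : L = fun k => E k + series mart_incr k + series a k - series v k -
    wgt j (run_mean k) * (p k / k%:R).
  by apply/funext => k; rewrite /L /E /Psi; ring.
have L_cvg : cvgn L.
  rewrite LE; apply: is_cvgB; last by apply/cvg_ex; exists 0.
  by apply: is_cvgB => //; apply: is_cvgD => //; exact: is_cvgD.
have L0 k : 0 <= L k by exact: lyap_ge0.
have L_cvg0 : L @ \oo --> 0.
  suff <- : limn L = 0 by [].
  have l0 : 0 <= limn L by apply: limr_ge => //; near=> k.
  apply/eqP; rewrite eq_le l0 andbT leNgt; apply/negP => {}l0.
  set l := limn L in l0 *.
  have l2 : 0 < l / 2 by rewrite divr_gt0.
  have Ll : L @ \oo --> l by exact: L_cvg.
  move/cvgrPdist_le : Ll => /(_ _ l2) [n3 _ h3].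
  (* eventually lyap >= l / 2, and lyap <= 2 wgt N * N, so the drift v is at
     least l / 8 times the harmonic term *)
  have hv k : (n3 <= k)%N -> @harmonic R k <= 8 / l * v k.
    move=> /h3; rewrite /= -/l => hk.
    have Ll : l / 2 <= L k by move: hk; rewrite ler_norml; lra.
    have LwN : L k <= 2 * (wgt j (run_mean k) * run_mean k) by exact: lyap_le.
    have -> : 8 / l * v k = 4 / l * (wgt j (run_mean k) * run_mean k) * harmonic k.
      by rewrite /v /harmonic /=; move: (k.+1%:R^-1) (wgt _ _ * _) => u w; field; lra.
    rewrite -[leLHS]mul1r; apply: ler_wpM2r; first exact: harmonic_ge0.
    by rewrite mulrAC ler_pdivlMr// mul1r; lra.
  apply: (@dvg_harmonic R); apply: (@series_bounded_cvg _ _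
    (series harmonic n3 + 8 / l * (limn (series v)))) => [n|n].
    exact: harmonic_ge0.
  have hl0 : 0 <= 8 / l by rewrite divr_ge0// ltW.
  apply: le_trans (_ : series harmonic n3 + 8 / l * series v n <= _).
    have [nn|nn] := leqP n n3.
      apply: le_trans (_ : series harmonic n3 <= _).
        by apply: nondecreasing_series => // k _ _; exact: harmonic_ge0.
      by rewrite lerDl mulr_ge0.
    elim: n nn => [//|n IH]; rewrite ltnS leq_eqVlt => /predU1P[<-|nn].
      by rewrite !seriesSr mulrDr; have := hv n3 (leqnn _); have := mulr_ge0 hl0 (sv0 n3); lra.
    by rewrite !seriesSr mulrDr; have := hv n (ltnW nn); have := IH nn; lra.
  rewrite lerD2l ler_wpM2l//; apply: nondecreasing_cvgn_le => //.
  exact: nondecreasing_series.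
apply/cvgrPdist_le => e e0.
pose e1 := Num.min e 1.
have e10 : 0 < e1 by rewrite lt_min e0 ltr01.
have e1e : e1 <= e by rewrite ge_min lexx.
have e11 : e1 <= 1 by rewrite ge_min lexx orbT.
have e2 : 0 < 4^-1 * (e1 / 2) ^+ j.*2.+2 by rewrite mulr_gt0// exprn_gt0// divr_gt0.
have [n3 h3] := cvg0_small L_cvg0 e2.
exists n3 => // k /= /h3; rewrite ger0_norm// sub0r normrN => Lk.
apply: le_trans e1e; rewrite leNgt; apply/negP => Ne.
have := lyap_ge j (run_mean k) d02; rewrite -/(L k) => Lge.
have : (e1 / 2) ^+ j.*2.+2 <= chi j (run_mean k / 2).
  rewrite /chi -[leRHS]ger0_norm ?chi_ge0// normrX.
  apply: lerXn2r; rewrite ?nnegrE//; first by rewrite divr_ge0// ltW.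
  move: Ne; have := ler_norm (run_mean k); case: clipP => [h|h|h]; move: h.
  - by rewrite normr1; lra.
  - by rewrite normrN normr1; lra.
  - have -> : `|run_mean k / 2| = `|run_mean k| / 2.
      by move: (run_mean k) => z; rewrite normrM (@ger0_norm _ 2^-1).
    lra.
have : 0 < (e1 / 2) ^+ j.*2.+2 by rewrite exprn_gt0// divr_gt0.
lra.
Unshelve. all: by end_near. Qed.

End pathwise.

(** * Adapted variables, random series and integrability *)

Section sub_sigma_algebra.
Context {d : measure_display} {Omega : measurableType d}.
Variable (G : set (set Omega)).
Hypothesis sG : sigma_algebra setT G.

Lemma measurable_wrtP {d'} {S : measurableType d'} (Y : Omega -> S) :
  measurable_wrt G Y <->
  measurable_fun [set: g_sigma_algebraType G] (Y : g_sigma_algebraType G -> S).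
Proof.
split=> [GY _ B mB|mY B mB].
  by rewrite setTI measurable_g_measurableTypeE//; exact: GY.
by have := mY measurableT B mB; rewrite setTI measurable_g_measurableTypeE.
Qed.

Lemma measurable_wrt_set (A : set Omega) :
  G A <-> measurable (A : set (g_sigma_algebraType G)).
Proof. by rewrite measurable_g_measurableTypeE. Qed.

Lemma measurable_wrt_comp {d1 d2} {S1 : measurableType d1} {S2 : measurableType d2}
    (f : S1 -> S2) (Y : Omega -> S1) :
  measurable_fun setT f -> measurable_wrt G Y -> measurable_wrt G (f \o Y).
Proof.
move=> mf mY B mB; rewrite comp_preimage; apply: mY.
by rewrite -[_ @^-1` _]setTI; exact: mf.
Qed.

Lemma measurable_wrt_pair {d1 d2} {S1 : measurableType d1} {S2 : measurableType d2}
    (Y1 : Omega -> S1) (Y2 : Omega -> S2) :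
  measurable_wrt G Y1 -> measurable_wrt G Y2 ->
  measurable_wrt G (fun w => (Y1 w, Y2 w)).
Proof.
move=> /measurable_wrtP m1 /measurable_wrtP m2; apply/measurable_wrtP.
exact/measurable_fun_pair.
Qed.

Lemma measurable_wrt_sum {R : realType} (Y : nat -> Omega -> R) n :
  (forall k, (k < n)%N -> measurable_wrt G (Y k)) ->
  measurable_wrt G (fun w => \sum_(0 <= k < n) Y k w).
Proof.
elim: n => [|n IH] mY.
  have -> : (fun w => \sum_(0 <= k < 0) Y k w) = cst 0.
    by apply/funext => w; rewrite big_geq.
  by apply/measurable_wrtP; exact: measurable_cst.
have -> : (fun w => \sum_(0 <= k < n.+1) Y k w) =
    (fun w => \sum_(0 <= k < n) Y k w + Y n w).
  by apply/funext => w; rewrite big_nat_recr.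
have /measurable_wrtP m1 := IH (fun k kn => mY k (ltnW kn)).
have /measurable_wrtP m2 := mY n (leqnn _).
by apply/measurable_wrtP; exact: measurable_funD.
Qed.

Lemma measurable_wrt_mul {R : realType} (Y Z : Omega -> R) :
  measurable_wrt G Y -> measurable_wrt G Z ->
  measurable_wrt G (fun w => Y w * Z w).
Proof.
move=> /measurable_wrtP m1 /measurable_wrtP m2; apply/measurable_wrtP.
exact: measurable_funM.
Qed.

Lemma measurable_wrt_indic {R : realType} (A : set Omega) :
  G A -> measurable_wrt G (\1_A : Omega -> R).
Proof.
move=> /measurable_wrt_set mA; apply/measurable_wrtP.
exact: (@measurable_indic _ (g_sigma_algebraType G)).
Qed.

Lemma measurable_wrt_le {R : realType} (Y : Omega -> R) c :
  measurable_wrt G Y -> G [set w | Y w <= c].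
Proof.
move=> mY; have -> : [set w | Y w <= c] = Y @^-1` `]-oo, c].
  by apply/seteqP; split => w /=; rewrite in_itv.
exact/mY.
Qed.

Lemma measurable_wrt_ge {R : realType} (Y : Omega -> R) c :
  measurable_wrt G Y -> G [set w | c <= Y w].
Proof.
move=> mY; have -> : [set w | c <= Y w] = Y @^-1` `[c, +oo[.
  by apply/seteqP; split => w /=; rewrite in_itv/= andbT.
exact/mY.
Qed.

Lemma measurable_wrt_setI (A B : set Omega) : G A -> G B -> G (A `&` B).
Proof.
by rewrite !measurable_wrt_set => mA mB; exact: measurableI.
Qed.

Lemma measurable_wrt_setU (A B : set Omega) : G A -> G B -> G (A `|` B).
Proof.
by rewrite !measurable_wrt_set => mA mB; exact: measurableU.
Qed.

Lemma measurable_wrt_setC (A : set Omega) : G A -> G (~` A).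
Proof.
by rewrite !measurable_wrt_set => mA; exact: measurableC.
Qed.

End sub_sigma_algebra.

Lemma measurable_wrtS {d} {Omega : measurableType d} (G G' : set (set Omega))
    {d'} {S : measurableType d'} (Y : Omega -> S) :
  G `<=` G' -> measurable_wrt G Y -> measurable_wrt G' Y.
Proof. by move=> GG mY B mB; apply: GG; exact: mY. Qed.

Lemma measurable_wrt_fun {d} {Omega : measurableType d} (G : set (set Omega))
    {d'} {S : measurableType d'} (Y : Omega -> S) :
  G `<=` measurable -> measurable_wrt G Y -> measurable_fun setT Y.
Proof. by move=> GG mY _ B mB; rewrite setTI; apply: GG; exact: mY. Qed.

Section ae_series.
Context {d : measure_display} {Omega : measurableType d} {R : realType}.
Variable Pr : probability Omega R.

Lemma ae_nneseries_lty (f : nat -> Omega -> R) :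
  (forall k, measurable_fun setT (f k)) -> (forall k w, 0 <= f k w) ->
  (\sum_(k <oo) \int[Pr]_w (f k w)%:E < +oo)%E ->
  {ae Pr, forall w, (\sum_(k <oo) (f k w)%:E < +oo)%E}.
Proof.
move=> mf f0 fi.
have int : Pr.-integrable setT (fun w => \sum_(k <oo) (f k w)%:E)%E.
  apply/integrableP; split.
    apply: ge0_emeasurable_sum => [k w _ _|k _]; first by rewrite lee_fin.
    exact/measurable_EFinP.
  under eq_integral.
    move=> w _; rewrite gee0_abs; last first.
      by apply: nneseries_ge0 => k _ _; rewrite lee_fin.
    over.
  rewrite integral_nneseries// => [k|k w _]; last by rewrite lee_fin.
  exact/measurable_EFinP.
apply: filterS (integrable_ae measurableT int) => w /(_ Logic.I).
by rewrite fin_numElt => /andP[].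
Qed.

Lemma nneseries_lty_bound (u : R^nat) : (forall k, 0 <= u k) ->
  (\sum_(k <oo) (u k)%:E < +oo)%E ->
  exists K : nat, forall n, \sum_(0 <= k < n) u k <= K%:R.
Proof.
move=> u0 uoo.
have s0 : (0 <= \sum_(k <oo) (u k)%:E)%E.
  by apply: nneseries_ge0 => k _ _; rewrite lee_fin.
pose s := fine (\sum_(k <oo) (u k)%:E)%E.
exists (Num.truncn s).+1 => n.
have sE : (s%:E = \sum_(k <oo) (u k)%:E)%E by rewrite fineK// ge0_fin_numE.
have ss : 0 <= s by rewrite fine_ge0.
have /andP[_ /ltW] := truncn_itv ss.
apply: le_trans.
rewrite -lee_fin sE -sumEFin; apply: nneseries_lim_ge => k _.
by rewrite lee_fin.
Qed.

Lemma nneseries_lty_cvg (u : R^nat) : (forall k, 0 <= u k) ->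
  (\sum_(k <oo) (u k)%:E < +oo)%E -> cvgn (series u).
Proof.
move=> u0 /(nneseries_lty_bound u0)[K uK].
apply: nondecreasing_is_cvgn; first exact: nondecreasing_series.
by exists K%:R => _ [n _ <-]; exact: uK.
Qed.

End ae_series.

Section integrable_EFin.
Context {d : measure_display} {T : measurableType d} {R : realType}.
Variable mu : {measure set T -> \bar R}.
Implicit Types f g : T -> R.

Lemma integrable_EFinD f g : mu.-integrable setT (EFin \o f) ->
  mu.-integrable setT (EFin \o g) ->
  mu.-integrable setT (EFin \o (fun w => f w + g w)).
Proof.
move=> fi gi; have := integrableD measurableT fi gi.
by congr (_.-integrable _ _).
Qed.

Lemma integrable_EFinZ c f : mu.-integrable setT (EFin \o f) ->
  mu.-integrable setT (EFin \o (fun w => c * f w)).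
Proof.
move=> fi; have := integrableZl measurableT c fi.
by congr (_.-integrable _ _).
Qed.

Lemma integrable_EFin_sum n (f : nat -> T -> R) :
  (forall k, mu.-integrable setT (EFin \o f k)) ->
  mu.-integrable setT (EFin \o (fun w => \sum_(0 <= k < n) f k w)).
Proof.
move=> fi.
have -> : EFin \o (fun w => \sum_(0 <= k < n) f k w) =
    (fun w => \sum_(0 <= k < n) (f k w)%:E)%E.
  by apply/funext => w; rewrite /= sumEFin.
by apply: integrable_sum => // k _; exact: fi.
Qed.

Lemma le_integrable_EFin f g : measurable_fun setT f ->
  (forall w, `|f w| <= g w) -> mu.-integrable setT (EFin \o g) ->
  mu.-integrable setT (EFin \o f).
Proof.
move=> mf fg gi; apply: le_integrable gi => //; first exact/measurable_EFinP.
by move=> w _; rewrite /= lee_fin (le_trans (fg w))// ler_norm.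
Qed.

Lemma Rintegral_sum n (f : nat -> T -> R) :
  (forall k, mu.-integrable setT (EFin \o f k)) ->
  \int[mu]_w (\sum_(0 <= k < n) f k w) = \sum_(0 <= k < n) \int[mu]_w f k w.
Proof.
move=> fi; elim: n => [|n IH].
  rewrite big_geq// /Rintegral integral0_eq// => w _; by rewrite big_geq.
rewrite big_nat_recr//= -IH -RintegralD//; last exact: integrable_EFin_sum.
by apply: eq_Rintegral => w _; rewrite big_nat_recr.
Qed.

Lemma EFin_Rintegral f : mu.-integrable setT (EFin \o f) ->
  (\int[mu]_w f w)%:E = (\int[mu]_w (f w)%:E)%E.
Proof. by move=> fi; rewrite fineK//; exact: integrable_fin_num fi. Qed.

End integrable_EFin.

(** * Doob's martingale convergence theorem *)

Section upcrossings.
Context {R : realType}.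
Implicit Types (N : R^nat) (a b : R).

(** Whether the path N is, at time n, on its way up from below a to above b. *)
Fixpoint rising N a b n : bool :=
  if n is k.+1 then (if rising N a b k then N k.+1 < b else N k.+1 <= a)
  else N 0%N <= a.

Definition completed N a b k : R := (rising N a b k && ~~ rising N a b k.+1)%:R.

(** The gain of the player who bets on the increments of N exactly while N is
    rising wins b - a per completed upcrossing, and loses at most the last,
    unfinished, excursion below a. *)
Lemma upcrossing_gain (D : R^nat) a b n : a < b ->
  (b - a) * \sum_(0 <= k < n) completed (series D) a b k
    + (if rising (series D) a b n then series D n - a else 0) <=
  \sum_(0 <= k < n) (rising (series D) a b k)%:R * D k.
Proof.
move=> ab; set N := series D; elim: n => [|n IH].
  by rewrite !big_geq// mulr0 add0r /=; case: ifPn => // h; rewrite subr_le0.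
rewrite !big_nat_recr//= mulrDr {2}/completed /=.
have NS : N n.+1 = N n + D n by rewrite /N seriesSr addrC.
have ar1 (s t x y : R) : s + (x - a) <= t -> s + (x + y - a) <= t + y by lra.
have ar2 (s t x y : R) : s + (x - a) <= t -> b <= x + y -> s + (b - a) <= t + y by lra.
have ar3 (s t z : R) : s + 0 <= t -> z <= a -> s + (z - a) <= t by lra.
move: IH; case: (rising N a b n) => /= IH.
  case: ltP => /= h; rewrite ?(mulr0, mulr1, addr0, mul1r).
    by rewrite NS; exact: ar1 IH.
  by apply: ar2 IH _; rewrite -NS.
have [h|h] /= := leP (N n.+1) a; rewrite ?(mulr0, mul0r, addr0).
  exact: ar3 IH h.
by rewrite addr0 in IH.
Qed.

(** If only finitely many upcrossings are completed, then either the path stays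
    on its way up forever, below b, or it never comes down to a again. *)
Lemma rising_cvg N a b : a < b ->
  (\sum_(k <oo) (completed N a b k)%:E < +oo)%E ->
  (exists n0, forall n, (n0 <= n)%N -> N n < b) \/
  (exists n0, forall n, (n0 <= n)%N -> a < N n).
Proof.
move=> ab fin.
have c0 k : 0 <= completed N a b k by [].
have /cvg_series_cvg_0 c_cvg := nneseries_lty_cvg c0 fin.
have [n0 _ hn0] : \forall n \near \oo, `|0 - completed N a b n| < 1.
  by move/cvgrPdist_lt : c_cvg; apply.
have stay n : (n0 <= n)%N -> rising N a b n -> rising N a b n.+1.
  move=> /hn0 /=; rewrite sub0r normrN /completed => h Rn; apply/negPn/negP => nR.
  by move: h; rewrite Rn nR /= normr1 ltxx.
have [[m nm Rm]|nR] := pselect (exists2 m, (n0 <= m)%N & rising N a b m).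
  left; exists m.+1 => -[//|n]; rewrite ltnS => mn.
  have Rn : rising N a b n.
    elim: n mn => [|n IH]; first by rewrite leqn0 => /eqP <-.
    rewrite leq_eqVlt => /predU1P[<-//|]; rewrite ltnS => mn.
    exact: (stay _ (leq_trans nm mn) (IH mn)).
  by have := stay n (leq_trans nm mn) Rn; rewrite /= Rn.
right; exists n0.+1 => -[//|n]; rewrite ltnS => mn; rewrite ltNge; apply/negP => Na.
have Rn : ~~ rising N a b n by apply/negP => Rn; apply: nR; exists n.
by apply: nR; exists n.+1; [exact: leqW|rewrite /= (negbTE Rn)].
Qed.

(** The limit is the supremum of the levels that the path eventually exceeds;
    recurrence to a bounded set makes it finite. *)
Lemma cvg_of_no_oscillation N :
  (forall p q : rat, (ratr p : R) < ratr q ->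
    (exists n0, forall n, (n0 <= n)%N -> N n < ratr q) \/
    (exists n0, forall n, (n0 <= n)%N -> ratr p < N n)) ->
  (exists c, forall n0, exists2 n, (n0 <= n)%N & `|N n| <= c) ->
  cvgn N.
Proof.
move=> cross [c freq].
pose L := [set x : R | exists n0, forall n, (n0 <= n)%N -> x < N n].
have ratlt (x y : R) : x < y -> exists p : rat, x < ratr p < y.
  by move=> /rat_in_itvoo[p]; rewrite in_itv/= => h; exists p.
have L0 : L !=set0.
  have [p hp] := ratlt (- c - 2) (- c - 1) (ltac:(lra)).
  have [q hq] := ratlt (- c - 1) (- c) (ltac:(lra)).
  have [|[n0 h]|[n0 h]] := cross p q; first lra.
    have [n nn] := freq n0; rewrite ler_norml => hc.
    by have := h n nn; lra.
  by exists (ratr p); exists n0.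
have Lub : ubound L c.
  move=> x [n0 h]; have [n nn] := freq n0; rewrite ler_norml => hc.
  by have := h n nn; lra.
have hsL : has_sup L by split => //; exists c.
apply/cvg_ex; exists (sup L); apply/cvgrPdist_le => e e0.
have [x [n1 h1] xs] := sup_adherent e0 hsL.
have [p hp] := ratlt (sup L) (sup L + e / 2) (ltac:(lra)).
have [q hq] := ratlt (sup L + e / 2) (sup L + e) (ltac:(lra)).
have [|[n2 h2]|[n2 h2]] := cross p q; first lra.
  exists (n1 + n2)%N => // n /= nn.
  have := h1 n (leq_trans (leq_addr _ _) nn).
  have := h2 n (leq_trans (leq_addl _ _) nn).
  by rewrite ler_norml; lra.
have : ratr p <= sup L by apply: ub_le_sup; [exists c|exists n2].
lra.
Qed.

End upcrossings.

Section doob.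
Context {d : measure_display} {Omega : measurableType d} {R : realType}.
Variables (Pr : probability Omega R) (Flt : nat -> set (set Omega)).
Hypothesis FltF : filtration Flt.
Variables (D : nat -> Omega -> R) (C : R).
Hypothesis mD : forall k, measurable_wrt (Flt k.+1) (D k).
Hypothesis iD : forall k, Pr.-integrable setT (EFin \o D k).
Hypothesis D_mart : forall k A, Flt k A -> \int[Pr]_w (\1_A w * D k w) = 0.

Let N w n := series (D ^~ w) n.
Let neg w n := Num.max (- N w n) 0.

Hypothesis negC : forall n, \int[Pr]_w neg w n <= C.

Let sFlt k : sigma_algebra setT (Flt k). Proof. by case: FltF. Qed.
Let mFlt k : Flt k `<=` measurable. Proof. by case: FltF. Qed.
Let leFlt k l : (k <= l)%N -> Flt k `<=` Flt l. Proof. by case: FltF => _ _; apply. Qed.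

Let mN n : measurable_wrt (Flt n) (fun w => N w n).
Proof.
apply: measurable_wrt_sum => // k kn.
exact: measurable_wrtS (leFlt kn) (mD k).
Qed.

Let iN n : Pr.-integrable setT (EFin \o (fun w => N w n)).
Proof. exact: integrable_EFin_sum. Qed.

Let mNfun n : measurable_fun setT (fun w => N w n).
Proof. exact: measurable_wrt_fun (@mFlt n) (mN n). Qed.

Let ineg n : Pr.-integrable setT (EFin \o (fun w => neg w n)).
Proof.
apply: le_integrable (iN n) => //.
  apply/measurable_EFinP; apply: measurable_maxr => //.
  exact: measurable_funN.
move=> w _; rewrite /= lee_fin /neg /Num.max; case: ifPn => _.
  by rewrite normr0.
by rewrite normrN.
Qed.

Lemma Flt_rising a b n : Flt n [set w | rising (N w) a b n].
Proof.
elim: n => [|n IH]; first exact: measurable_wrt_le.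
have -> : [set w | rising (N w) a b n.+1] =
  ([set w | rising (N w) a b n] `&` ~` [set w | b <= N w n.+1]) `|`
  (~` [set w | rising (N w) a b n] `&` [set w | N w n.+1 <= a]).
  apply/seteqP; split => w /=; case: ifPn => // Rn.
  - by rewrite ltNge => /negP; left.
  - by right.
  - by case=> -[// _ /negP]; rewrite -ltNge.
  - by case=> -[].
have {}IH := leFlt (leqnSn n) IH.
apply: measurable_wrt_setU => //; apply: measurable_wrt_setI => //.
- by apply: measurable_wrt_setC => //; exact: measurable_wrt_ge.
- exact: measurable_wrt_setC.
- exact: measurable_wrt_le.
Qed.

Let iID k A : Flt k A -> Pr.-integrable setT (EFin \o (fun w => \1_A w * D k w)).
Proof.
move=> FA; have mA := mFlt FA.
apply: le_integrable (iD k) => //.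
  apply/measurable_EFinP; apply: measurable_funM; first exact: measurable_indic.
  exact: measurable_wrt_fun (@mFlt k.+1) (mD k).
move=> w _; rewrite /= lee_fin normrM indicE.
by case: (_ \in _); rewrite ?normr1 ?normr0 ?mul1r ?mul0r.
Qed.

Lemma Rintegral_mart_transform (A : nat -> set Omega) n :
  (forall k, Flt k (A k)) ->
  \int[Pr]_w (\sum_(0 <= k < n) \1_(A k) w * D k w) = 0.
Proof.
move=> FA; rewrite Rintegral_sum => [|k]; last exact: iID.
by rewrite big1// => k _; exact: D_mart.
Qed.

Lemma measurable_completed a b k :
measurable_fun setT (fun w => completed (N w) a b k).
Proof.
have -> : (fun w => completed (N w) a b k) =
    \1_([set w | rising (N w) a b k] `&` ~` [set w | rising (N w) a b k.+1]).
  apply/funext => w; rewrite indicE /completed; congr (nat_of_bool _)%:R.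
  apply/idP/idP => [/andP[h1 h2]|/set_mem[h1 /negP h2]].
    by rewrite inE; split => //; exact/negP.
  by apply/andP; split.
apply: measurable_indic; apply: measurableI; first exact/mFlt/Flt_rising.
by apply: measurableC; exact/mFlt/Flt_rising.
Qed.

(** The gain of the betting strategy of [upcrossing_gain] has mean zero, because
    being on the way up at time k is an event of time k. *)
Lemma expected_upcrossings a b : a < b ->
  (\sum_(k <oo) \int[Pr]_w (completed (N w) a b k)%:E < +oo)%E.
Proof.
move=> ab.
have mc := measurable_completed a b.
have c0 w k : 0 <= completed (N w) a b k by [].
have c1 w k : completed (N w) a b k <= 1 by rewrite /completed; case: (_ && _).
have ic k : Pr.-integrable setT (EFin \o (fun w => completed (N w) a b k)).
  apply: (@le_integrable _ _ _ _ _ _ _ (EFin \o cst 1)).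
  - by [].
  - exact/measurable_EFinP.
  - by move=> w _; rewrite /= lee_fin normr1 ger0_norm.
  - exact: finite_measure_integrable_cst.
apply: (@le_lt_trans _ _ ((b - a)^-1 * (C + `|a|))%:E); last exact: ltry.
apply: lime_le.
  by apply: is_cvg_nneseries => k _ _; apply: integral_ge0 => w _; rewrite lee_fin.
apply: nearW => n /=.
have isum : Pr.-integrable setT (EFin \o (fun w => \sum_(0 <= k < n) completed (N w) a b k)).
  exact: integrable_EFin_sum.
pose G w := \sum_(0 <= k < n) \1_[set w | rising (N w) a b k] w * D k w.
have iG : Pr.-integrable setT (EFin \o G).
  by apply: integrable_EFin_sum => k; apply: iID; exact: Flt_rising.
have ia : Pr.-integrable setT (EFin \o cst `|a|).
  exact: finite_measure_integrable_cst.
have key : (b - a) * \int[Pr]_w (\sum_(0 <= k < n) completed (N w) a b k) <=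
    C + `|a|.
  rewrite -RintegralZl//.
  apply: le_trans (_ : \int[Pr]_w (G w + (neg w n + cst `|a| w)) <= _).
    apply: le_Rintegral => //.
    - exact: integrable_EFinZ isum.
    - exact: integrable_EFinD iG (integrable_EFinD (ineg n) ia).
    move=> w _; have := @upcrossing_gain _ (D ^~ w) a b n ab; rewrite -/(N w) /=.
    have -> : \sum_(0 <= k < n) (rising (N w) a b k)%:R * D k w = G w.
      apply: eq_bigr => k _; rewrite indicE.
      have -> // : (w \in [set w | rising (N w) a b k]) = rising (N w) a b k.
      by apply/idP/idP => [/set_mem//|h]; rewrite inE.
    have ar1 (s x t m : R) : s + (x - a) <= t -> - x <= m -> s <= t + (m + `|a|).
      by have := ler_norm a; lra.
    have ar2 (s t m : R) : s + 0 <= t -> 0 <= m -> s <= t + (m + `|a|).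
      by have := normr_ge0 a; lra.
    have n1 : - N w n <= neg w n by rewrite le_max lexx.
    have n2 : 0 <= neg w n by rewrite le_max lexx orbT.
    by case: ifP => _ h; [exact: ar1 h n1|exact: ar2 h n2].
  rewrite (RintegralD measurableT iG (integrable_EFinD (ineg n) ia)).
  rewrite (RintegralD measurableT (ineg n) ia).
  rewrite /G Rintegral_mart_transform ?add0r; last by move=> k; exact: Flt_rising.
  by rewrite lerD// Rintegral_cst//= probability_setT mulr1.
rewrite -integral_sum//.
under eq_integral do rewrite sumEFin.
rewrite -[leLHS]fineK; last exact: integrable_fin_num isum.
rewrite lee_fin -ler_pdivrMl ?invr_gt0 ?subr_gt0// invrK.
exact: key.
Qed.

(** The martingale has mean zero, so the bound on its negative part is a bound
    on its absolute value, and Fatou's lemma keeps it from escaping to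
    infinity. *)
Lemma recurrent_bounded :
  {ae Pr, forall w, exists c : R, forall n0, exists2 n, (n0 <= n)%N & `|N w n| <= c}.
Proof.
have mabs n : measurable_fun setT (fun w => (`|N w n|)%:E).
  by apply/measurable_EFinP; exact: measurableT_comp.
have absC n : (\int[Pr]_w (`|N w n|)%:E <= (2 * C)%:E)%E.
  have E0 : \int[Pr]_w N w n = 0.
    rewrite -(@Rintegral_mart_transform (fun=> setT) n).
      by congr fine; apply: eq_integral => w _; congr EFin; apply: eq_bigr => k _;
        rewrite indicT mul1r.
    by move=> k; have := measurable_wrt_setC (sFlt k); case: (sFlt k) => F0 _ _ /(_ set0 F0);
      rewrite setC0.
  have iabs : Pr.-integrable setT (EFin \o (fun w => `|N w n|)).
    by have := integrable_norm (iN n).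
  rewrite -[leLHS]fineK; last exact: integrable_fin_num iabs.
  rewrite lee_fin.
  have -> : fine (\int[Pr]_w (`|N w n|)%:E) = \int[Pr]_w (N w n + 2 * neg w n).
    rewrite /Rintegral; congr fine; apply: eq_integral => w _; congr EFin.
    rewrite /neg; case: (leP (N w n) 0) => h.
      by rewrite ler0_norm// max_l ?oppr_ge0//; lra.
    by rewrite gtr0_norm// max_r ?oppr_le0 ?(ltW h)//; lra.
  have i2 : Pr.-integrable setT (EFin \o (fun w => 2 * neg w n)).
    exact: integrable_EFinZ (ineg n).
  by rewrite RintegralD// E0 add0r RintegralZl//; apply: ler_wpM2l.
have fat : (\int[Pr]_w limn_einf (fun n => (`|N w n|)%:E) <= (2 * C)%:E)%E.
  apply: le_trans (fatou Pr measurableT mabs _) _ => [n w _|]; first by rewrite lee_fin.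
  rewrite limn_einf_lim; apply: lime_le; first exact: is_cvg_einfs.
  apply: nearW => n; apply: le_trans (absC n); apply: ereal_inf_lbound.
  by exists n => //=.
have lim0 w : (0 <= limn_einf (fun n => (`|N w n|)%:E))%E.
  rewrite limn_einf_lim; apply: lime_ge; first exact: is_cvg_einfs.
  by apply: nearW => n; apply: le_ereal_inf_tmp => _ [k _ <-]; rewrite lee_fin.
have int : Pr.-integrable setT (fun w => limn_einf (fun n => (`|N w n|)%:E)).
  apply/integrableP; split.
    apply: (measurableT_comp (@oppe_measurable R setT)) => //.
    by apply: measurable_fun_limn_esup => n; exact: measurableT_comp (mabs n).
  under eq_integral do rewrite gee0_abs//.
  exact: le_lt_trans fat (ltry _).
apply: filterS (integrable_ae measurableT int) => w /(_ Logic.I) fin.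
apply: contrapT => nfreq.
suff : (limn_einf (fun n => (`|N w n|)%:E) = +oo)%E by move=> h; rewrite h in fin.
apply: (cvg_limn_einf_sup _).1; apply/cvgeyPge => c.
apply: contrapT => nev; apply: nfreq; exists c => n0.
apply: contrapT => h; apply: nev; exists n0 => // n /= nn.
rewrite lee_fin leNgt; apply/negP => cN; apply: h; exists n => //; exact: ltW.
Qed.

(** Almost surely no interval with rational endpoints is crossed infinitely
    often. *)
Theorem martingale_cvg : {ae Pr, forall w, cvgn (N w)}.
Proof.
have cross : {ae Pr, forall w, forall i : nat,
    if @unpickle (rat * rat)%type i is Some pq then
      (ratr pq.1 : R) < ratr pq.2 ->
      (\sum_(k <oo) (completed (N w) (ratr pq.1) (ratr pq.2) k)%:E < +oo)%E
    else True}.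
  apply/ae_foralln => i; case: unpickle => [[p q]|]; last exact: aeW.
  have [pq|pq] := ltP (ratr p : R) (ratr q); last exact: aeW.
  suff : {ae Pr, forall w,
      (\sum_(k <oo) (completed (N w) (ratr p) (ratr q) k)%:E < +oo)%E}.
    by apply: filterS => w.
  apply: ae_nneseries_lty => //; last exact: expected_upcrossings.
  by move=> k; exact: measurable_completed.
apply: filterS2 cross recurrent_bounded => w cross_w bounded_w.
apply: cvg_of_no_oscillation => // p q pq; apply: rising_cvg => //.
by have := cross_w (pickle (p, q)); rewrite pickleK; exact.
Qed.

End doob.

(** * Martingales that are bounded below *)

Section compensator.
Context {d : measure_display} {Omega : measurableType d} {R : realType}.
Variables (Pr : probability Omega R) (Flt : nat -> set (set Omega)).
Hypothesis FltF : filtration Flt.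

Let sFlt k : sigma_algebra setT (Flt k). Proof. by case: FltF. Qed.
Let mFlt k : Flt k `<=` measurable. Proof. by case: FltF. Qed.

Lemma integral_set_indic (A : set Omega) (f : Omega -> R) :
  (\int[Pr]_(w in A) (f w)%:E = \int[Pr]_w (\1_A w * f w)%:E)%E.
Proof.
rewrite integral_mkcond; apply: eq_integral => w _.
by rewrite patchE indicE; case: ifPn => _ /=; rewrite ?mul1r ?mul0r.
Qed.

Variables (Y y : nat -> Omega -> R).
Hypothesis Y0 : forall k w, 0 <= Y k w.
Hypothesis y0 : forall k w, 0 <= y k w.
Hypothesis mY : forall k, measurable_fun setT (Y k).
Hypothesis my : forall k, measurable_wrt (Flt k) (y k).
Hypothesis Yy : forall k A, Flt k A ->
  (\int[Pr]_(w in A) (Y k w)%:E = \int[Pr]_(w in A) (y k w)%:E)%E.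

(** On the event A k of time k the variable Y k may be replaced by its conditional
    expectation, and the sum of the y k over the k with A k never exceeds K: it
    is bounded at the last such k. *)
Lemma localized_series_bound (K : R) (A : nat -> set Omega) : 0 <= K ->
  (forall k, Flt k (A k)) ->
  (forall k w, A k w -> \sum_(0 <= i < k.+1) y i w <= K) ->
  (\sum_(k <oo) \int[Pr]_w (\1_(A k) w * Y k w)%:E <= K%:E)%E.
Proof.
move=> K0 FA Ay.
have mA k : measurable (A k) by exact/mFlt/FA.
have iE k : (\int[Pr]_w (\1_(A k) w * Y k w)%:E =
             \int[Pr]_w (\1_(A k) w * y k w)%:E)%E.
  by rewrite -!integral_set_indic Yy.
under eq_eseriesr do rewrite iE.
have m1 k : measurable_fun setT (fun w => \1_(A k) w * y k w : R).
  apply: measurable_funM; first exact: measurable_indic.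
  exact: measurable_wrt_fun (mFlt (k := k)) (my k).
rewrite -integral_nneseries//; last 2 first.
- by move=> k; exact/measurable_EFinP.
- by move=> k w _; rewrite lee_fin mulr_ge0.
apply: le_trans (_ : \int[Pr]_w (cst K%:E w) <= _)%E; last first.
  by rewrite integral_cst//= probability_setT mule1.
apply: ge0_le_integral => //.
- by move=> w _; apply: nneseries_ge0 => k _ _; rewrite lee_fin mulr_ge0.
- apply: ge0_emeasurable_sum => [k w _ _|k _]; first by rewrite lee_fin mulr_ge0.
  exact/measurable_EFinP.
move=> w _; apply: lime_le.
  by apply: is_cvg_nneseries => k _ _; rewrite lee_fin mulr_ge0.
apply: nearW => n /=; rewrite sumEFin lee_fin.
elim: n => [|n IH]; first by rewrite big_geq.
have [An|An] := pselect (A n w); last first.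
  by rewrite big_nat_recr//= indicE memNset// mul0r addr0.
apply: le_trans (Ay n w An); apply: ler_sum => k _.
by rewrite indicE; case: (_ \in _); rewrite ?mul1r ?mul0r.
Qed.

(** Conditional Borel-Cantelli lemma: up to the time when the sum of the y exceeds
    K, the two series have the same expectation, which is at most K; every path
    with a finite sum of the y is covered by some K. *)
Lemma compensated_series_lty :
  {ae Pr, forall w, (\sum_(k <oo) (y k w)%:E < +oo)%E} ->
  {ae Pr, forall w, (\sum_(k <oo) (Y k w)%:E < +oo)%E}.
Proof.
move=> yoo.
pose A (K : nat) k : set Omega := [set w | \sum_(0 <= i < k.+1) y i w <= K%:R].
have FA K k : Flt k (A K k).
  apply: measurable_wrt_le => //; apply: measurable_wrt_sum => // i ik.
  by apply: measurable_wrtS (my i); case: FltF => _ _; apply.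
have loc (K : nat) : {ae Pr, forall w, (\sum_(k <oo) (\1_(A K k) w * Y k w)%:E < +oo)%E}.
  apply: ae_nneseries_lty.
  - move=> k; apply: measurable_funM => //; apply: measurable_indic.
    exact/mFlt/FA.
  - by move=> k w; rewrite mulr_ge0.
  - by apply: le_lt_trans (localized_series_bound _ (FA K) _) (ltry K%:R).
have : {ae Pr, forall w, forall K : nat, (\sum_(k <oo) (\1_(A K k) w * Y k w)%:E < +oo)%E}.
  exact/ae_foralln.
move=> h; near=> w.
have /nneseries_lty_bound [//|K yK] : (\sum_(k <oo) (y k w)%:E < +oo)%E by near: w.
have : forall K : nat, (\sum_(k <oo) (\1_(A K k) w * Y k w)%:E < +oo)%E by near: w.
move=> /(_ K); congr (_ < _)%E; apply: eq_eseriesr => k _.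
by rewrite indicE mem_set ?mul1r//=; exact: yK.
Unshelve. all: by end_near. Qed.

Variable D : nat -> Omega -> R.
Hypothesis mD : forall k, measurable_wrt (Flt k.+1) (D k).
(* [D] has conditional mean zero, stated through its positive and negative parts
   since it need not be integrable *)
Hypothesis D_sym : forall k A, Flt k A ->
  (\int[Pr]_(w in A) (Num.max (D k w) 0)%:E =
   \int[Pr]_(w in A) (Num.max (- D k w) 0)%:E)%E.
Hypothesis D_dom : forall k w, `|D k w| <= 2 + Y k w.

Let leFlt k l : (k <= l)%N -> Flt k `<=` Flt l. Proof. by case: FltF => _ _; apply. Qed.

Let mDfun k : measurable_fun setT (D k).
Proof. exact: measurable_wrt_fun (@mFlt k.+1) (mD k). Qed.

(** The event that by time k neither has the sum of the y exceeded K nor has the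
    martingale fallen below -K: its indicator stops the martingale. *)
Fixpoint good_set (K : R) k : set Omega :=
  let G := [set w | \sum_(0 <= i < k.+1) y i w <= K] `&`
           [set w | - K <= \sum_(0 <= i < k) D i w] in
  if k is j.+1 then good_set K j `&` G else G.

Lemma good_setE K k w : good_set K k w <->
  forall j, (j <= k)%N -> \sum_(0 <= i < j.+1) y i w <= K /\
    - K <= \sum_(0 <= i < j) D i w.
Proof.
elim: k => [|k IH].
  split=> [[h1 h2] j|h]; first by rewrite leqn0 => /eqP ->.
  by have [h1 h2] := h 0%N (leqnn _); split.
split=> [[/IH h [h1 h2]] j|h].
  by rewrite leq_eqVlt => /predU1P[->|]; [split|rewrite ltnS; exact: h].
split; first by apply/IH => j jk; apply: h; exact: leqW.
by have [h1 h2] := h k.+1 (leqnn _); split.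
Qed.

Lemma Flt_good_set K k : Flt k (good_set K k).
Proof.
have G j : Flt j ([set w | \sum_(0 <= i < j.+1) y i w <= K] `&`
           [set w | - K <= \sum_(0 <= i < j) D i w]).
  apply: measurable_wrt_setI => //.
    apply: measurable_wrt_le => //; apply: measurable_wrt_sum => // i ij.
    exact: measurable_wrtS (@leFlt i j ij) (my i).
  apply: measurable_wrt_ge => //; apply: measurable_wrt_sum => // i ij.
  exact: measurable_wrtS (leFlt ij) (mD i).
elim: k => [|k IH]; first exact: G.
apply: measurable_wrt_setI; [exact: sFlt|exact: leFlt (leqnSn k) _ IH|exact: G].
Qed.

(** The stopped martingale lies above -K until its last step, whose size is at
    most 2 + Y; so the expectation of its negative part is at most
    K + 2 + E(sum of the stopped Y) <= 2 K + 2, and Doob's theorem applies. *)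
Lemma localized_martingale_cvg (K : R) : 0 <= K ->
  {ae Pr, forall w, cvgn (series (fun k => \1_(good_set K k) w * D k w))}.
Proof.
move=> K0.
have mA k : measurable (good_set K k) by exact/mFlt/Flt_good_set.
have bound : (\sum_(k <oo) \int[Pr]_w (\1_(good_set K k) w * Y k w)%:E <= K%:E)%E.
  apply: localized_series_bound => //; first exact: Flt_good_set.
  by move=> k w /good_setE/(_ k (leqnn _))[].
have Y10 k w : 0 <= \1_(good_set K k) w * Y k w by rewrite mulr_ge0.
have bound_n n : (\sum_(0 <= k < n) \int[Pr]_w (\1_(good_set K k) w * Y k w)%:E <= K%:E)%E.
  apply: le_trans bound; apply: nneseries_lim_ge => k _ _.
  by apply: integral_ge0 => w _; rewrite lee_fin.
have mY1 k : measurable_fun setT (fun w => \1_(good_set K k) w * Y k w).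
  by apply: measurable_funM => //; exact: measurable_indic.
have iY k : Pr.-integrable setT (EFin \o (fun w => \1_(good_set K k) w * Y k w)).
  apply/integrableP; split; first exact/measurable_EFinP.
  under eq_integral do rewrite /= ger0_norm//.
  apply: le_lt_trans (ltry K); apply: le_trans (bound_n k.+1).
  rewrite big_nat_recr//= leeDr// sume_ge0// => j _.
  by apply: integral_ge0 => w _; rewrite lee_fin.
have mDK k : measurable_fun setT (fun w => \1_(good_set K k) w * D k w).
  by apply: measurable_funM => //; exact: measurable_indic.
have i2 (c : R) : Pr.-integrable setT (EFin \o cst c).
  exact: finite_measure_integrable_cst.
have iD k : Pr.-integrable setT (EFin \o (fun w => \1_(good_set K k) w * D k w)).
  apply: le_integrable_EFin (mDK k) _ (integrable_EFinD (i2 2) (iY k)) => w.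
  rewrite normrM indicE; case: (_ \in _) => /=.
    by rewrite normr1 !mul1r; exact: D_dom.
  by rewrite normr0 !mul0r addr0.
apply: (@martingale_cvg _ _ _ Pr Flt FltF _ (2 * K + 2)).
- move=> k; apply: measurable_wrt_mul => //; apply: measurable_wrt_indic => //.
  exact: leFlt (leqnSn k) _ (Flt_good_set K k).
- exact: iD.
- move=> k H FH; set A := H `&` good_set K k.
  have FA : Flt k A by apply: measurable_wrt_setI => //; exact: Flt_good_set.
  have mAA := mFlt FA.
  have iA : Pr.-integrable setT (EFin \o (fun w => \1_A w * D k w)).
    apply: le_integrable_EFin (integrable_norm (iD k)).
      by apply: measurable_funM => //; exact: measurable_indic.
    move=> w; rewrite /A indicI /= normrM normrM (normrM (\1_(good_set K k) w)).
    rewrite -mulrA ler_piMl ?mulr_ge0// indicE.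
    by case: (_ \in _); rewrite ?normr1 ?normr0.
  have part (s : R) : `|s| = 1 -> Pr.-integrable setT
      (EFin \o (fun w => \1_A w * Num.max (s * D k w) 0)).
    move=> s1; apply: le_integrable_EFin (integrable_norm iA).
      apply: measurable_funM; first exact: measurable_indic.
      by apply: measurable_maxr => //; exact: measurable_funM.
    move=> w; rewrite /= !normrM ler_wpM2l// ger0_norm ?le_max ?lexx ?orbT//.
    by rewrite ge_max normr_ge0 andbT (le_trans (ler_norm _))// normrM s1 mul1r.
  transitivity (\int[Pr]_w (\1_A w * Num.max (1 * D k w) 0 -
                            \1_A w * Num.max (-1 * D k w) 0)).
    apply: eq_Rintegral => w _; rewrite -mulrBr mul1r mulN1r.
    have -> : Num.max (D k w) 0 - Num.max (- D k w) 0 = D k w.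
      have [D0|D0] := leP 0 (D k w).
        by rewrite max_r ?oppr_le0// subr0.
      by rewrite max_l ?oppr_ge0 ?(ltW D0)// sub0r opprK.
    by rewrite mulrA /A indicI.
  rewrite RintegralB//; [|exact: part (normr1 _)|]; last first.
    by apply: part; rewrite normrN1.
  apply/eqP; rewrite subr_eq0; apply/eqP; congr fine.
  have := D_sym FA; rewrite (integral_set_indic A) (integral_set_indic A) => h.
  transitivity (\int[Pr]_w (\1_A w * Num.max (D k w) 0)%:E)%E.
    by apply: eq_integral => w _; rewrite mul1r.
  by rewrite h; apply: eq_integral => w _; rewrite mulN1r.
move=> n.
have low w m : - (K + 2) - \sum_(0 <= k < m) \1_(good_set K k) w * Y k w <=
    series (fun k => \1_(good_set K k) w * D k w) m.
  elim: m => [|m IH]; first by rewrite /series /= !big_geq// subr0; lra.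
  have [Aw|Aw] := pselect (good_set K m w); last first.
    rewrite seriesSr big_nat_recr//= indicE memNset// !mul0r !addr0.
    exact: IH.
  have sE : series (fun k => \1_(good_set K k) w * D k w) m = \sum_(0 <= i < m) D i w.
    apply: eq_big_nat => i /andP[_ im]; rewrite indicE mem_set ?mul1r//.
    apply/good_setE => j ji; move/good_setE : Aw; apply.
    exact: leq_trans ji (ltnW im).
  have /good_setE/(_ m (leqnn _))[_ h] := Aw.
  rewrite seriesSr big_nat_recr//= sE indicE mem_set//= !mul1r.
  have := D_dom m w; rewrite ler_norml => /andP[h1 _].
  have : 0 <= \sum_(0 <= i < m) \1_(good_set K i) w * Y i w by apply: sumr_ge0.
  lra.
have iS : Pr.-integrable setT (EFin \o (fun w => \sum_(0 <= k < n) \1_(good_set K k) w * Y k w)).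
  exact: integrable_EFin_sum.
have iT := integrable_EFinD (i2 (K + 2)) iS.
apply: le_trans (_ : \int[Pr]_w (cst (K + 2) w +
    \sum_(0 <= k < n) \1_(good_set K k) w * Y k w) <= _).
  have iN : Pr.-integrable setT (EFin \o (fun w => series (fun k => \1_(good_set K k) w * D k w) n)).
    exact: integrable_EFin_sum.
  apply: le_Rintegral => //.
    apply: le_integrable_EFin (integrable_norm iN).
      apply: measurable_maxr => //; apply: measurable_funN.
      by move/integrableP : iN => [/measurable_EFinP].
    move=> w /=; rewrite ger0_norm ?le_max ?lexx ?orbT//.
    by rewrite ge_max normr_ge0 andbT -normrN ler_norm.
  move=> w _ /=; rewrite ge_max; have := low w n.
  have : 0 <= \sum_(0 <= i < n) \1_(good_set K i) w * Y i w by apply: sumr_ge0.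
  by move=> h1 h2; apply/andP; split; lra.
rewrite RintegralD// Rintegral_cst//= probability_setT mulr1 Rintegral_sum//.
have : \sum_(0 <= k < n) \int[Pr]_w (\1_(good_set K k) w * Y k w) <= K.
  rewrite -lee_fin -sumEFin; apply: le_trans (bound_n n).
  by apply: lee_sum => k _; rewrite EFin_Rintegral.
lra.
Qed.

(** A path with a finite sum of the y, along which the martingale is bounded
    below, is never stopped for K large enough. *)
Theorem bounded_below_martingale_cvg :
  {ae Pr, forall w, (\sum_(k <oo) (y k w)%:E < +oo)%E} ->
  {ae Pr, forall w, (exists B, forall n, B <= series (D ^~ w) n) ->
    cvgn (series (D ^~ w))}.
Proof.
move=> yoo.
have loc : {ae Pr, forall w, forall K : nat,
    cvgn (series (fun k => \1_(good_set K%:R k) w * D k w))}.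
  by apply/ae_foralln => K; exact: localized_martingale_cvg.
apply: filterS2 yoo loc => w yw locw [B DB].
have [K1 yK] := nneseries_lty_bound (y0 ^~ w) yw.
pose K := (K1 + (Num.truncn `|B|).+1)%N.
have BK : `|B| <= (Num.truncn `|B|).+1%:R.
  by have /andP[_ /ltW] := truncn_itv (normr_ge0 B).
suff -> : D ^~ w = (fun k => \1_(good_set K%:R k) w * D k w) by exact: locw.
apply/funext => k; rewrite indicE mem_set ?mul1r//; apply/good_setE => j _; split.
  by apply: le_trans (yK _) _; rewrite ler_nat leq_addr.
apply: le_trans (DB j); rewrite lerNl; apply: le_trans (ler_norm _) _.
by rewrite normrN (le_trans BK)// ler_nat leq_addl.
Qed.

End compensator.

(** * The Poisson equation of a V-ergodic kernel *)

Section V_bounded.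
Context {d : measure_display} {T : measurableType d} {R : realType}.
Variable V : T -> R.
Hypothesis mV : measurable_fun setT V.
Hypothesis V1 : forall x, 1 <= V x.
Implicit Types (g : T -> R) (mu : {measure set T -> \bar R}).

Definition Vbounded (kappa : R) g :=
  measurable_fun setT g /\ forall x, `|g x| <= kappa * V x.

Lemma V_gt0 x : 0 < V x. Proof. exact: lt_le_trans (V1 x). Qed.

Lemma Vbounded_V : Vbounded 1 V.
Proof. by split=> // x; rewrite mul1r ger0_norm// ltW// V_gt0. Qed.

Lemma Vbounded_cst c : Vbounded `|c| (cst c).
Proof. by split=> // x; rewrite ler_peMr. Qed.

Lemma VboundedD k1 k2 g1 g2 : Vbounded k1 g1 -> Vbounded k2 g2 ->
  Vbounded (k1 + k2) (fun x => g1 x + g2 x).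
Proof.
move=> [m1 b1] [m2 b2]; split; first exact: measurable_funD.
by move=> x; rewrite mulrDl (le_trans (ler_normD _ _))// lerD.
Qed.

Lemma VboundedB k1 k2 g1 g2 : Vbounded k1 g1 -> Vbounded k2 g2 ->
  Vbounded (k1 + k2) (fun x => g1 x - g2 x).
Proof.
move=> [m1 b1] [m2 b2]; split; first exact: measurable_funB.
by move=> x; rewrite mulrDl (le_trans (ler_normB _ _))// lerD.
Qed.

Lemma Vbounded_ge0 kappa g (x : T) : Vbounded kappa g -> 0 <= kappa.
Proof.
move=> [_ /(_ x)] /(le_trans (normr_ge0 _)); rewrite pmulr_lge0//.
exact: V_gt0.
Qed.

Lemma Vbounded_integrable mu kappa g : mu.-integrable setT (EFin \o V) ->
  Vbounded kappa g -> mu.-integrable setT (EFin \o g).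
Proof.
move=> iV [mg gb]; apply: le_integrable_EFin (integrable_EFinZ kappa iV) => //.
Qed.

Lemma Vbounded_Rintegral_le mu kappa g : mu.-integrable setT (EFin \o V) ->
  Vbounded kappa g -> `|\int[mu]_x g x| <= kappa * \int[mu]_x V x.
Proof.
move=> iV gb; have ig := Vbounded_integrable iV gb.
apply: le_trans (le_normr_Rintegral measurableT ig) _.
rewrite -RintegralZl//; apply: le_Rintegral => //.
- exact: integrable_norm ig.
- exact: integrable_EFinZ iV.
- by move=> x _; case: gb.
Qed.

Lemma Vdist_ge mu1 mu2 g : measurable_fun setT g ->
  (forall x, `|g x| <= V x) ->
  (`|\int[mu1]_x (g x)%:E - \int[mu2]_x (g x)%:E| <= Vdist V mu1 mu2)%E.
Proof.
move=> mg gV; apply: ereal_sup_ubound; exists g => //; split => //.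
apply: ge_ereal_sup => _ [x _ <-]; rewrite lee_fin ler_pdivrMr ?mul1r//.
exact: V_gt0.
Qed.

Lemma Vdist_ge0 mu1 mu2 : (0 <= Vdist V mu1 mu2)%E.
Proof.
have := @Vdist_ge mu1 mu2 (cst 0) _ _; rewrite !integral0_eq// sube0 abse0.
apply=> // x; rewrite normr0 ltW//; exact: V_gt0.
Qed.

(** If V had an infinite integral for either measure, the test function V would
    make the distance infinite. *)
Lemma Vdist_integrable mu1 mu2 : (Vdist V mu1 mu2 < +oo)%E ->
  mu1.-integrable setT (EFin \o V) /\ mu2.-integrable setT (EFin \o V).
Proof.
move=> doo.
have VE x : `|V x| = V x by rewrite ger0_norm// ltW// V_gt0.
have {}h : (`|\int[mu1]_x (V x)%:E - \int[mu2]_x (V x)%:E| < +oo)%E.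
  by apply: le_lt_trans doo; apply: Vdist_ge => // x; rewrite VE.
have i0 (mu : {measure set T -> \bar R}) : (0 <= \int[mu]_x (V x)%:E)%E.
  by apply: integral_ge0 => x _; rewrite lee_fin -VE.
have int (mu : {measure set T -> \bar R}) : (\int[mu]_x (V x)%:E < +oo)%E ->
    mu.-integrable setT (EFin \o V).
  move=> oo; apply/integrableP; split; first exact/measurable_EFinP.
  by under eq_integral do rewrite /= VE.
move: h (i0 mu1) (i0 mu2) (int mu1) (int mu2).
case: (\int[mu1]_x _)%E => [r1| |]; case: (\int[mu2]_x _)%E => [r2| |] //= _ _ _ i1 i2.
by split; [apply: i1|apply: i2]; exact: ltry.
Qed.

(** Normalising g by kappa makes it a test function of the distance. *)
Lemma Vdist_Rintegral mu1 mu2 c kappa g : (Vdist V mu1 mu2 <= c%:E)%E ->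
  Vbounded kappa g -> `|\int[mu1]_x g x - \int[mu2]_x g x| <= kappa * c.
Proof.
move=> dc gb; have [i1 i2] := Vdist_integrable (le_lt_trans dc (ltry c)).
have k0 : 0 <= kappa by exact: (Vbounded_ge0 point gb).
have ig1 := Vbounded_integrable i1 gb; have ig2 := Vbounded_integrable i2 gb.
case: (gb) => mg gV.
have [k1|k1] := ltP 0 kappa; last first.
  have kE : kappa = 0 by apply/eqP; rewrite eq_le k0 k1.
  have g0 x : g x = 0.
    by have := gV x; rewrite kE mul0r normr_le0 => /eqP.
  have z (mu : {measure set T -> \bar R}) : \int[mu]_x g x = 0.
    by rewrite /Rintegral integral0_eq// => x _; rewrite g0.
  by rewrite !z subrr normr0 kE mul0r.
have := @Vdist_ge mu1 mu2 (fun x => kappa^-1 * g x).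
have m1 : measurable_fun setT (fun x => kappa^-1 * g x).
  exact: measurable_funM.
move=> /(_ m1) h; have {}h := le_trans (h _) dc.
have {}h : (`|\int[mu1]_x (kappa^-1 * g x)%:E - \int[mu2]_x (kappa^-1 * g x)%:E| <= c%:E)%E.
  apply: h => x; rewrite normrM gtr0_norm ?invr_gt0// ler_pdivrMl//.
move: h; rewrite -!EFin_Rintegral; try exact: integrable_EFinZ.
rewrite -EFinB /= lee_fin !RintegralZl// -mulrBr normrM gtr0_norm ?invr_gt0//.
by rewrite ler_pdivrMl.
Qed.

End V_bounded.

Section vergodic.
Context {d : measure_display} {T : measurableType d} {R : realType}.
Variable V : T -> R.
Hypothesis mV : measurable_fun setT V.
Hypothesis V1 : forall x, 1 <= V x.
Variables (K : R.-pker T ~> T) (mupi : probability T R) (C rho : R).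
Hypothesis rho01 : 0 < rho < 1.
Hypothesis ergo : forall (n : nat) x,
  (Vdist V (kiter K n x) mupi <= (C * rho ^+ n * V x)%:E)%E.
Implicit Types (g : T -> R).

Local Notation Vb := (Vbounded V).
Let V0 x : 0 < V x. Proof. exact: V_gt0. Qed.
Let r1_gt0 : 0 < 1 - rho. Proof. by case/andP: rho01 => _; rewrite subr_gt0. Qed.

Definition kop g x := \int[K x]_y g y.
Definition kopn n g x := \int[kiter K n x]_y g y.

Lemma ergodic_cst_ge0 : 0 <= C.
Proof.
have := le_trans (Vdist_ge0 V1 _ _) (ergo 0 point).
by rewrite expr0 mulr1 lee_fin pmulr_lge0.
Qed.

Lemma kiter_V_integrable n x : (kiter K n x).-integrable setT (EFin \o V).
Proof. by case: (Vdist_integrable mV V1 (le_lt_trans (ergo n x) (ltry _))). Qed.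

Lemma invariant_V_integrable : mupi.-integrable setT (EFin \o V).
Proof. by case: (Vdist_integrable mV V1 (le_lt_trans (ergo 0 point) (ltry _))). Qed.

Lemma ge0_integral_kiterS (n : nat) x (h : T -> \bar R) : (forall y, 0 <= h y)%E ->
  measurable_fun setT h ->
  (\int[kiter K n.+1 x]_y h y = \int[kiter K n x]_y \int[K y]_z h z)%E.
Proof.
move=> h0 mh.
have := @integral_kcomp _ _ _ T T T R (kiter K n) (kernel.kernel_snd K) x h h0 mh.
move=> <-; apply: eq_measure_integral => A mA _; exact: erefl.
Qed.

Lemma ge0_integral_kiter0 x (h : T -> \bar R) : (forall y, 0 <= h y)%E ->
  measurable_fun setT h -> (\int[kiter K 0 x]_y h y = h x)%E.
Proof. by move=> h0 mh; rewrite /= integral_dirac// diracT mul1e. Qed.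

Lemma kernel_V_integrable x : (K x).-integrable setT (EFin \o V).
Proof.
apply/integrableP; split; first exact/measurable_EFinP.
have hV y : (0 <= `|(EFin \o V) y|)%E by [].
have mhV : measurable_fun setT (fun y => `|(EFin \o V) y|)%E.
  by apply: measurableT_comp => //; exact/measurable_EFinP.
have := kiter_V_integrable 1 x => /integrableP[_].
rewrite ge0_integral_kiterS// ge0_integral_kiter0//.
  by move=> y; exact: integral_ge0.
by apply: measurable_fun_integral_kernel => // U mU; exact: measurable_kernel.
Qed.

Lemma kernel_Vbounded_integrable x kappa g : Vb kappa g -> (K x).-integrable setT (EFin \o g).
Proof. exact: Vbounded_integrable (kernel_V_integrable x). Qed.

Lemma kiter_Vbounded_integrable n x kappa g : Vb kappa g ->
  (kiter K n x).-integrable setT (EFin \o g).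
Proof. exact: Vbounded_integrable (kiter_V_integrable n x). Qed.

Lemma kopn_ergo n kappa g x : Vb kappa g ->
  `|kopn n g x - \int[mupi]_y g y| <= kappa * (C * rho ^+ n * V x).
Proof. by move=> gb; exact: Vdist_Rintegral (ergo n x) gb. Qed.

Lemma kopn0 g x : measurable_fun setT g -> kopn 0 g x = g x.
Proof.
move=> mg; rewrite /kopn /Rintegral /= integral_dirac//; last exact/measurable_EFinP.
by rewrite diracT mul1e.
Qed.

Lemma measurable_kop g : measurable_fun setT g -> measurable_fun setT (kop g).
Proof.
move=> mg; rewrite /kop /Rintegral.
apply: (measurableT_comp (@fine_measurable R setT measurableT)) => //=.
have -> : (fun x => \int[K x]_y (g y)%:E)%E = (fun x =>
    \int[K x]_y ((EFin \o g) ^\+ y) - \int[K x]_y ((EFin \o g) ^\- y))%E.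
  by apply/funext => x; rewrite integralE.
have mE : measurable_fun setT (EFin \o g) by exact/measurable_EFinP.
apply: emeasurable_funB; apply: measurable_fun_integral_kernel => //.
- by move=> U mU; exact: measurable_kernel.
- exact: measurable_funepos.
- by move=> U mU; exact: measurable_kernel.
- exact: measurable_funeneg.
Qed.

Let kopnS_ge0 n g x : measurable_fun setT g -> (forall y, 0 <= g y) ->
  (forall y, (K y).-integrable setT (EFin \o g)) ->
  kopn n.+1 g x = kopn n (kop g) x.
Proof.
move=> mg g0 ig; rewrite /kopn /Rintegral ge0_integral_kiterS//; last first.
  exact/measurable_EFinP.
by congr fine; apply: eq_integral => y _; rewrite /kop EFin_Rintegral.
Qed.

(** Ergodicity at n = 1 bounds K V by mupi(V) + C rho V. *)
Lemma Vbounded_kop : exists M, forall kappa g, Vb kappa g -> Vb (kappa * M) (kop g).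
Proof.
exists (`|\int[mupi]_y V y| + C * rho) => kappa g gb; split.
  by apply: measurable_kop; case: gb.
move=> x; apply: le_trans (Vbounded_Rintegral_le (kernel_V_integrable x) gb) _.
rewrite -mulrA; apply: ler_wpM2l; first exact: (Vbounded_ge0 V1 point gb).
have -> : \int[K x]_y V y = kopn 1 V x.
  rewrite kopnS_ge0//; [|by move=> y; exact: ltW|exact: kernel_V_integrable].
  by rewrite kopn0//; exact: measurable_kop.
have := kopn_ergo 1 x (Vbounded_V mV V1); rewrite mul1r expr1.
rewrite ler_norml => /andP[_]; rewrite lerBlDl => /le_trans; apply.
rewrite mulrDl lerD2r; apply: le_trans (ler_norm _) _.
by rewrite ler_peMr.
Qed.

Lemma kopnB n k1 k2 g1 g2 x : Vb k1 g1 -> Vb k2 g2 ->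
  kopn n (fun y => g1 y - g2 y) x = kopn n g1 x - kopn n g2 x.
Proof.
move=> b1 b2; rewrite /kopn RintegralB//.
- exact: kiter_Vbounded_integrable b1.
- exact: kiter_Vbounded_integrable b2.
Qed.

Lemma kopB k1 k2 g1 g2 x : Vb k1 g1 -> Vb k2 g2 ->
  kop (fun y => g1 y - g2 y) x = kop g1 x - kop g2 x.
Proof.
move=> b1 b2; rewrite /kop RintegralB//.
- exact: kernel_Vbounded_integrable b1.
- exact: kernel_Vbounded_integrable b2.
Qed.

Lemma VboundedZ kappa c g : Vb kappa g -> Vb (`|c| * kappa) (fun x => c * g x).
Proof.
move=> [mg gb]; split; first exact: measurable_funM.
by move=> x; rewrite normrM -mulrA ler_wpM2l.
Qed.

(** Linearity: g is the difference of the nonnegative functions g + kappa V and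
    kappa V. *)
Lemma kopnS n kappa g x : Vb kappa g -> kopn n.+1 g x = kopn n (kop g) x.
Proof.
move=> gb; have k0 : 0 <= kappa by exact: (Vbounded_ge0 V1 point gb).
have [M hM] := Vbounded_kop.
have Vbk : Vb (`|kappa| * 1) (fun x => kappa * V x) by apply: VboundedZ; exact: Vbounded_V.
pose h x := g x + kappa * V x.
have hb : Vb (kappa + `|kappa| * 1) h by exact: VboundedD.
have gE : g = fun x => h x - kappa * V x by apply/funext => y; rewrite /h addrK.
have gb2 := gb.
rewrite gE (kopnB _ _ hb Vbk).
have -> : kop (fun x => h x - kappa * V x) =
   fun x => kop h x - kop (fun x => kappa * V x) x.
  by apply/funext => y; rewrite (kopB _ hb Vbk).
rewrite (kopnB _ _ (hM _ _ hb) (hM _ _ Vbk)).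
congr (_ - _); apply: kopnS_ge0.
- by case: hb.
- by move=> y; rewrite /h; case: gb => _ /(_ y); rewrite ler_norml; lra.
- by move=> y; exact: kernel_Vbounded_integrable hb.
- by case: Vbk.
- by move=> y; rewrite mulr_ge0// ltW.
- by move=> y; exact: kernel_Vbounded_integrable Vbk.
Qed.

Lemma kopn_kop n kappa g x : Vb kappa g -> kopn n (kop g) x = kop (kopn n g) x.
Proof.
have [M hM] := Vbounded_kop.
elim: n kappa g x => [|n IH] kappa g x gb.
  have [mg _] := gb; rewrite kopn0; last by case: (hM _ _ gb).
  by apply: eq_Rintegral => y _; rewrite kopn0.
rewrite (kopnS _ _ (hM _ _ gb)) (IH _ _ _ (hM _ _ gb)).
by apply: eq_Rintegral => y _; rewrite (kopnS _ _ gb).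
Qed.

Lemma Vbounded_kopn n kappa g : Vb kappa g ->
  exists M, Vb M (kopn n g).
Proof.
have [M hM] := Vbounded_kop; elim: n kappa g => [|n IH] kappa g gb.
  exists kappa; have -> // : kopn 0 g = g.
  by apply/funext => x; rewrite kopn0//; case: gb.
have [M' h'] := IH _ _ (hM _ _ gb).
by exists M'; have -> : kopn n.+1 g = kopn n (kop g); [apply/funext => x; exact: kopnS gb|].
Qed.

Lemma kopn_cst n c x : kopn n (cst c) x = c.
Proof.
have mass m y : (kiter K m y setT = 1)%E.
  elim: m y => [|m IH] y; first by rewrite /= diracT.
  have := @ge0_integral_kiterS m y (cst 1%E) _ _; rewrite !integral_cst// !mul1e.
  move=> -> //; rewrite (eq_integral (cst 1%E)); last first.
    by move=> z _; rewrite integral_cst// mul1e prob_kernel.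
  by rewrite integral_cst// mul1e.
by rewrite /kopn Rintegral_cst// mass mulr1.
Qed.

(** The solution of the Poisson equation for g, normalised to vanish at the
    base point rather than to have mean zero: this keeps the unknown invariant
    mean out of the definition. *)
Definition poisson_part g n x := kopn n g x - kopn n g point.

Definition poisson_sol g x := limn (series (fun n => poisson_part g n x)).

Lemma poisson_part_le kappa g n x : Vb kappa g ->
  `|poisson_part g n x| <= kappa * C * (V x + V point) * rho ^+ n.
Proof.
move=> gb; have h1 := kopn_ergo n x gb; have h2 := kopn_ergo n point gb.
have -> : poisson_part g n x = (kopn n g x - \int[mupi]_y g y) -
   (kopn n g point - \int[mupi]_y g y) by rewrite /poisson_part; ring.
apply: le_trans (ler_normB _ _) _; apply: le_trans (lerD h1 h2) _.
by rewrite le_eqVlt; apply/orP; left; apply/eqP; ring.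
Qed.

Lemma geometric_tail (u : R^nat) (A : R) : 0 <= A -> (forall n, `|u n| <= A * rho ^+ n) ->
  cvgn (series u) /\
  forall N, `|limn (series u) - series u N| <= A * rho ^+ N / (1 - rho).
Proof.
move=> A0 uA.
have /andP[r0 r01] := rho01; have r1 : 0 < 1 - rho by rewrite subr_gt0.
have sumr n N : (N <= n)%N -> \sum_(N <= k < n) `|u k| <= A * rho ^+ N / (1 - rho).
  move=> Nn; apply: le_trans (_ : A * (rho ^+ N - rho ^+ n) / (1 - rho) <= _).
    elim: n Nn => [|n IH]; first by rewrite leqn0 => /eqP ->; rewrite big_geq// subrr mulr0 mul0r.
    rewrite leq_eqVlt => /predU1P[<-|]; first by rewrite big_geq// subrr mulr0 mul0r.
    rewrite ltnS => Nn; rewrite big_nat_recr//=; apply: le_trans (lerD (IH Nn) (uA n)) _.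
    rewrite exprS le_eqVlt; apply/orP; left; apply/eqP; field; lra.
  rewrite ler_pM2r ?invr_gt0// ler_wpM2l// gerDl oppr_le0 exprn_ge0//; lra.
have cu : cvgn (series u).
  apply: normed_cvg; apply: nondecreasing_is_cvgn.
    by apply/nondecreasing_seqP => k; rewrite [leRHS]seriesSr lerDl normr_ge0.
  exists (A * rho ^+ 0 / (1 - rho)) => _ [n _ <-]; exact: sumr.
split=> // N.
have cd : (fun n => `|series u n - series u N|) @ \oo --> `|limn (series u) - series u N|.
  by apply: cvg_norm; apply: cvgB => //; exact: cvg_cst.
rewrite -(cvg_lim _ cd)//; apply: limr_le.
  by apply/cvg_ex; eexists; exact: cd.
exists N => // n /= Nn; rewrite sub_series_geq//.
by apply: le_trans (ler_norm_sum _ _ _) _; exact: sumr.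
Qed.

Let A kappa x := kappa * C * (V x + V point).

Let A_ge0 kappa g x : Vb kappa g -> 0 <= A kappa x.
Proof.
move=> gb; rewrite /A !mulr_ge0 ?ergodic_cst_ge0 ?addr_ge0 ?(ltW (V0 _))//.
exact: (Vbounded_ge0 V1 point gb).
Qed.

Lemma poisson_sol_tail kappa g x N : Vb kappa g ->
  `|poisson_sol g x - series (fun n => poisson_part g n x) N| <=
  kappa * C * (V x + V point) * rho ^+ N / (1 - rho).
Proof.
move=> gb; have [_] := geometric_tail (A_ge0 x gb) (fun n => poisson_part_le n x gb).
exact.
Qed.

Lemma poisson_sol_cvg kappa g x : Vb kappa g ->
  series (fun n => poisson_part g n x) @ \oo --> poisson_sol g x.
Proof.
by move=> gb; have [] := geometric_tail (A_ge0 x gb) (fun n => poisson_part_le n x gb).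
Qed.

Lemma poisson_sol_le kappa g x : Vb kappa g ->
  `|poisson_sol g x| <= kappa * (C / (1 - rho)) * (1 + V point) * V x.
Proof.
move=> gb; have := poisson_sol_tail x 0 gb; rewrite seriesEnat /= big_geq// subr0.
rewrite expr0 mulr1 => /le_trans; apply.
have k0 := Vbounded_ge0 V1 point gb.
have -> : kappa * C * (V x + V point) / (1 - rho) =
  (kappa * (C / (1 - rho))) * (V x + V point) by ring.
rewrite -[leRHS]mulrA; apply: ler_wpM2l.
  by rewrite mulr_ge0// divr_ge0 ?ergodic_cst_ge0// ltW.
have := V1 x; have := V1 point; nra.
Qed.

Lemma measurable_poisson_sol kappa g : Vb kappa g -> measurable_fun setT (poisson_sol g).
Proof.
move=> gb; apply: (@measurable_fun_cvg _ _ _ setT (fun N x => series (fun n => poisson_part g n x) N)).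
  move=> N; apply: measurable_sum => n; apply: measurable_funB => //.
  by have [M []] := Vbounded_kopn n gb.
by move=> x _; exact: poisson_sol_cvg gb.
Qed.

Lemma Vbounded_poisson_sol kappa g : Vb kappa g ->
  Vb (kappa * (C / (1 - rho)) * (1 + V point)) (poisson_sol g).
Proof.
by move=> gb; split; [exact: measurable_poisson_sol gb|move=> x; exact: poisson_sol_le].
Qed.

Lemma geometric_eq0 (a B : R) : (forall n, `|a| <= B * rho ^+ n) -> a = 0.
Proof.
move=> aB; have /andP[r0 r01] := rho01.
have cB : (fun n => B * rho ^+ n) @ \oo --> B * 0.
  by apply: cvgM; [exact: cvg_cst|apply: cvg_expr; rewrite gtr0_norm].
apply/eqP; rewrite -normr_le0 -[leRHS](mulr0 B) -(cvg_lim _ cB)//.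
by apply: limr_ge; [apply/cvg_ex; eexists; exact: cB|exact: nearW].
Qed.

Let partial_sum g N x := series (fun n => poisson_part g n x) N.

Let Vbounded_partial_sum kappa g N : Vb kappa g -> exists M, Vb M (partial_sum g N).
Proof.
move=> gb; elim: N => [|N [M hM]].
  exists `|0 : R|; have -> : partial_sum g 0 = cst 0.
    by apply/funext => x; rewrite /partial_sum seriesEnat /= big_geq.
  exact: Vbounded_cst.
have [M' h'] := Vbounded_kopn N gb.
exists (M + (M' + `|kopn N g point|)).
have -> : partial_sum g N.+1 = fun x => partial_sum g N x + (kopn N g x - cst (kopn N g point) x).
  by apply/funext => x; rewrite /partial_sum seriesSr.
by apply: VboundedD => //; apply: VboundedB => //; exact: Vbounded_cst.
Qed.

Let partial_sum_eq kappa g N x : Vb kappa g ->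
  partial_sum g N x - kop (partial_sum g N) x = g x - kopn N g x.
Proof.
move=> gb; elim: N x => [|N IH] x.
  have -> : partial_sum g 0 = cst 0.
    by apply/funext => y; rewrite /partial_sum seriesEnat /= big_geq.
  rewrite kopn0; last by case: gb.
  by rewrite /kop Rintegral_cst// mul0r !subrr.
have [M hM] := Vbounded_partial_sum N gb; have [M' h'] := Vbounded_kopn N gb.
have -> : partial_sum g N.+1 = fun x => partial_sum g N x - (cst (kopn N g point) x - kopn N g x).
  by apply/funext => y; rewrite /partial_sum seriesSr /poisson_part /=; ring.
have hc := Vbounded_cst V1 (kopn N g point).
rewrite (kopB _ hM (VboundedB hc h')) (kopB _ hc h').
rewrite -(kopn_kop _ _ gb) -(kopnS _ _ gb).
have -> : kop (cst (kopn N g point)) x = kopn N g point.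
  by rewrite /kop Rintegral_cst// prob_kernel mulr1.
have := IH x; rewrite /=; lra.
Qed.

(** The partial sums telescope to g - K^N g, and K^N g tends to the invariant mean;
    all errors are geometric in N. *)
Lemma poisson_eq kappa g x : Vb kappa g ->
  poisson_sol g x - kop (poisson_sol g) x = g x - \int[mupi]_y g y.
Proof.
move=> gb; apply/eqP; rewrite -subr_eq0; apply/eqP.
pose D := kappa * C / (1 - rho) * (1 + V point).
have k0 := Vbounded_ge0 V1 point gb.
have D0 : 0 <= D.
  rewrite /D !mulr_ge0 ?ergodic_cst_ge0 ?invr_ge0 ?(ltW r1_gt0)// addr_ge0// ltW//.
have tail N : Vb (D * rho ^+ N) (fun y => poisson_sol g y - partial_sum g N y).
  have [M [hM _]] := Vbounded_partial_sum N gb; split.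
    by apply: measurable_funB => //; exact: measurable_poisson_sol gb.
  move=> y; apply: le_trans (poisson_sol_tail y N gb) _.
  have -> : kappa * C * (V y + V point) * rho ^+ N / (1 - rho) =
    (kappa * C / (1 - rho) * rho ^+ N) * (V y + V point) by ring.
  have -> : D * rho ^+ N * V y =
    (kappa * C / (1 - rho) * rho ^+ N) * ((1 + V point) * V y) by rewrite /D; ring.
  apply: ler_wpM2l; last by have := V1 y; have := V1 point; nra.
  rewrite !mulr_ge0 ?ergodic_cst_ge0 ?invr_ge0 ?(ltW r1_gt0)// exprn_ge0//.
  by case/andP: rho01 => /ltW.
have [M hM] := Vbounded_kop.
apply: (@geometric_eq0 _ (D * V x + D * M * V x + kappa * C * V x)) => N.
have hP := Vbounded_poisson_sol gb; have [MS hS] := Vbounded_partial_sum N gb.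
have t1 : `|poisson_sol g x - partial_sum g N x| <= D * rho ^+ N * V x by case: (tail N).
have t2 : `|kop (fun y => poisson_sol g y - partial_sum g N y) x| <= D * rho ^+ N * M * V x.
  by case: (hM _ _ (tail N)).
have t3 := kopn_ergo N x gb.
rewrite (kopB _ hP hS) in t2.
have := partial_sum_eq N x gb.
have -> : (D * V x + D * M * V x + kappa * C * V x) * rho ^+ N =
  D * rho ^+ N * V x + D * rho ^+ N * M * V x + kappa * (C * rho ^+ N * V x) by ring.
move: t1 t2 t3; rewrite !ler_norml => t1 t2 t3 e; apply/andP.
by split; lra.
Qed.

(** The partial sums for H telescope to G x - G point minus the same difference
    after N steps of the chain, which is geometrically small. The constant c
    cancels between x and the base point. *)
Lemma poisson_sol_uniq kappa eta G H c x : Vb kappa G -> Vb eta H ->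
  (forall y, G y - kop G y = H y - c) -> poisson_sol H x = G x - G point.
Proof.
move=> Gb Hb GH.
have step n y : kopn n H y = kopn n G y - kopn n.+1 G y + c.
  have [M hM] := Vbounded_kop; have hc := Vbounded_cst V1 (- c).
  have HE : H = fun y => (G y - kop G y) - cst (- c) y.
    by apply/funext => z; rewrite GH /= opprK subrK.
  rewrite HE (kopnB _ _ (VboundedB Gb (hM _ _ Gb)) hc) (kopnB _ _ Gb (hM _ _ Gb)).
  by rewrite kopn_cst -(kopnS _ _ Gb) opprK.
have sum N : series (fun n => poisson_part H n x) N =
    (G x - G point) - poisson_part G N x.
  elim: N => [|N IH].
    have [mG _] := Gb.
    by rewrite seriesEnat /= big_geq// /poisson_part !kopn0// subrr.
  by rewrite seriesSr IH /poisson_part !step; ring.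
apply/eqP; rewrite -subr_eq0; apply/eqP.
apply: (@geometric_eq0 _ (eta * C * (V x + V point) / (1 - rho) + kappa * C * (V x + V point))) => N.
have t1 := poisson_sol_tail x N Hb; have t2 := poisson_part_le N x Gb.
rewrite sum in t1; rewrite mulrDl.
have -> : eta * C * (V x + V point) / (1 - rho) * rho ^+ N =
  eta * C * (V x + V point) * rho ^+ N / (1 - rho) by ring.
move: t1 t2; rewrite !ler_norml => t1 t2; apply/andP; split; lra.
Qed.

Lemma poisson_sol_point g : poisson_sol g point = 0.
Proof.
rewrite /poisson_sol.
have -> : series (fun n => poisson_part g n point) = cst 0.
  by apply/funext => n; rewrite seriesEnat /= big1// => i _; rewrite /poisson_part subrr.
exact: lim_cst.
Qed.

End vergodic.

(** The difference of the solutions for two kernels solves, for the first kernel,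
    a Poisson equation whose right-hand side is small; since both solutions vanish
    at the base point, [poisson_sol_uniq] identifies it. *)
Lemma poisson_sol_perturb {d} {T : measurableType d} {R : realType} (V : T -> R)
    (K1 K2 : R.-pker T ~> T) (pi1 pi2 : probability T R) (C1 rho1 C2 rho2 : R)
    (g1 g2 : T -> R) (kappa a dv : R) x :
  measurable_fun setT V -> (forall x, 1 <= V x) ->
  0 < rho1 < 1 ->
  (forall (n : nat) x, (Vdist V (kiter K1 n x) pi1 <= (C1 * rho1 ^+ n * V x)%:E)%E) ->
  0 < rho2 < 1 ->
  (forall (n : nat) x, (Vdist V (kiter K2 n x) pi2 <= (C2 * rho2 ^+ n * V x)%:E)%E) ->
  Vbounded V kappa g1 -> Vbounded V kappa g2 ->
  (forall y, `|g2 y - g1 y| <= a * V y) ->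
  (forall y, (Vdist V (K2 y) (K1 y) <= (dv * V y)%:E)%E) ->
  `|poisson_sol K2 g2 x - poisson_sol K1 g1 x| <=
  (a + kappa * (C2 / (1 - rho2)) * (1 + V point) * dv) * (C1 / (1 - rho1))
    * (1 + V point) * V x.
Proof.
move=> mV V1 r1 e1 r2 e2 b1 b2 ga Kdv.
have P1 := Vbounded_poisson_sol mV V1 r1 e1 b1.
have P2 := Vbounded_poisson_sol mV V1 r2 e2 b2.
set kap := kappa * (C2 / (1 - rho2)) * (1 + V point) in P2 *.
pose G y := poisson_sol K2 g2 y - poisson_sol K1 g1 y.
have Gb := VboundedB P2 P1; rewrite -/G in Gb.
pose H y := (g2 y - g1 y) + (kop K2 (poisson_sol K2 g2) y - kop K1 (poisson_sol K2 g2) y).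
have Hb : Vbounded V (a + kap * dv) H.
  split.
    apply: measurable_funD; apply: measurable_funB; try by case: b1; case: b2.
    - by apply: measurable_kop; case: P2.
    - by apply: measurable_kop; case: P2.
  move=> y; rewrite mulrDl; apply: le_trans (ler_normD _ _) _; apply: lerD; first exact: ga.
  rewrite -mulrA; exact: (Vdist_Rintegral mV V1 (Kdv y) P2).
have GH y : G y - kop K1 G y = H y - (\int[pi2]_z g2 z - \int[pi1]_z g1 z).
  rewrite /G (kopB mV V1 e1 _ P2 P1) /H.
  have := poisson_eq mV V1 r1 e1 y b1; have := poisson_eq mV V1 r2 e2 y b2.
  move: (poisson_sol K1 g1 y) (poisson_sol K2 g2 y) (kop K1 (poisson_sol K1 g1) y)
    (kop K2 (poisson_sol K2 g2) y) (kop K1 (poisson_sol K2 g2) y).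
  clear=> s1 s2 k11 k22 k12 h2 h1.
  have -> : k22 = s2 - (g2 y - \int[pi2]_z g2 z) by rewrite -h2 subKr.
  have -> : k11 = s1 - (g1 y - \int[pi1]_z g1 z) by rewrite -h1 subKr.
  by ring.
have G0 : G point = 0 by rewrite /G !poisson_sol_point subrr.
have := poisson_sol_uniq mV V1 r1 e1 x Gb Hb GH; rewrite G0 subr0 => GE.
rewrite -/(G x) -GE; exact: (poisson_sol_le mV V1 r1 e1 x Hb).
Qed.

(** * The joint law of a state and its successor *)

Lemma measurable_fun_kernel_Rintegral {d1 d2} {S : measurableType d1}
    {T : measurableType d2} {R : realType} (k : R.-pker S ~> T) (H : S * T -> R) :
  measurable_fun setT H ->
  measurable_fun setT (fun s => \int[k s]_y H (s, y)).
Proof.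
move=> mH; rewrite /Rintegral.
apply: (measurableT_comp (@fine_measurable R setT measurableT)) => //=.
have mE : measurable_fun setT (EFin \o H) by exact/measurable_EFinP.
have -> : (fun s => \int[k s]_y (H (s, y))%:E)%E = (fun s =>
    \int[k s]_y ((EFin \o H) ^\+ (s, y)) - \int[k s]_y ((EFin \o H) ^\- (s, y)))%E.
  by apply/funext => s; rewrite integralE; congr (_ - _)%E;
    apply: eq_integral => y _; rewrite ?funeposE ?funenegE.
apply: emeasurable_funB.
- apply: (measurable_fun_integral_sfinite_kernel _ k) => //.
  exact: measurable_funepos.
- apply: (measurable_fun_integral_sfinite_kernel _ k) => //.
  exact: measurable_funeneg.
Qed.

Section graph_kernel.
Context {d1 d2 : measure_display} {S : measurableType d1} {T : measurableType d2}
  {R : realType}.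
Variable k : R.-pker S ~> T.

Let mpair (s : S) : measurable_fun setT (pair s : T -> S * T).
Proof. exact: pair1_measurable. Qed.

(** The law of (s, y) for y drawn from [k s]. The idle first argument gives it
    the shape of the kernels that compose with [kcomp]. *)
Definition graph_kernel (us : unit * S) : {measure set (S * T) -> \bar R} :=
  measure_function_pushforward__canonical__measure_function_Measure
    (k us.2) (mpair us.2).

Let measurable_graph_kernel U : measurable U ->
  measurable_fun setT (graph_kernel ^~ U).
Proof.
move=> mU; rewrite /graph_kernel /= /pushforward.
have mk := @measurable_kfcomp _ _ S T R k (EFin \o \1_U) _ _.
have {}mk : measurable_fun setT (kfcomp k (EFin \o \1_U)).
  apply: mk => [|t]; last by rewrite lee_fin.
  by apply/measurable_EFinP; exact: measurable_indic.
rewrite kfcompkindic// in mk.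
have ms : measurable_fun setT (@snd unit S) by exact: measurable_snd.
rewrite (_ : (fun x => _) = (fun s => k s (xsection U s)) \o snd).
  exact: measurableT_comp mk ms.
by apply/funext => x /=; rewrite xsectionE.
Qed.

HB.instance Definition _ := isKernel.Build _ _ _ _ R graph_kernel measurable_graph_kernel.

Let graph_kernel_prob us : graph_kernel us setT = 1%E.
Proof. by rewrite /graph_kernel /= /pushforward preimage_setT prob_kernel. Qed.

HB.instance Definition _ := Kernel_isProbability.Build _ _ _ _ R graph_kernel graph_kernel_prob.

End graph_kernel.

Section markov_property.
Context {dO d1 d2 : measure_display} {Omega : measurableType dO}
  {S : measurableType d1} {T : measurableType d2} {R : realType}.
Variables (Pr : probability Omega R) (k : R.-pker S ~> T).
Variables (Y : Omega -> S) (X : Omega -> T).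
Hypothesis mY : measurable_fun setT Y.
Hypothesis mX : measurable_fun setT X.
Hypothesis rect : forall A B, measurable A -> measurable B ->
  (Pr (Y @^-1` A `&` X @^-1` B) = \int[Pr]_(w in Y @^-1` A) k (Y w) B)%E.

(** Rectangles generate the product sigma-algebra and are stable under
    intersection, so [rect] identifies the law of (Y, X) with the law of Y followed
    by [graph_kernel k]. *)
Lemma joint_law_disintegration (H : S * T -> \bar R) :
  (forall z, 0 <= H z)%E -> measurable_fun setT H ->
  (\int[Pr]_w H (Y w, X w) = \int[Pr]_w \int[k (Y w)]_y H (Y w, y))%E.
Proof.
move=> H0 mH.
have mYX : measurable_fun setT (fun w => (Y w, X w)) by exact/measurable_fun_pair.
pose Ym : {mfun Omega >-> S} := mfun_Sub (mem_set mY).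
pose YXm : {mfun Omega >-> (S * T)%type} := mfun_Sub (mem_set mYX).
pose law : probability S R := distribution Pr Ym.
pose l := kprobability (measurable_cst (law : pprobability S R) : measurable_fun [set: unit] _).
have lawE (f : S -> \bar R) : (forall s, 0 <= f s)%E -> measurable_fun setT f ->
    (\int[law]_s f s = \int[Pr]_w f (Y w))%E.
  by move=> f0 mf; rewrite /law (ge0_integral_pushforward mY)//= preimage_setT.
have mk B : measurable B -> measurable_fun setT (fun s => k s B) by exact: measurable_kernel.
have eq_law U : measurable U -> distribution Pr YXm U = kcomp l (graph_kernel k) tt U.
  pose G : set (set (S * T)) := [set A `*` B | A in measurable & B in measurable].
  apply: (measure_unique G (fun=> setT)) => //.
  - exact: measurable_prod_measurableType.
  - move=> _ _ [A1 mA1 [B1 mB1 <-]] [A2 mA2 [B2 mB2 <-]].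
    exists (A1 `&` A2); first exact: measurableI.
    by exists (B1 `&` B2); [exact: measurableI|rewrite setXI].
  - by move=> _; exists setT => //; exists setT => //; rewrite setXTT.
  - by rewrite bigcup_const//; exists 0%N.
  - move=> _ [A mA [B mB <-]].
    transitivity (Pr (Y @^-1` A `&` X @^-1` B)); first by [].
    rewrite rect// /kcomp /l /=.
    transitivity (\int[law]_s ((\1_A s)%:E * k s B))%E; last first.
      apply: eq_integral => s _; rewrite /graph_kernel /= /pushforward indicE.
      have [sA|sA] := boolP (s \in A).
        rewrite mul1e; congr (k s _); apply/seteqP; split => y /=; last by case.
        by split => //; exact: set_mem.
      rewrite mul0e [X in k s X](_ : _ = set0) ?measure0//.
      by apply/seteqP; split => y //= -[/mem_set]; rewrite (negbTE sA).
    rewrite lawE; last 2 first.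
    + by move=> s; rewrite mule_ge0// lee_fin.
    + by apply: emeasurable_funM; [exact/measurable_EFinP/measurable_indic|exact: mk].
    rewrite integral_mkcond; apply: eq_integral => w _; rewrite patchE.
    have -> : (w \in Y @^-1` A) = (Y w \in A) by apply/idP/idP; rewrite !inE.
    by rewrite indicE; case: (_ \in A); rewrite ?mul1e ?mul0e.
  - by move=> _; apply: (le_lt_trans (probability_le1 (distribution Pr YXm) measurableT)); exact: ltry.
transitivity (\int[distribution Pr YXm]_z H z)%E.
  by rewrite (ge0_integral_pushforward mYX)//= preimage_setT.
transitivity (\int[kcomp l (graph_kernel k) tt]_z H z)%E.
  by apply: eq_measure_integral => U mU _; exact: eq_law.
rewrite integral_kcomp// /l /=.
have mint : measurable_fun setT (fun s => \int[k s]_y H (s, y))%E.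
  exact: (measurable_fun_integral_sfinite_kernel H k).
rewrite -(lawE (fun s => \int[k s]_y H (s, y))%E)//; last first.
  by move=> s; exact: integral_ge0.
apply: eq_integral => s _; rewrite /graph_kernel /=.
by rewrite (ge0_integral_pushforward (pair1_measurable s))//= preimage_setT.
Qed.

End markov_property.

(** * Power means, series and constants *)

Section power_means.
Context {R : realType}.
Implicit Types (alpha t v x y : R).

(** A substitute, up to a constant, for the tangent inequality of v^alpha at t: the
    first term is at least v when v <= t, the second one otherwise. *)
Lemma powR_tangent alpha t v : 1 <= alpha -> 0 < t -> 0 <= v ->
  v <= t + t `^ (1 - alpha) * v `^ alpha.
Proof.
move=> a1 t0 v0; have [vt|tv] := leP v t.
  by apply: le_trans vt _; rewrite lerDl mulr_ge0// powR_ge0.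
have v1 : 0 < v by exact: lt_trans tv.
apply: le_trans (_ : t `^ (1 - alpha) * v `^ alpha <= _); last by rewrite lerDr ltW.
rewrite -{1}(powRr1 v0) -[X in v `^ X](subrK alpha 1).
rewrite powRD; last by rewrite (gt_eqF v1) implybT.
apply: ler_wpM2r; first exact: powR_ge0.
have -> : 1 - alpha = - (alpha - 1) by ring.
rewrite !powRN lef_pV2 ?posrE ?powR_gt0//.
by apply: ge0_ler_powR; rewrite ?nnegrE ?subr_ge0// ltW.
Qed.

Lemma le_add1_powR alpha t : 1 <= alpha -> 0 <= t -> t <= 1 + t `^ alpha.
Proof.
by move=> a1 t0; have := powR_tangent a1 ltr01 t0; rewrite powR1 mul1r.
Qed.

Lemma exprn_le_powR alpha n x M : 0 < alpha <= n%:R -> 0 <= x <= M -> 1 <= M ->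
  x ^+ n <= M ^+ n * x `^ alpha.
Proof.
move=> /andP[a0 an] /andP[x0 xM] M1; have M0 : 0 < M by apply: lt_le_trans M1.
have n0 : (0 < n)%N by rewrite -(ltr0n R); exact: lt_le_trans an.
have [->|xn0] := eqVneq x 0.
  by rewrite expr0n gtn_eqF//= mulr_ge0 ?powR_ge0// exprn_ge0// ltW.
have x1 : 0 < x by rewrite lt_neqAle eq_sym xn0.
have q1 : 0 < x / M <= 1 by rewrite divr_gt0//= ler_pdivrMr// mul1r.
have -> : x ^+ n = M ^+ n * (x / M) ^+ n.
  by rewrite -exprMn mulrCA divff ?mulr1// gt_eqF.
apply: ler_wpM2l; first by rewrite exprn_ge0// ltW.
rewrite -powR_mulrn; last by case/andP: q1 => /ltW.
apply: le_trans (ger_powR q1 an) _; apply: ge0_ler_powR; rewrite ?nnegrE ?(ltW a0)//.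
  by case/andP: q1 => /ltW.
by rewrite ler_pdivrMr// ler_peMr.
Qed.

(** The terms of a convergent series are bounded, and on a bounded set the higher
    power is dominated by the lower one. *)
Lemma powR_series_exprn alpha n (u : R^nat) : 1 <= alpha <= n%:R ->
  (forall k, 0 <= u k) -> cvgn (series (fun k => u k `^ alpha)) ->
  cvgn (series (fun k => u k ^+ n)).
Proof.
move=> /andP[a1 an] u0 cu; have a0 : 0 < alpha by exact: lt_le_trans a1.
have [S hS] := cvg_seq_bound cu.
have uS k : u k `^ alpha <= S.
  apply: le_trans (hS k.+1); apply: le_trans (ler_norm _).
  by rewrite /series /= big_nat_recr//= lerDr sumr_ge0// => i _; exact: powR_ge0.
have S0 : 0 <= S by exact: le_trans (powR_ge0 _ _) (uS 0%N).
pose M := 1 + S; have M1 : 1 <= M by rewrite lerDl.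
have uM k : 0 <= u k <= M.
  by rewrite u0 /= (le_trans (le_add1_powR a1 (u0 k)))// lerD2l.
apply: (@series_bounded_cvg _ _ (M ^+ n * S)) => [k|k]; first exact: exprn_ge0.
apply: le_trans (_ : \sum_(0 <= i < k) M ^+ n * u i `^ alpha <= _).
  by apply: ler_sum => i _; apply: exprn_le_powR => //; rewrite a0.
rewrite -mulr_sumr ler_wpM2l//; first by rewrite exprn_ge0// (le_trans _ M1).
by apply: le_trans (hS k); exact: ler_norm.
Qed.

Lemma series_le_cvg_scale c (u v : R^nat) : (forall k, 0 <= u k) ->
  (forall k, u k <= c * v k) -> cvgn (series v) -> cvgn (series u).
Proof.
move=> u0 uv cv; have [B hB] := cvg_seq_bound cv.
have cB k : `|c * series v k| <= `|c| * B by rewrite normrM ler_wpM2l.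
apply: (@series_bounded_cvg _ _ (`|c| * B)) => // k.
apply: le_trans (cB k); apply: le_trans (ler_norm _).
by rewrite /series /= mulr_sumr; apply: ler_sum.
Qed.

Lemma cvg_seriesD (u v : R^nat) : cvgn (series u) -> cvgn (series v) ->
  cvgn (series (fun k => u k + v k)).
Proof.
move=> cu cv; have -> : series (fun k => u k + v k) = series u + series v.
  by apply/funext => k; rewrite /series /= big_split.
exact: is_cvgD.
Qed.

End power_means.

(** Jensen's inequality up to a constant: integrate [powR_tangent] at the level
    t with t^alpha equal to the moment of order alpha. *)
Lemma mean_powR_le {R : realType} {d} {T : measurableType d} (mu : {measure set T -> \bar R})
    (V : T -> R) (alpha : R) : 1 <= alpha -> mu setT = 1%E ->
    (forall x, 1 <= V x) -> measurable_fun setT V ->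
    mu.-integrable setT (EFin \o V) ->
    (\int[mu]_x (V x `^ alpha)%:E < +oo)%E ->
  (\int[mu]_x V x) `^ alpha <= 2 `^ alpha * \int[mu]_x (V x `^ alpha).
Proof.
move=> a1 mu1 V1 mV iV Ioo; have a0 : 0 < alpha by exact: lt_le_trans a1.
have V0 x : 0 <= V x by exact: le_trans (V1 x).
have mVa : measurable_fun setT (fun x => V x `^ alpha).
  exact: (measurableT_comp (@measurable_powR R alpha)).
have iVa : mu.-integrable setT (EFin \o (fun x => V x `^ alpha)).
  apply/integrableP; split; first exact/measurable_EFinP.
  by under eq_integral do rewrite /= ger0_norm ?powR_ge0//.
have i1 c : mu.-integrable setT (EFin \o cst c).
  apply: le_integrable_EFin (integrable_EFinZ `|c| iV) => // x /=.
  by rewrite ler_peMr.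
set I := \int[mu]_x (V x `^ alpha).
have I1 : 1 <= I.
  have <- : \int[mu]_x (cst 1 x : R) = 1 by rewrite Rintegral_cst// mu1 mulr1.
  apply: le_Rintegral => // x _; rewrite /= (le_trans (V1 x))// le1r_powR//.
pose t := I `^ alpha^-1; have I0 : 0 < I by exact: lt_le_trans I1.
have t0 : 0 < t by exact: powR_gt0.
have tI : t `^ alpha = I by rewrite -powRrM mulVf ?gt_eqF// powRr1// ltW.
have key : \int[mu]_x V x <= 2 * t.
  apply: le_trans (_ : \int[mu]_x (cst t x + t `^ (1 - alpha) * V x `^ alpha) <= _).
    apply: le_Rintegral => //.
      exact: integrable_EFinD (i1 t) (integrable_EFinZ _ iVa).
    by move=> x _; exact: powR_tangent.
  rewrite (RintegralD measurableT (i1 t) (integrable_EFinZ _ iVa)).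
  rewrite Rintegral_cst// mu1 mulr1 RintegralZl// -/I -{1}tI.
  rewrite -powRD; last by rewrite (gt_eqF t0) implybT.
  by rewrite subrK powRr1 ?(ltW t0)//; lra.
apply: le_trans (_ : (2 * t) `^ alpha <= _); last first.
  by rewrite powRM ?(ltW t0)// tI.
apply: ge0_ler_powR; rewrite ?nnegrE ?(ltW a0)//.
  by apply: Rintegral_ge0.
by rewrite mulr_ge0// ltW.
Qed.

Lemma nneseries_shift1 {R : realType} (t : nat -> \bar R) : (forall k, 0 <= t k)%E ->
  (\sum_(0 <= k <oo) t k.+1 <= \sum_(1 <= k <oo) t k)%E.
Proof.
move=> t0; apply: lime_le; first by apply: is_cvg_nneseries => k _ _.
apply: nearW => n /=.
have -> : (\sum_(0 <= k < n) t k.+1 = \sum_(1 <= k < n.+1) t k)%E by rewrite big_add1.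
by apply: nneseries_lim_ge => k _.
Qed.

Section drift_constants.
Context {R : realType} {dTh : measure_display} {Theta : measurableType dTh}.
Variables (C rho : Theta -> R).
Hypothesis rho01 : forall t, 0 < rho t < 1.

Lemma Lcst_ge1 (t : Theta) : 1 <= Lcst C rho t.
Proof.
have /andP[r0 r1] := rho01 t; rewrite /Lcst le_max; apply/orP; right.
by rewrite invf_ge1 ?subr_gt0// gerBl ltW.
Qed.

Lemma ergodic_cst_le_Lcst_sqr t : 0 <= C t -> C t / (1 - rho t) <= Lcst C rho t ^+ 2.
Proof.
move=> C0; have /andP[r0 r1] := rho01 t.
rewrite expr2; apply: ler_pM => //; rewrite ?invr_ge0 ?subr_ge0 ?(ltW r1)//.
  by rewrite /Lcst le_max lexx.
by rewrite /Lcst le_max lexx orbT.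
Qed.

End drift_constants.

(** * Finite weighted norms *)

Section finite_norms.
Context {d dTh : measure_display} {T : measurableType d}
  {Theta : measurableType dTh} {R : realType}.
Variables (V : T -> R) (P : Theta -> R.-pker T ~> T).
Hypothesis V1 : forall x, 1 <= V x.

Let V0 x : 0 < V x. Proof. exact: lt_le_trans (V1 x). Qed.

Lemma Vnorm_ge0 (g : T -> R) : (0 <= Vnorm V g)%E.
Proof.
apply: le_trans (_ : ((`|g point| / V point)%:E <= _)%E).
  by rewrite lee_fin divr_ge0// ltW.
by apply: ereal_sup_ubound; exists point.
Qed.

Lemma Vnorm_fine (g : T -> R) x : (Vnorm V g < +oo)%E ->
  `|g x| <= fine (Vnorm V g) * V x.
Proof.
move=> oo; rewrite -ler_pdivrMr// -lee_fin fineK ?ge0_fin_numE ?Vnorm_ge0//.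
by apply: ereal_sup_ubound; exists x.
Qed.

Lemma DV_ge0 t t' : (0 <= DV V P t t')%E.
Proof.
apply: le_trans (_ : (Vdist V (P t point) (P t' point) * ((V point)^-1)%:E <= _)%E).
  by rewrite mule_ge0 ?Vdist_ge0// lee_fin invr_ge0 ltW.
by apply: ereal_sup_ubound; exists point.
Qed.

Lemma DV_fine t t' x : (DV V P t t' < +oo)%E ->
  (Vdist V (P t x) (P t' x) <= (fine (DV V P t t') * V x)%:E)%E.
Proof.
move=> oo; rewrite EFinM fineK ?ge0_fin_numE ?DV_ge0// -lee_pdivrMr//.
by apply: ereal_sup_ubound; exists x.
Qed.

End finite_norms.

Lemma limn_esup_lty_bound {R : realType} (u : nat -> R) :
  (limn_esup (fun n => (u n)%:E) < +oo)%E -> exists B, forall n, u n <= B.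
Proof.
move=> /ereal_inf_lt[_ [A [n0 _ An] <-]] supA.
set S := ereal_sup _ in supA.
have sub n : (n0 <= n)%N -> ((u n)%:E <= S)%E.
  by move=> nn; apply: ereal_sup_ubound; exists n => //; exact: An.
have f : S \is a fin_num.
  by rewrite fin_numE (lt_eqF supA) andbT gt_eqF// (lt_le_trans (ltNyr _) (sub n0 _)).
exists (\sum_(0 <= i < n0) `|u i| + `|fine S|) => n; have [nn|nn] := leqP n0 n.
  apply: le_trans (_ : `|fine S| <= _); last by rewrite lerDr sumr_ge0.
  by apply: le_trans (ler_norm _); rewrite -lee_fin fineK// sub.
apply: le_trans (_ : `|u n| + 0 <= _); first by rewrite addr0 ler_norm.
apply: lerD => //; rewrite big_mkord (bigD1 (Ordinal nn))//= lerDl.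
by apply: sumr_ge0.
Qed.

(** * Controlled Markov chains *)

Section kernel_family.
Context {R : realType} {dT dTh : measure_display}
  {T : measurableType dT} {Theta : measurableType dTh}.
Variables (P : Theta -> R.-pker T ~> T) (P_meas : jointly_measurable P).
Variables (V : T -> R) (V_meas : measurable_fun setT V) (V_ge1 : forall x, 1 <= V x).
Variables (piT : Theta -> probability T R) (C rho : Theta -> R).
Hypothesis P_ergo : geometrically_ergodic V P piT C rho.

Let ergo t : forall (n : nat) x,
  (Vdist V (kiter (P t) n x) (piT t) <= (C t * rho t ^+ n * V x)%:E)%E.
Proof. by case: (P_ergo t). Qed.

Let rho01 t : 0 < rho t < 1. Proof. by case: (P_ergo t). Qed.

(** One kernel for the whole family, with the parameter as part of the source:
    this gives measurability in the pair. *)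
Definition ctrl_kernel (z : T * Theta) : {measure set T -> \bar R} := P z.2 z.1.

Let measurable_ctrl_kernel U : measurable U -> measurable_fun setT (ctrl_kernel ^~ U).
Proof. exact: P_meas. Qed.

HB.instance Definition _ := isKernel.Build _ _ _ _ R ctrl_kernel measurable_ctrl_kernel.

Let ctrl_kernel_prob z : ctrl_kernel z setT = 1%E. Proof. exact: prob_kernel. Qed.

HB.instance Definition _ := Kernel_isProbability.Build _ _ _ _ R ctrl_kernel ctrl_kernel_prob.

(** The extra real argument carries a weight known at the current time. *)
Definition weighted_kernel (s : (T * Theta) * R) : {measure set T -> \bar R} :=
  P s.1.2 s.1.1.

Let measurable_weighted_kernel U : measurable U ->
  measurable_fun setT (weighted_kernel ^~ U).
Proof.
move=> mU; have m1 : measurable_fun setT (@fst (T * Theta) R) by exact: measurable_fst.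
exact: (measurableT_comp (P_meas mU) m1).
Qed.

HB.instance Definition _ := isKernel.Build _ _ _ _ R weighted_kernel measurable_weighted_kernel.

Let weighted_kernel_prob z : weighted_kernel z setT = 1%E. Proof. exact: prob_kernel. Qed.

HB.instance Definition _ := Kernel_isProbability.Build _ _ _ _ R weighted_kernel weighted_kernel_prob.

Implicit Types f : T * Theta -> R.

Definition joint_kop f z := kop (P z.2) (fun x => f (x, z.2)) z.1.
Definition joint_kopn n f z := kopn (P z.2) n (fun x => f (x, z.2)) z.1.
Definition joint_sol f z := poisson_sol (P z.2) (fun x => f (x, z.2)) z.1.

Definition sections_Vbounded f :=
  forall t, exists kappa, Vbounded V kappa (fun x => f (x, t)).

Lemma measurable_joint_kop f : measurable_fun setT f -> measurable_fun setT (joint_kop f).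
Proof.
move=> mf.
have mH : measurable_fun setT (fun sy : (T * Theta) * T => f (sy.2, sy.1.2)).
  apply: measurableT_comp => //; apply/measurable_fun_pair; first exact: measurable_snd.
  by apply: measurableT_comp; [exact: measurable_snd|exact: measurable_fst].
exact: (measurable_fun_kernel_Rintegral ctrl_kernel mH).
Qed.

Lemma measurable_joint_kopn n f : measurable_fun setT f -> sections_Vbounded f ->
  measurable_fun setT (joint_kopn n f).
Proof.
elim: n f => [|n IH] f mf bf.
  have -> // : joint_kopn 0 f = f.
  apply/funext => -[x t]; rewrite /joint_kopn kopn0//=.
  by have [k []] := bf t.
have -> : joint_kopn n.+1 f = joint_kopn n (joint_kop f).
  apply/funext => -[x t]; have [k fb] := bf t; rewrite /joint_kopn /=.
  exact: (kopnS V_meas V_ge1 (ergo t) n x fb).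
apply: IH; first exact: measurable_joint_kop.
move=> t; have [k fb] := bf t; have [M hM] := Vbounded_kop V_meas V_ge1 (ergo t).
by exists (k * M); exact: (hM _ _ fb).
Qed.

Lemma measurable_joint_sol f : measurable_fun setT f -> sections_Vbounded f ->
  measurable_fun setT (joint_sol f).
Proof.
move=> mf bf.
apply: (@measurable_fun_cvg _ _ _ setT (fun N z => series (fun n =>
   poisson_part (P z.2) (fun x => f (x, z.2)) n z.1) N)).
  move=> N; apply: measurable_sum => n; apply: measurable_funB.
    exact: measurable_joint_kopn.
  have mp : measurable_fun setT (fun z : T * Theta => (point : T, z.2)).
    by apply/measurable_fun_pair; [exact: measurable_cst|exact: measurable_snd].
  exact: (measurableT_comp (measurable_joint_kopn n mf bf) mp).
move=> [x t] _; have [k fb] := bf t.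
exact: (poisson_sol_cvg V_meas V_ge1 (rho01 t) (ergo t) fb).
Qed.

Lemma C_nneg t : 0 <= C t. Proof. exact: (ergodic_cst_ge0 V_ge1 (ergo t)). Qed.

Let L t := Lcst C rho t.

Lemma joint_sol_le kappa f : (forall t, Vbounded V kappa (fun x => f (x, t))) ->
  forall x t, `|joint_sol f (x, t)| <= kappa * (1 + V point) * L t ^+ 2 * V x.
Proof.
move=> fb x t; apply: le_trans (poisson_sol_le V_meas V_ge1 (rho01 t) (ergo t) x (fb t)) _.
have k0 := Vbounded_ge0 V_ge1 point (fb t).
have V0 y : 0 <= V y by exact: le_trans (V_ge1 y).
have -> : kappa * (C t / (1 - rho t)) * (1 + V point) * V x =
  (kappa * (1 + V point) * V x) * (C t / (1 - rho t)) by ring.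
have -> : kappa * (1 + V point) * L t ^+ 2 * V x =
  (kappa * (1 + V point) * V x) * L t ^+ 2 by ring.
by apply: ler_wpM2l; [rewrite !mulr_ge0// addr_ge0|exact: ergodic_cst_le_Lcst_sqr (C_nneg t)].
Qed.

Lemma joint_sol_Vbounded kappa f : measurable_fun setT f ->
  (forall t, Vbounded V kappa (fun x => f (x, t))) ->
  forall t, Vbounded V (kappa * (1 + V point) * L t ^+ 2) (fun x => joint_sol f (x, t)).
Proof.
move=> mf fb t; split; last by move=> x /=; exact: joint_sol_le.
have mj := measurable_joint_sol mf (fun t => ex_intro _ kappa (fb t)).
by apply: (measurableT_comp mj); exact: pair2_measurable.
Qed.

Lemma joint_poisson_eq kappa f x t : Vbounded V kappa (fun x => f (x, t)) ->
  joint_sol f (x, t) - joint_kop (joint_sol f) (x, t) =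
  f (x, t) - \int[piT t]_y f (y, t).
Proof. exact: (poisson_eq V_meas V_ge1 (rho01 t) (ergo t)). Qed.

(** The bound of [poisson_sol_perturb] in terms of L: the two factors C / (1 - rho)
    are at most squares, so the change of kernel costs the power 4, which the power
    6 dominates because L >= 1. *)
Lemma joint_sol_perturb kappa f a dv x t1 t2 :
  (forall t, Vbounded V kappa (fun x => f (x, t))) -> 0 <= a -> 0 <= dv ->
  (forall y, `|f (y, t2) - f (y, t1)| <= a * V y) ->
  (forall y, (Vdist V (P t2 y) (P t1 y) <= (dv * V y)%:E)%E) ->
  `|joint_sol f (x, t2) - joint_sol f (x, t1)| <=
  (1 + V point) * (L t1 ^+ 2 * a * V x +
   kappa * (1 + V point) * (Num.max (L t2) (L t1) ^+ 6 * dv * V x)).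
Proof.
move=> fb a0 dv0 ga Kdv.
have k0 := Vbounded_ge0 V_ge1 point (fb t1).
have V0 y : 0 <= V y by exact: le_trans (V_ge1 y).
apply: le_trans (poisson_sol_perturb x V_meas V_ge1 (rho01 t1) (ergo t1)
  (rho01 t2) (ergo t2) (fb t1) (fb t2) ga Kdv) _.
have q1 := ergodic_cst_le_Lcst_sqr rho01 (C_nneg t1); have q2 := ergodic_cst_le_Lcst_sqr rho01 (C_nneg t2).
have l1 : 1 <= L t1 by exact: Lcst_ge1. have l2 : 1 <= L t2 by exact: Lcst_ge1.
have c1 : 0 <= C t1 / (1 - rho t1).
  by rewrite divr_ge0 ?C_nneg// subr_ge0; case/andP: (rho01 t1) => _ /ltW.
have c2 : 0 <= C t2 / (1 - rho t2).
  by rewrite divr_ge0 ?C_nneg// subr_ge0; case/andP: (rho01 t2) => _ /ltW.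
rewrite -/(L t1) in q1; rewrite -/(L t2) in q2.
move: (C t1 / _) (C t2 / _) q1 q2 c1 c2 => u1 u2 q1 q2 c1 c2.
set M := Num.max _ _.
have M1 : L t1 <= M by rewrite /M le_max lexx orbT.
have M2 : L t2 <= M by rewrite /M le_max lexx.
have M0 : 1 <= M by exact: le_trans M1.
have u12 : u2 * u1 <= M ^+ 6.
  apply: le_trans (_ : M ^+ 2 * M ^+ 2 <= _); last first.
    by rewrite -exprD; apply: ler_weXn2l.
  apply: ler_pM => //; [apply: le_trans q2 _|apply: le_trans q1 _];
    by apply: lerXn2r; rewrite ?nnegrE// (le_trans ler01)// (le_trans _ M1, le_trans _ M2).
have vp : 0 <= 1 + V point by rewrite addr_ge0.
have -> : (a + kappa * u2 * (1 + V point) * dv) * u1 * (1 + V point) * V x =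
  (1 + V point) * (u1 * (a * V x) + kappa * (1 + V point) * ((u2 * u1) * (dv * V x))) by ring.
have -> : (1 + V point) * (L t1 ^+ 2 * a * V x +
   kappa * (1 + V point) * (M ^+ 6 * dv * V x)) =
  (1 + V point) * (L t1 ^+ 2 * (a * V x) + kappa * (1 + V point) * (M ^+ 6 * (dv * V x))).
  by ring.
apply: ler_wpM2l => //; apply: lerD; first by apply: ler_wpM2r => //; exact: mulr_ge0.
apply: ler_wpM2l; first exact: mulr_ge0.
by apply: ler_wpM2r => //; exact: mulr_ge0.
Qed.

Context {dO : measure_display} {Omega : measurableType dO}.
Variables (Pr : probability Omega R) (Flt : nat -> set (set Omega)).
Hypothesis FltF : filtration Flt.
Variables (X : nat -> Omega -> T) (th : nat -> Omega -> Theta).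
Hypothesis proc : controlled_markov Pr Flt P X th.

Let Z n w := (X n w, th n w).

Let sFlt k : sigma_algebra setT (Flt k). Proof. by case: FltF. Qed.
Let mFlt k : Flt k `<=` measurable. Proof. by case: FltF. Qed.
Let leFlt k l : (k <= l)%N -> Flt k `<=` Flt l. Proof. by case: FltF => _ _; apply. Qed.

Lemma Z_adapted n : measurable_wrt (Flt n) (Z n).
Proof. by case: proc => + _; apply. Qed.

Lemma measurable_Z n : measurable_fun setT (Z n).
Proof. exact: measurable_wrt_fun (@mFlt n) (Z_adapted n). Qed.

Lemma measurable_X n : measurable_fun setT (X n).
Proof.
have m1 : measurable_fun setT (@fst T Theta) by exact: measurable_fst.
exact: (measurableT_comp m1 (measurable_Z n)).
Qed.

(** The Markov property for bounded functions extends to nonnegative functions of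
    the current pair, a weight W known at time n, and the next state. *)
Lemma markov_integral n (W : Omega -> R) (H : ((T * Theta) * R) * T -> \bar R) :
  measurable_wrt (Flt n) W -> (forall s, 0 <= H s)%E -> measurable_fun setT H ->
  (\int[Pr]_w H ((Z n w, W w), X n.+1 w) =
   \int[Pr]_w \int[P (th n w) (X n w)]_y H ((Z n w, W w), y))%E.
Proof.
move=> mW H0 mH.
have wY : measurable_wrt (Flt n) (fun w => (Z n w, W w)).
  by apply: measurable_wrt_pair => //; exact: Z_adapted.
have mY := measurable_wrt_fun (@mFlt n) wY.
apply: (joint_law_disintegration (k := weighted_kernel) mY (measurable_X n.+1) _ H0 mH).
move=> A B mA mB; set A' := _ @^-1` A.
have FA : Flt n A' by exact: wY.
have mA' := mFlt FA.
have [_ /(_ n (\1_B))] := proc.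
have mXB : measurable (X n.+1 @^-1` B).
  by rewrite -[_ @^-1` _]setTI; exact: measurable_X.
case=> [||_ _ _ /(_ A' FA)].
- exact: measurable_indic.
- exists 1; split => // r r1 x _; rewrite /= indicE; case: (_ \in _) => /=.
    by rewrite normr1 ltW.
  by rewrite normr0 (le_trans _ (ltW r1)).
rewrite /Rintegral => e.
have PB1 w : (P (th n w) (X n w) B <= 1)%E.
  have <- : P (th n w) (X n w) setT = 1%E by exact: prob_kernel.
  by apply: le_measure; rewrite ?inE.
have e1 : (\int[Pr]_(w in A') (\1_B (X n.+1 w) : R)%:E = Pr (A' `&` X n.+1 @^-1` B))%E.
  by rewrite setIC -integral_indic.
have e2 : (\int[Pr]_(w in A') (fine (\int[P (th n w) (X n w)]_y (\1_B y)%:E))%:E =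
    \int[Pr]_(w in A') P (th n w) (X n w) B)%E.
  apply: eq_integral => w _; rewrite integral_indic// setIT fineK//.
  by rewrite ge0_fin_numE// (le_lt_trans (PB1 w))// ltry.
rewrite e1 e2 in e.
have f1 : Pr (A' `&` X n.+1 @^-1` B) \is a fin_num.
  by apply: fin_num_measure; exact: measurableI.
have mPB : measurable_fun setT (fun w => P (th n w) (X n w) B).
  exact: (measurableT_comp (P_meas mB) (measurable_Z n)).
have f2 : (\int[Pr]_(w in A') P (th n w) (X n w) B)%E \is a fin_num.
  rewrite ge0_fin_numE; last by apply: integral_ge0.
  apply: (@le_lt_trans _ _ (\int[Pr]_(w in A') cst 1%E w)%E); last first.
    rewrite integral_cst// mul1e; exact: le_lt_trans (probability_le1 Pr mA') (ltry 1).
  by apply: ge0_le_integral => //; exact: measurable_funTS.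
have E : (Pr (A' `&` X n.+1 @^-1` B) = \int[Pr]_(w in A') P (th n w) (X n w) B)%E.
  by rewrite -(fineK f1) -(fineK f2) e.
exact: E.
Qed.

Variable alpha : R.
Hypothesis alpha_gt1 : 1 < alpha.
Variables (f : T * Theta -> R) (kappa : R).
Hypothesis mf : measurable_fun setT f.
Hypothesis f_ge0 : forall z, 0 <= f z.
Hypothesis f_le : forall x t, f (x, t) <= kappa * V x.

Let alpha_ge1 : 1 <= alpha. Proof. exact: ltW. Qed.
Let alpha_gt0 : 0 < alpha. Proof. exact: lt_trans alpha_gt1. Qed.

Let mf_section t : measurable_fun setT (fun x => f (x, t)).
Proof. by apply: (measurableT_comp mf); exact: pair2_measurable. Qed.

Let fb t : Vbounded V kappa (fun x => f (x, t)).
Proof. by split=> // x; rewrite ger0_norm. Qed.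

Let kappa0 : 0 <= kappa. Proof. exact: (Vbounded_ge0 V_ge1 point (fb point)). Qed.
Let V0 x : 0 <= V x. Proof. exact: le_trans (V_ge1 x). Qed.
Let L1 t : 1 <= L t. Proof. exact: Lcst_ge1. Qed.
Let L0 t : 0 <= L t. Proof. exact: le_trans (L1 t). Qed.

Let c0 := kappa * (1 + V point).
Let c00 : 0 <= c0. Proof. by rewrite mulr_ge0// addr_ge0. Qed.

Definition sol := joint_sol f.
Definition psol := joint_kop sol.

Let msol : measurable_fun setT sol.
Proof. exact: measurable_joint_sol mf (fun t => ex_intro _ kappa (fb t)). Qed.
Let mpsol : measurable_fun setT psol. Proof. exact: measurable_joint_kop. Qed.

Let solVb t : Vbounded V (c0 * L t ^+ 2) (fun x => sol (x, t)).
Proof. exact: joint_sol_Vbounded. Qed.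

Let intV t x : (P t x).-integrable setT (EFin \o V).
Proof. exact: (kernel_V_integrable V_meas V_ge1 (ergo t) x). Qed.

Let psol_le t x : `|psol (x, t)| <= c0 * L t ^+ 2 * \int[P t x]_y V y.
Proof. exact: (Vbounded_Rintegral_le (intV t x) (solVb t)). Qed.

Let wt k : R := k.+1%:R `^ (- alpha).
Let wt_ge0 k : 0 <= wt k. Proof. exact: powR_ge0. Qed.

Lemma wtM k v : 0 <= v -> wt k * v `^ alpha = (v / k.+1%:R) `^ alpha.
Proof.
move=> v0; rewrite powRM ?invr_ge0// mulrC; congr (_ * _).
by rewrite /wt powRN -[in RHS]powR_inv1// -powRrM mulN1r powRN.
Qed.

(** What has to be summable at step k: the powers of order alpha of the two parts
    of the martingale increment and of V, divided by k + 1. *)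
Let moment k (z : T * Theta) (y : T) : R :=
  wt k * (`|sol (y, z.2)| `^ alpha + `|psol z| `^ alpha + V y `^ alpha).

Let moment_ge0 k z y : 0 <= moment k z y.
Proof. by rewrite mulr_ge0// !addr_ge0// powR_ge0. Qed.

Let A5b_term k w : \bar R :=
  ((k.+1%:R `^ (- alpha) * L (th k w) `^ (2 * alpha))%:E
     * \int[P (th k w) (X k w)]_y (V y `^ alpha)%:E)%E.

Let cmom := c0 `^ alpha + (2 * c0) `^ alpha + 1.

Let measurable_powRV : measurable_fun setT (fun y => V y `^ alpha).
Proof. exact: (measurableT_comp (@measurable_powR R alpha)). Qed.

Let cmom_gt0 : 0 < cmom.
Proof. by rewrite ltr_wpDl// addr_ge0// powR_ge0. Qed.

Let measurable_moment k z : measurable_fun setT (moment k z).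
Proof.
apply: measurable_funM => //; apply: measurable_funD => //.
apply: measurable_funD => //.
apply: (measurableT_comp (@measurable_powR R alpha)).
by apply: measurableT_comp => //; case: (solVb z.2).
Qed.

(** The solution is at most c0 L^2 V, and its mean is controlled by Jensen's
    inequality, so both moments are at most multiples of the term of [A5b]. *)
Lemma moment_le k w :
  (\int[P (th k w) (X k w)]_y (moment k (Z k w) y)%:E <= cmom%:E * A5b_term k w)%E.
Proof.
rewrite /A5b_term; set t := th k w; set x := X k w.
have wt0 : 0 < wt k by rewrite powR_gt0.
have La : 0 < L t `^ (2 * alpha) by rewrite powR_gt0// (lt_le_trans _ (L1 t)).
have [Ioo|] := ltP (\int[P t x]_y (V y `^ alpha)%:E)%E +oo%E; last first.
  rewrite leye_eq => /eqP ->; rewrite gt0_muley ?lte_fin ?mulr_gt0//.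
  by rewrite gt0_muley ?lte_fin// leey.
have iVa : (P t x).-integrable setT (EFin \o (fun y => V y `^ alpha)).
  apply/integrableP; split; first exact/measurable_EFinP.
  by under eq_integral do rewrite /= ger0_norm ?powR_ge0//.
rewrite -(EFin_Rintegral iVa) -EFinM.
set I := \int[P t x]_y (V y `^ alpha).
have P1 : P t x setT = 1%E by exact: prob_kernel.
have Jensen := mean_powR_le alpha_ge1 P1 V_ge1 V_meas (intV t x) Ioo.
have L2a v : 0 <= v -> (c0 * L t ^+ 2 * v) `^ alpha = c0 `^ alpha * L t `^ (2 * alpha) * v `^ alpha.
  have LL0 : 0 <= L t ^+ 2 by exact: exprn_ge0.
  move=> v0; rewrite (powRM _ (mulr_ge0 c00 LL0) v0) (powRM _ c00 LL0).
  by rewrite -powR_mulrn// -powRrM.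
have q_le : `|psol (Z k w)| `^ alpha <= (2 * c0) `^ alpha * L t `^ (2 * alpha) * I.
  have V0' : 0 <= \int[P t x]_y V y by exact: Rintegral_ge0.
  apply: le_trans (_ : (c0 * L t ^+ 2 * \int[P t x]_y V y) `^ alpha <= _).
    apply: ge0_ler_powR; rewrite ?nnegrE ?(ltW alpha_gt0)//.
      by apply: mulr_ge0 => //; apply: mulr_ge0 => //; exact: exprn_ge0.
    exact: psol_le.
  rewrite L2a// [(2 * c0) `^ _]powRM// -!mulrA.
  rewrite [leRHS]mulrCA; apply: ler_wpM2l; first exact: powR_ge0.
  rewrite [leRHS]mulrCA; apply: ler_wpM2l; first exact: ltW.
  exact: Jensen.
have icst (c : R) : (P t x).-integrable setT (EFin \o cst c).
  exact: Vbounded_integrable (intV t x) (Vbounded_cst V_ge1 c).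
pose b := c0 `^ alpha * L t `^ (2 * alpha) + 1.
apply: (@le_trans _ _ (\int[P t x]_y (wt k * (b * V y `^ alpha + cst (`|psol (Z k w)| `^ alpha) y))%:E)%E).
  apply: ge0_le_integral => //.
  - by move=> y _; rewrite lee_fin.
  - exact/measurable_EFinP/measurable_moment.
  - apply/measurable_EFinP; apply: measurable_funM => //; apply: measurable_funD => //.
    exact: measurable_funM.
  move=> y _; rewrite lee_fin /moment; apply: ler_wpM2l => //=.
  rewrite addrAC lerD2r /b mulrDl mul1r lerD2r -L2a//.
  apply: ge0_ler_powR; rewrite ?nnegrE ?(ltW alpha_gt0)//.
    by apply: mulr_ge0 => //; apply: mulr_ge0 => //; exact: exprn_ge0.
  by have [_] := solVb t; apply.
have iS := integrable_EFinD (integrable_EFinZ b iVa) (icst (`|psol (Z k w)| `^ alpha)).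
rewrite -EFin_Rintegral; last exact: integrable_EFinZ iS.
rewrite lee_fin RintegralZl// (RintegralD measurableT (integrable_EFinZ b iVa) (icst _)).
rewrite RintegralZl// Rintegral_cst// P1 mulr1 -/I.
have I1 : 0 <= I by apply: Rintegral_ge0 => y _; exact: powR_ge0.
have LI : 1 <= L t `^ (2 * alpha).
  by rewrite -[leLHS](powRr0 (L t)); apply: ler_powR => //; rewrite mulr_ge0// ltW.
rewrite -/(wt k) mulrCA -mulrA; apply: ler_wpM2l => //.
move: q_le; rewrite /b /cmom; set A1 := c0 `^ _; set A2 := (2 * c0) `^ _.
set LL := L t `^ _ in LI *; set qq := `|_| `^ _ => q_le.
have : I <= LL * I by rewrite ler_peMl.
have -> : LL * ((A1 + A2 + 1) * I) = A1 * LL * I + A2 * LL * I + LL * I by ring.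
rewrite mulrDl mul1r; lra.
Qed.

Let fbar z := sol z - psol z.

Lemma fbarE x t : fbar (x, t) = f (x, t) - \int[piT t]_y f (y, t).
Proof. exact: joint_poisson_eq (fb t). Qed.

Let mom_joint k : measurable_fun setT (fun zy : (T * Theta) * T => moment k zy.1 zy.2).
Proof.
have m1 : measurable_fun setT (@fst (T * Theta) T) by exact: measurable_fst.
have m2 : measurable_fun setT (@snd (T * Theta) T) by exact: measurable_snd.
have m12 : measurable_fun setT (fun zy : (T * Theta) * T => zy.1.2).
  by apply: measurableT_comp m1; exact: measurable_snd.
have mp := @measurable_powR R alpha.
apply: measurable_funM => //; apply: measurable_funD; last exact: measurableT_comp measurable_powRV m2.
apply: measurable_funD; apply: (measurableT_comp mp); apply: measurableT_comp => //.
- by apply: (measurableT_comp msol); exact/measurable_fun_pair.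
- exact: (measurableT_comp mpsol m1).
Qed.

Let Ym k w := moment k (Z k w) (X k.+1 w).
Let ym k w := \int[P (th k w) (X k w)]_y moment k (Z k w) y.

Hypothesis A5b : {ae Pr, forall w, (\sum_(0 <= k <oo) A5b_term k w < +oo)%E}.

Let A5b_ge0 k w : (0 <= A5b_term k w)%E.
Proof.
rewrite mule_ge0 ?lee_fin ?mulr_ge0 ?powR_ge0//.
by apply: integral_ge0 => y _; rewrite lee_fin powR_ge0.
Qed.

Let A5b_fin : {ae Pr, forall w, forall k, (A5b_term k w < +oo)%E}.
Proof.
apply: filterS A5b => w woo k; apply: le_lt_trans woo.
apply: le_trans (nneseries_lim_ge k.+1 _); last by move=> i _.
by rewrite big_nat_recr//= leeDr// sume_ge0.
Qed.

Let measurable_ym k : measurable_wrt (Flt k) (ym k).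
Proof.
have m := measurable_fun_kernel_Rintegral ctrl_kernel (@mom_joint k).
exact: (measurable_wrt_comp m (Z_adapted k)).
Qed.

Let measurable_Ym k : measurable_fun setT (Ym k).
Proof.
have m : measurable_fun setT (fun w => (Z k w, X k.+1 w)).
  by apply/measurable_fun_pair; [exact: measurable_Z|exact: measurable_X].
exact: (measurableT_comp (@mom_joint k) m).
Qed.

Let ym_ge0 k w : 0 <= ym k w. Proof. exact: Rintegral_ge0. Qed.
Let Ym_ge0 k w : 0 <= Ym k w. Proof. exact: moment_ge0. Qed.

Let ymE : {ae Pr, forall w, forall k,
  (ym k w)%:E = (\int[P (th k w) (X k w)]_y (moment k (Z k w) y)%:E)%E}.
Proof.
apply: filterS A5b_fin => w wfin k; rewrite /ym /Rintegral fineK//.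
rewrite ge0_fin_numE; last by apply: integral_ge0 => y _; rewrite lee_fin.
apply: le_lt_trans (moment_le k w) _; rewrite lte_mul_pinfty// ?lee_fin ltW//.
Qed.

Let Ym_ym k A : Flt k A ->
  (\int[Pr]_(w in A) (Ym k w)%:E = \int[Pr]_(w in A) (ym k w)%:E)%E.
Proof.
move=> FA; have mA := mFlt FA.
rewrite (integral_set_indic Pr A) (integral_set_indic Pr A).
pose H (s : ((T * Theta) * R) * T) : \bar R := (`|s.1.2| * moment k s.1.1 s.2)%:E.
have mH : measurable_fun setT H.
  apply/measurable_EFinP; apply: measurable_funM.
    apply: measurableT_comp => //.
    by apply: measurableT_comp; [exact: measurable_snd|exact: measurable_fst].
  have ms : measurable_fun setT (fun s : ((T * Theta) * R) * T => (s.1.1, s.2)).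
    apply/measurable_fun_pair; last exact: measurable_snd.
    by apply: measurableT_comp; [exact: measurable_fst|exact: measurable_fst].
  exact: (measurableT_comp (@mom_joint k) ms).
have H0 s : (0 <= H s)%E by rewrite lee_fin mulr_ge0.
have := markov_integral (measurable_wrt_indic (sFlt k) FA) H0 mH.
rewrite /H /= => e.
have nind w : `|\1_A w : R| = \1_A w by rewrite ger0_norm// indicE.
transitivity (\int[Pr]_w (`|\1_A w| * moment k (Z k w) (X k.+1 w))%:E)%E.
  by apply: eq_integral => w _; rewrite nind.
rewrite e; apply: ae_eq_integral => //.
- have m := measurable_fun_integral_sfinite_kernel H weighted_kernel H0 mH.
  have mp : measurable_fun setT (fun w => (Z k w, \1_A w : R)).
    by apply/measurable_fun_pair; [exact: measurable_Z|exact: measurable_indic].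
  exact: (measurableT_comp m mp).
- apply/measurable_EFinP; apply: measurable_funM; first exact: measurable_indic.
  exact: measurable_wrt_fun (@mFlt k) (measurable_ym k).
apply: filterS ymE => w yE _; rewrite EFinM yE -ge0_integralZl//.
- by apply: eq_integral => y _; rewrite nind EFinM.
- exact/measurable_EFinP/measurable_moment.
- by move=> y _; rewrite lee_fin.
Qed.

Let ym_sum : {ae Pr, forall w, (\sum_(k <oo) (ym k w)%:E < +oo)%E}.
Proof.
apply: filterS2 A5b ymE => w woo yE.
apply: (@le_lt_trans _ _ (\sum_(k <oo) (cmom%:E * A5b_term k w))%E).
  apply: lee_nneseries => k _; first by rewrite lee_fin.
  by rewrite yE; exact: moment_le.
rewrite nneseriesZl//.
apply: lte_mul_pinfty => //; rewrite lee_fin; exact: (ltW cmom_gt0).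
Qed.

Lemma moment_series_lty : {ae Pr, forall w, (\sum_(k <oo) (Ym k w)%:E < +oo)%E}.
Proof.
exact: (compensated_series_lty FltF Ym_ge0 ym_ge0 measurable_Ym measurable_ym Ym_ym ym_sum).
Qed.

Let xs w k := fbar (Z k.+1 w).
Let ms w k := sol (X k.+1 w, th k w) - psol (Z k w).
Let ps w k := psol (Z k w).
Let rs w k := sol (Z k.+1 w) - sol (X k.+1 w, th k w).

Variable j : nat.

Let Dm k w := mart_incr j (xs w) (ms w) k.

Let mfbar : measurable_fun setT fbar. Proof. exact: measurable_funB. Qed.

Lemma measurable_wgt : measurable_fun setT (@wgt R j).
Proof.
apply: measurable_funX; apply: measurable_maxr; first exact: measurable_cst.
by apply: measurable_minr; [exact: measurable_cst|exact: measurable_id].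
Qed.

Let predictable_weight k :
  measurable_wrt (Flt k) (fun w => wgt j (run_mean (xs w) k) / k.+1%:R).
Proof.
have mx : measurable_wrt (Flt k) (fun w => series (xs w) k).
  apply: measurable_wrt_sum => // i ik.
  apply: (measurable_wrt_comp mfbar).
  exact: measurable_wrtS (leFlt ik) (Z_adapted i.+1).
have m : measurable_fun setT (fun x : R => wgt j (k%:R^-1 * x) / k.+1%:R).
  apply: measurable_funM => //; apply: (measurableT_comp measurable_wgt).
  exact: measurable_funM.
exact: (measurable_wrt_comp m mx).
Qed.

Let measurable_Dm k : measurable_wrt (Flt k.+1) (Dm k).
Proof.
have m1 : measurable_wrt (Flt k.+1) (fun w => ms w k).
  have mp : measurable_wrt (Flt k.+1) (fun w => (X k.+1 w, th k w)).
    apply: measurable_wrt_pair => //.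
      exact: (measurable_wrt_comp (measurable_fst : measurable_fun setT _) (Z_adapted k.+1)).
    apply: measurable_wrtS (leFlt (leqnSn k)) _.
    exact: (measurable_wrt_comp (measurable_snd : measurable_fun setT _) (Z_adapted k)).
  have ma := measurable_wrt_comp msol mp.
  have mb := measurable_wrtS (leFlt (leqnSn k)) (measurable_wrt_comp mpsol (Z_adapted k)).
  move: ma mb => /(measurable_wrtP (sFlt k.+1)) ma /(measurable_wrtP (sFlt k.+1)) mb.
  by apply/(measurable_wrtP (sFlt k.+1)); exact: measurable_funB.
have m2 := measurable_wrtS (leFlt (leqnSn k)) (@predictable_weight k).
have := measurable_wrt_mul (sFlt k.+1) m2 m1.
by congr measurable_wrt; apply/funext => w; rewrite /Dm /mart_incr; ring.
Qed.

(** Given the present, the increment is a multiple of g(X_(k+1)) - P g(X_k), whose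
    integral for the kernel is zero. *)
Let Dm_sym k A : Flt k A ->
  (\int[Pr]_(w in A) (Num.max (Dm k w) 0)%:E =
   \int[Pr]_(w in A) (Num.max (- Dm k w) 0)%:E)%E.
Proof.
move=> FA; have mA := mFlt FA.
rewrite (integral_set_indic Pr A) (integral_set_indic Pr A).
pose W w : R := \1_A w * (wgt j (run_mean (xs w) k) / k.+1%:R).
have mW : measurable_wrt (Flt k) W.
  by apply: measurable_wrt_mul => //; exact: measurable_wrt_indic.
pose H (c : R) (s : ((T * Theta) * R) * T) : \bar R :=
  (Num.max (c * (s.1.2 * (sol (s.2, s.1.1.2) - psol s.1.1))) 0)%:E.
have mH c : measurable_fun setT (H c).
  have ms1 : measurable_fun setT (fun s : ((T * Theta) * R) * T => s.1.1).
    by apply: measurableT_comp; [exact: measurable_fst|exact: measurable_fst].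
  apply/measurable_EFinP; apply: measurable_maxr => //; apply: measurable_funM => //.
  apply: measurable_funM.
    by apply: measurableT_comp; [exact: measurable_snd|exact: measurable_fst].
  apply: measurable_funB; last exact: measurableT_comp mpsol ms1.
  apply: (measurableT_comp msol); apply/measurable_fun_pair; first exact: measurable_snd.
  by apply: measurableT_comp ms1; exact: measurable_snd.
have H0 c s : (0 <= H c s)%E by rewrite lee_fin le_max lexx orbT.
have part c : (\int[Pr]_w (\1_A w * Num.max (c * Dm k w) 0)%:E =
   \int[Pr]_w \int[P (th k w) (X k w)]_y H c ((Z k w, W w), y))%E.
  rewrite -(markov_integral mW (H0 c) (mH c)); apply: eq_integral => w _.
  rewrite /H /=; congr EFin; rewrite /W /Dm /mart_incr /ms indicE.
  case: (_ \in A); rewrite ?mul0r ?mulr0 ?mul0r ?maxxx//= !mul1r.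
  by congr Num.max; ring.
transitivity (\int[Pr]_w (\1_A w * Num.max (1 * Dm k w) 0)%:E)%E.
  by apply: eq_integral => w _; rewrite mul1r.
transitivity (\int[Pr]_w (\1_A w * Num.max (-1 * Dm k w) 0)%:E)%E; last first.
  by apply: eq_integral => w _; rewrite mulN1r.
rewrite !part; apply: eq_integral => w _.
set t := th k w; set x := X k w; set c := W w.
pose g y := c * (sol (y, t) - psol (x, t)).
have gb : Vbounded V (`|c| * (c0 * L t ^+ 2 + `|psol (x, t)|)) g.
  exact: (VboundedZ c (VboundedB (solVb t) (Vbounded_cst V_ge1 (psol (x, t))))).
have ig := Vbounded_integrable (intV t x) gb.
have g0 : (\int[P t x]_y (g y)%:E = 0)%E.
  rewrite -(EFin_Rintegral ig) /g RintegralZl//; last first.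
    exact: (Vbounded_integrable (intV t x)
      (VboundedB (solVb t) (Vbounded_cst V_ge1 (psol (x, t))))).
  rewrite RintegralB//; last 2 first.
  - exact: Vbounded_integrable (intV t x) (solVb t).
  - exact: Vbounded_integrable (intV t x) (Vbounded_cst V_ge1 (psol (x, t))).
  rewrite Rintegral_cst// (_ : P t x setT = 1%E); last exact: prob_kernel.
  by rewrite mulr1 [X in X - _](_ : _ = psol (x, t))// subrr mulr0.
have e := g0; rewrite integralE in e.
have fin1 : (\int[P t x]_y (EFin \o g)^\+ y)%E \is a fin_num.
  exact: integrable_pos_fin_num.
have fin2 : (\int[P t x]_y (EFin \o g)^\- y)%E \is a fin_num.
  exact: integrable_neg_fin_num.
have e2 : (\int[P t x]_y (EFin \o g)^\+ y = \int[P t x]_y (EFin \o g)^\- y)%E.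
  move: e; rewrite -(fineK fin1) -(fineK fin2) -EFinB => -[] /eqP.
  by rewrite subr_eq0 => /eqP ->.
transitivity (\int[P t x]_y (EFin \o g)^\+ y)%E.
  by apply: eq_integral => y _; rewrite funeposE /H /= mul1r EFin_max.
rewrite e2; apply: eq_integral => y _.
by rewrite funenegE /H /= mulN1r EFin_max.
Qed.

Let Dm_dom k w : `|Dm k w| <= 2 + Ym k w.
Proof.
have k0 : (0 : R) < k.+1%:R by [].
have ar (a b c : R) : 0 <= c -> 1 + a + (1 + b) <= 2 + (a + b + c) by lra.
rewrite /Dm /mart_incr normrM normfV (ger0_norm (ltW k0)) normrM -mulrA.
apply: le_trans (_ : 1 * (`|ms w k| / k.+1%:R) <= _).
  by apply: ler_wpM2r; [rewrite divr_ge0|exact: wgt_norm_le1].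
rewrite mul1r; set u := `|sol (X k.+1 w, th k w)|; set q := `|psol (Z k w)|.
have : `|ms w k| / k.+1%:R <= u / k.+1%:R + q / k.+1%:R.
  by rewrite -mulrDl ler_pM2r ?invr_gt0//; exact: ler_normB.
have hu : u / k.+1%:R <= 1 + wt k * u `^ alpha.
  have u0 : 0 <= u by exact: normr_ge0.
  by rewrite (wtM k u0); apply: le_add1_powR => //; exact: divr_ge0.
have hq : q / k.+1%:R <= 1 + wt k * q `^ alpha.
  have q0 : 0 <= q by exact: normr_ge0.
  by rewrite (wtM k q0); apply: le_add1_powR => //; exact: divr_ge0.
have hv : 0 <= wt k * V (X k.+1 w) `^ alpha by rewrite mulr_ge0// powR_ge0.
have -> : Ym k w = wt k * u `^ alpha + wt k * q `^ alpha + wt k * V (X k.+1 w) `^ alpha.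
  by rewrite /Ym /moment /= -/u -/q; ring.
move=> h; apply: le_trans h _; apply: le_trans (lerD hu hq) _.
move: (wt k * u `^ alpha) (wt k * q `^ alpha) (wt k * _ `^ alpha) hv => a b c h.
exact: ar.
Qed.

Lemma weighted_martingale_cvg : {ae Pr, forall w,
  (exists B, forall n, B <= series (mart_incr j (xs w) (ms w)) n) ->
  cvgn (series (mart_incr j (xs w) (ms w)))}.
Proof.
exact: (bounded_below_martingale_cvg FltF Ym_ge0 ym_ge0 measurable_Ym measurable_ym
  Ym_ym measurable_Dm Dm_sym Dm_dom ym_sum).
Qed.

Hypothesis alpha_le : alpha <= j.+2%:R.

Let A4_term k w : \bar R :=
  ((k%:R^-1 * Num.max (L (th k w)) (L (th k.-1 w)) ^+ 6)%:E
     * DV V P (th k w) (th k.-1 w) * (V (X k w))%:E)%E.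

Let var_term k w : \bar R :=
  ((k%:R^-1 * L (th k.-1 w) ^+ 2)%:E
     * Vnorm V (fun x => f (x, th k w) - f (x, th k.-1 w))%R
     * (V (X k w))%:E)%E.

Hypothesis A4 : {ae Pr, forall w, (\sum_(1 <= k <oo) A4_term k w < +oo)%E}.
Hypothesis A5a : {ae Pr, forall w,
  (limn_esup (fun n => \int[piT (th n w)]_x (V x)%:E) < +oo)%E}.
Hypothesis f_var : {ae Pr, forall w, (\sum_(1 <= k <oo) var_term k w < +oo)%E}.

Let piV t : (piT t).-integrable setT (EFin \o V).
Proof. exact: (invariant_V_integrable V_meas V_ge1 (ergo t)). Qed.

(** The bound from below is where f >= 0 and the bound on the invariant means
    enter. *)
Let xs_bounded w :
  (limn_esup (fun n => \int[piT (th n w)]_x (V x)%:E) < +oo)%E ->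
  exists2 K, 0 <= K & forall k, - K <= xs w k <= kappa * V (X k.+1 w) + K.
Proof.
have -> : (fun n => \int[piT (th n w)]_x (V x)%:E)%E =
    (fun n => (\int[piT (th n w)]_x V x)%:E).
  apply/funext => n; rewrite (EFin_Rintegral (piV (th n w))) //.
move=> /limn_esup_lty_bound[B hB].
have B0 : 0 <= B.
  have I0 : 0 <= \int[piT (th 0%N w)]_x V x by apply: Rintegral_ge0 => y _; exact: V0.
  exact: le_trans I0 (hB 0%N).
exists (kappa * B) => [|k]; first exact: mulr_ge0.
rewrite /xs /Z fbarE; set I := \int[_]_y _.
have I0 : 0 <= I by exact: Rintegral_ge0.
have I1 : I <= kappa * B.
  apply: le_trans (_ : kappa * \int[piT (th k.+1 w)]_x V x <= _).
    apply: le_trans (ler_norm _) _.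
    exact: (Vbounded_Rintegral_le (piV (th k.+1 w)) (fb (th k.+1 w))).
  by apply: ler_wpM2l.
have := f_ge0 (X k.+1 w, th k.+1 w); have := f_le (X k.+1 w) (th k.+1 w).
have kB : 0 <= kappa * B by exact: mulr_ge0.
move: (f _) (kappa * B) (kappa * V _) I0 I1 kB => a b c h1 h2 h3 h4 h5.
by apply/andP; split; lra.
Qed.

Let ps_cvg w : cvgn (series (Ym ^~ w)) ->
  cvgn (series (fun k => (`|ps w k| / k.+1%:R) ^+ j.+2)).
Proof.
move=> cY; apply: (@powR_series_exprn _ alpha); rewrite ?alpha_ge1//.
apply: (@series_le_cvg_scale _ 1) cY => k; first exact: powR_ge0.
have p0 := normr_ge0 (ps w k).
rewrite mul1r -(wtM k p0) /Ym /moment; apply: ler_wpM2l => //.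
by rewrite addrAC lerDr addr_ge0// powR_ge0.
Qed.

Let V_cvg w : cvgn (series (Ym ^~ w)) ->
  cvgn (series (fun k => (V (X k.+1 w) / k.+1%:R) ^+ j.+2)).
Proof.
move=> cY; apply: (@powR_series_exprn _ alpha); rewrite ?alpha_ge1//.
  by move=> k; exact: divr_ge0.
apply: (@series_le_cvg_scale _ 1) cY => k; first exact: powR_ge0.
rewrite mul1r -(wtM k (V0 _)) /Ym /moment; apply: ler_wpM2l => //.
by rewrite lerDr addr_ge0// powR_ge0.
Qed.

(** The term in p is shifted by one step, which costs the factor (k + 2) / (k + 1),
    at most 2. *)
Let g_cvg w K : 0 <= K ->
  (forall k, - K <= xs w k <= kappa * V (X k.+1 w) + K) ->
  cvgn (series (Ym ^~ w)) ->
  cvgn (series (fun k => ((`|xs w k| + 2 + `|ps w k.+1|) / k.+1%:R) ^+ j.+2)).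
Proof.
move=> K0 xK cY.
pose u k := `|ps w k| / k.+1%:R.
pose v k := V (X k.+1 w) / k.+1%:R.
have u0 k : 0 <= u k by exact: divr_ge0.
have v0 k : 0 <= v k by exact: divr_ge0.
have cu1 : cvgn (series (fun k => u k.+1 ^+ j.+2)).
  have [B hB] := cvg_seq_bound (ps_cvg cY).
  apply: (@series_bounded_cvg _ _ B) => n; first exact: exprn_ge0.
  apply: le_trans (hB n.+1); apply: le_trans (ler_norm _).
  by rewrite /series /= [leRHS]big_nat_recl//= lerDr exprn_ge0.
have cs := cvg_seriesD (V_cvg cY) cu1.
pose c := kappa + K + 2.
have c0' : 0 <= c by rewrite !addr_ge0.
have c2 : 2 <= c by rewrite /c lerDr addr_ge0.
apply: (@series_le_cvg_scale _ (2 ^+ j.+2 * c ^+ j.+2)) cs => k.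
  by apply: exprn_ge0; apply: divr_ge0 => //; apply: addr_ge0 => //; exact: addr_ge0.
rewrite -/(v k) -mulrA mulrDr -!exprMn.
apply: le_trans (exprnD_le _ (mulr_ge0 c0' (v0 k)) (mulr_ge0 c0' (u0 k.+1))).
have k1 : (0 : R) < k.+1%:R by [].
apply: lerXn2r; rewrite ?nnegrE.
- by apply: divr_ge0 => //; apply: addr_ge0 => //; exact: addr_ge0.
- by apply: addr_ge0; exact: mulr_ge0.
rewrite mulrDl; apply: lerD.
  rewrite /v mulrA ler_pM2r ?invr_gt0//.
  have VK : K <= K * V (X k.+1 w) by rewrite ler_peMr.
  have V2 : 2 <= 2 * V (X k.+1 w) by rewrite ler_peMr.
  have ar (x a b e : R) : - K <= x <= a + K -> 0 <= a -> K <= b -> 2 <= e -> `|x| + 2 <= a + b + e.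
    by move=> /andP[h1 h2] h3 h4 h5; have : `|x| <= a + K by [rewrite ler_norml; lra]; lra.
  have kV0 : 0 <= kappa * V (X k.+1 w) by exact: mulr_ge0.
  by rewrite /c 2!mulrDl; exact: (ar _ _ _ _ (xK k) kV0 VK V2).
have h : (k.+1%:R : R)^-1 <= 2 * k.+2%:R^-1.
  have k2 : (0 : R) < k.+2%:R by [].
  rewrite ler_pdivlMr// mulrC ler_pdivrMr// -natrM ler_nat.
  by rewrite mul2n -addnn addSn ltnS leq_addl.
rewrite /u mulrCA; apply: ler_wpM2l => //.
apply: le_trans h _; apply: ler_wpM2r => //.
Qed.

Let r_cvg_arith (p q u v : R) : 0 <= p -> 0 <= q -> 0 <= u -> 0 <= v ->
  p * (u + q * v) <= p * (1 + q) * (u + v).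
Proof.
move=> p0 q0 u0 v0; rewrite -mulrA; apply: ler_wpM2l => //.
have : 0 <= q * u by exact: mulr_ge0.
by rewrite mulrDl mul1r mulrDr; lra.
Qed.

(** Finite sums force each term, hence each norm in it, to be finite, so that
    [joint_sol_perturb] applies with the real values of the norms. *)
Let r_cvg w : (\sum_(1 <= k <oo) A4_term k w < +oo)%E ->
  (\sum_(1 <= k <oo) var_term k w < +oo)%E ->
  cvgn (series (fun k => `|rs w k| / k.+1%:R)).
Proof.
have A0 k : (0 <= A4_term k w)%E.
  by rewrite !mule_ge0 ?lee_fin ?DV_ge0// mulr_ge0// exprn_ge0// le_max L0.
have B0 k : (0 <= var_term k w)%E.
  by rewrite !mule_ge0 ?lee_fin ?Vnorm_ge0// mulr_ge0// exprn_ge0.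
move=> /(le_lt_trans (nneseries_shift1 A0)) sA /(le_lt_trans (nneseries_shift1 B0)) sB.
have term_lty (t : nat -> \bar R) : (forall k, 0 <= t k)%E ->
    (\sum_(0 <= k <oo) t k < +oo)%E -> forall k, (t k < +oo)%E.
  move=> t0 toe k; apply: le_lt_trans toe.
  apply: le_trans (nneseries_lim_ge k.+1 _); last by move=> i _.
  by rewrite big_nat_recr//= leeDr// sume_ge0.
have Aoo := term_lty _ (fun k => A0 k.+1) sA.
have Boo := term_lty _ (fun k => B0 k.+1) sB.
have Doo k : (DV V P (th k.+1 w) (th k w) < +oo)%E.
  have := Aoo k; rewrite /A4_term /= ltey; apply: contraTT; rewrite -leNgt leye_eq => /eqP ->.
  have m0 : 0 < Num.max (L (th k.+1 w)) (L (th k w)) by rewrite lt_max (lt_le_trans ltr01 (L1 _)).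
  rewrite gt0_muley ?lte_fin ?mulr_gt0 ?exprn_gt0//.
  by rewrite gt0_mulye ?lte_fin// (lt_le_trans ltr01).
have Noo k : (Vnorm V (fun x => f (x, th k.+1 w) - f (x, th k w))%R < +oo)%E.
  have := Boo k; rewrite /var_term /= ltey; apply: contraTT; rewrite -leNgt leye_eq => /eqP ->.
  have m0 : 0 < L (th k w) by exact: lt_le_trans (L1 _).
  rewrite gt0_muley ?lte_fin ?mulr_gt0 ?exprn_gt0//.
  by rewrite gt0_mulye ?lte_fin// (lt_le_trans ltr01).
pose a k := fine (Vnorm V (fun x => f (x, th k.+1 w) - f (x, th k w))).
pose d k := fine (DV V P (th k.+1 w) (th k w)).
have a0 k : 0 <= a k by apply: fine_ge0; exact: Vnorm_ge0.
have d0 k : 0 <= d k by apply: fine_ge0; exact: DV_ge0.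
pose uA k := k.+1%:R^-1 * Num.max (L (th k.+1 w)) (L (th k w)) ^+ 6 * d k * V (X k.+1 w).
pose uB k := k.+1%:R^-1 * L (th k w) ^+ 2 * a k * V (X k.+1 w).
have uAE k : (uA k)%:E = A4_term k.+1 w.
  by rewrite /uA EFinM EFinM fineK// ge0_fin_numE ?DV_ge0.
have uBE k : (uB k)%:E = var_term k.+1 w.
  by rewrite /uB EFinM EFinM fineK// ge0_fin_numE ?Vnorm_ge0.
have uA0 k : 0 <= uA k by rewrite -lee_fin uAE.
have uB0 k : 0 <= uB k by rewrite -lee_fin uBE.
have cA : cvgn (series uA).
  by apply: nneseries_lty_cvg => //; under eq_eseriesr do rewrite uAE.
have cB : cvgn (series uB).
  by apply: nneseries_lty_cvg => //; under eq_eseriesr do rewrite uBE.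
pose c := (1 + V point) * (1 + c0).
have vp : 0 <= 1 + V point by rewrite addr_ge0.
apply: (@series_le_cvg_scale _ c) (cvg_seriesD cB cA) => k.
  exact: divr_ge0.
have := @joint_sol_perturb kappa f (a k) (d k) (X k.+1 w) (th k w) (th k.+1 w) fb (a0 k) (d0 k)
  (fun y => Vnorm_fine V_ge1 y (Noo k)) (fun y => DV_fine V_ge1 y (Doo k)).
rewrite -/sol -/(rs w k) -/c0.
have k1 : (0 : R) <= k.+1%:R^-1 by [].
have -> : uB k = L (th k w) ^+ 2 * a k * V (X k.+1 w) * k.+1%:R^-1.
  by rewrite /uB [RHS]mulrC !mulrA.
have -> : uA k = Num.max (L (th k.+1 w)) (L (th k w)) ^+ 6 * d k * V (X k.+1 w) * k.+1%:R^-1.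
  by rewrite /uA [RHS]mulrC !mulrA.
have hA : 0 <= Num.max (L (th k.+1 w)) (L (th k w)) ^+ 6 * d k * V (X k.+1 w).
  by rewrite mulr_ge0// mulr_ge0// exprn_ge0// le_max L0.
have hB : 0 <= L (th k w) ^+ 2 * a k * V (X k.+1 w).
  by rewrite mulr_ge0// mulr_ge0// exprn_ge0.
rewrite -mulrDl mulrA => h.
apply: ler_wpM2r => //; apply: le_trans h _.
exact: r_cvg_arith.
Qed.

(** Almost every path satisfies the hypotheses of [run_mean_cvg0]; alpha <= j + 2
    turns moments of order alpha into the powers that it requires. *)
Theorem centred_run_mean_cvg0 : {ae Pr, forall w,
  run_mean (fun k => f (X k.+1 w, th k.+1 w) - \int[piT (th k.+1 w)]_y f (y, th k.+1 w)) @ \oo --> 0}.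
Proof.
apply: filterS2 (filterI A4 f_var) (filterI A5a (filterI moment_series_lty weighted_martingale_cvg)).
move=> w [wA4 wvar] [wA5a [wY wM]].
have -> : (fun k => f (X k.+1 w, th k.+1 w) - \int[piT (th k.+1 w)]_y f (y, th k.+1 w)) = xs w.
  by apply/funext => k; rewrite -fbarE.
have [K K0 xK] := xs_bounded wA5a.
have cY : cvgn (series (Ym ^~ w)) by apply: nneseries_lty_cvg.
apply: (@run_mean_cvg0 _ j K (xs w) (ms w) (ps w) (rs w)) => //.
- by move=> n; rewrite /xs /ms /ps /rs /fbar; ring.
- by exists 0%N => n _; case/andP: (xK n).
- exact: g_cvg xK cY.
- exact: r_cvg.
Qed.

End kernel_family.

(** * The law of large numbers *)

Section run_mean_theory.
Context {R : realType}.
Implicit Types x y : R^nat.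

Lemma run_meanD x y n : run_mean (fun k => x k + y k) n = run_mean x n + run_mean y n.
Proof. by rewrite /run_mean /series /= big_split mulrDr. Qed.

Lemma run_meanZ c x n : run_mean (fun k => c * x k) n = c * run_mean x n.
Proof. by rewrite /run_mean /series /= -mulr_sumr mulrCA. Qed.

Lemma run_mean_cvg x (l : R) : x @ \oo --> l -> run_mean x @ \oo --> (l : R).
Proof. by move=> /cesaro xl; rewrite -cvg_shiftS. Qed.

(** Prepending one term x 0 changes the running mean by x 0 / (n + 1) and by the
    factor n / (n + 1). *)
Lemma run_mean_shift_cvg0 x :
  run_mean (fun k => x k.+1) @ \oo --> (0 : R) -> run_mean x @ \oo --> (0 : R).
Proof.
move=> h; rewrite -cvg_shiftS.
have -> : [sequence run_mean x n.+1]_n = fun n =>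
    x 0%N * harmonic n + (1 - harmonic n) * run_mean (fun k => x k.+1) n.
  apply/funext => n; rewrite /run_mean /series /= big_nat_recl// mulrDr mulrC.
  congr (_ + _); case: n => [|n]; first by rewrite big_geq// !mulr0.
  rewrite mulrA; congr (_ * _).
  have n0 : n.+1%:R != 0 :> R by [].
  have n1 : n.+2%:R != 0 :> R by [].
  have -> : n.+2%:R = n.+1%:R + 1 :> R by rewrite natr1.
  rewrite -natr1 in n1; move: (n.+1%:R : R) n0 n1 => a a0 a1.
  by field; rewrite a0 a1.
have c0 : (fun n => x 0%N * harmonic n) @ \oo --> x 0%N * 0.
  exact: (cvgM (cvg_cst (x 0%N)) (@cvg_harmonic R)).
have c1 : (fun n => 1 - @harmonic R n) @ \oo --> (1 - 0 : R).
  exact: (cvgB (cvg_cst (1 : R)) (@cvg_harmonic R)).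
suff : (fun n => x 0%N * harmonic n + (1 - harmonic n) * run_mean (fun k => x k.+1) n)
  @ \oo --> x 0%N * 0 + (1 - 0) * 0 by rewrite !mulr0 addr0.
exact: (cvgD c0 (cvgM c1 h)).
Qed.

End run_mean_theory.

Theorem theorem2p7 (R : realType) (dT dTh dO : measure_display)
  (T : measurableType dT) (Theta : measurableType dTh)
  (Omega : measurableType dO) (Pr : probability Omega R)
  (target : probability T R)
  (P : Theta -> R.-pker T ~> T)
  (P_meas : jointly_measurable P)
  (Flt : nat -> set (set Omega)) (Flt_filtration : filtration Flt)
  (X : nat -> Omega -> T) (th : nat -> Omega -> Theta)
  (Xth_process : controlled_markov Pr Flt P X th)
  (P_irr : forall t, irreducible target (P t))
  (P_aper : forall t, aperiodic (P t))
  (V : T -> R) (V_meas : measurable_fun setT V) (V_ge1 : forall x, 1 <= V x)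
  (V_drift : drift_minorization V P)
  (piT : Theta -> probability T R)
  (piT_inv : forall t, invariant_prob (P t) (piT t))
  (C rho : Theta -> R)
  (P_ergo : geometrically_ergodic V P piT C rho)
  (A4 : {ae Pr, forall w,
     (\sum_(1 <= k <oo)
        ((k%:R^-1 * Num.max (Lcst C rho (th k w)) (Lcst C rho (th k.-1 w)) ^+ 6)%:E
         * DV V P (th k w) (th k.-1 w) * (V (X k w))%:E) < +oo)%E})
  (A5a : {ae Pr, forall w,
     (limn_esup (fun n => \int[piT (th n w)]_x (V x)%:E) < +oo)%E})
  (alpha : R) (alpha_gt1 : 1 < alpha)
  (A5b : {ae Pr, forall w,
     (\sum_(0 <= k <oo)
        ((k.+1%:R `^ (- alpha) * Lcst C rho (th k w) `^ (2 * alpha))%:E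
         * \int[P (th k w) (X k w)]_y (V y `^ alpha)%:E) < +oo)%E})
  (F : T * Theta -> R) (F_meas : measurable_fun setT F)
  (F_bound : (ereal_sup (range (fun t => Vnorm V (fun x => F (x, t)))) < +oo)%E)
  (F_var : {ae Pr, forall w,
     (\sum_(1 <= k <oo)
        ((k%:R^-1 * Lcst C rho (th k.-1 w) ^+ 2)%:E
         * Vnorm V (fun x => F (x, th k w) - F (x, th k.-1 w))%R
         * (V (X k w))%:E) < +oo)%E})
  (F_lim : {ae Pr, forall w,
     cvgn (fun n => \int[piT (th n w)]_x F (x, th n w))}) :
  {ae Pr, forall w,
     (fun n : nat => n%:R^-1 * \sum_(0 <= k < n) F (X k w, th k w)) @ \oo -->
     limn (fun n => \int[piT (th n w)]_x F (x, th n w))}.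
Proof.
have [n an] : exists n : nat, alpha <= n.+2%:R.
  exists (Num.truncn alpha); have := truncnS_gt alpha.
  by move=> /ltW /le_trans -> //; rewrite ler_nat.
have ergo t := (P_ergo t).2.
have V0 x : 0 <= V x by exact: le_trans (V_ge1 x).
pose kappa := fine (ereal_sup (range (fun t => Vnorm V (fun x => F (x, t))))).
have F_le x t : `|F (x, t)| <= kappa * V x.
  have tS : (Vnorm V (fun x => F (x, t)) <=
      ereal_sup (range (fun t => Vnorm V (fun x => F (x, t)))))%E.
    by apply: ereal_sup_ubound; exists t.
  apply: le_trans (Vnorm_fine V_ge1 x (le_lt_trans tS F_bound)) _.
  apply: ler_wpM2r => //; apply: fine_le => //.
    by rewrite ge0_fin_numE ?Vnorm_ge0// (le_lt_trans tS).
  by rewrite ge0_fin_numE// (le_trans _ tS)// Vnorm_ge0.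
have mV2 : measurable_fun setT (fun z : T * Theta => V z.1).
  by apply: measurableT_comp => //; exact: measurable_fst.
have := centred_run_mean_cvg0 P_meas V_meas V_ge1 P_ergo Flt_filtration
  Xth_process alpha_gt1 _ _ _ A5b an A4 A5a.
move=> lln.
(* both functions are nonnegative; the added term kappa V does not depend on the
   parameter, so the variations are those of F and zero *)
have ae1 := @lln (fun z => F z + kappa * V z.1) (2 * kappa).
have ae2 := @lln (fun z => V z.1) 1.
have {}ae1 : {ae Pr, forall w, run_mean (fun k =>
    F (X k.+1 w, th k.+1 w) + kappa * V (X k.+1 w) -
    \int[piT (th k.+1 w)]_y (F (y, th k.+1 w) + kappa * V y)) @ \oo --> (0 : R)}.
  apply: ae1 => /=.
  - by apply: measurable_funD => //; exact: measurable_funM.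
  - by move=> [x t] /=; have := F_le x t; rewrite ler_norml => /andP[]; lra.
  - move=> x t; have := F_le x t; rewrite ler_norml => /andP[_ h].
    by rewrite -mulrA mulr_natl mulr2n lerD2r.
  - apply: filterS F_var => w; congr (_ < _)%E; apply: eq_eseriesr => k _.
    congr (_ * Vnorm V _ * _)%E; apply/funext => x /=.
    by rewrite opprD addrACA subrr addr0.
have {}ae2 : {ae Pr, forall w, run_mean (fun k =>
    V (X k.+1 w) - \int[piT (th k.+1 w)]_y V y) @ \oo --> (0 : R)}.
  apply: ae2 => //=.
  - by move=> x t; rewrite mul1r.
  - apply: aeW => w; rewrite eseries0 ?ltry// => k _ _.
    have -> : (fun x => V x - V x) = cst 0 by apply/funext => x; rewrite subrr.
    suff -> : Vnorm V (cst (0 : R)) = 0%E by rewrite mule0 mul0e.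
    have -> : Vnorm V (cst (0 : R)) = ereal_sup [set 0%E]; last by rewrite ereal_sup1.
    congr ereal_sup; apply/seteqP; split => [_ [x _ <-]|_ ->] /=.
      by rewrite normr0 mul0r.
    by exists point => //; rewrite normr0 mul0r.
apply: filterS3 F_lim ae1 ae2 => w b_cvg cvg1 cvg2.
pose b k := \int[piT (th k w)]_x F (x, th k w).
pose a k := F (X k w, th k w).
suff d_cvg : run_mean (fun k => a k - b k) @ \oo --> (0 : R).
  have -> : (fun n : nat => n%:R^-1 * \sum_(0 <= k < n) F (X k w, th k w)) =
      (fun n => run_mean (fun k => a k - b k) n + run_mean b n).
    apply/funext => m; rewrite -run_meanD /run_mean /series /=.
    by congr (_ * _); apply: eq_bigr => k _; rewrite subrK.
  by rewrite -[X in _ --> X]add0r; apply: cvgD => //; exact: run_mean_cvg.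
apply: run_mean_shift_cvg0.
have piV t := invariant_V_integrable V_meas V_ge1 (ergo t).
have piF t : (piT t).-integrable setT (EFin \o (fun x => F (x, t))).
  apply: (Vbounded_integrable (kappa := kappa) (piV t)); split => // .
  by apply: (measurableT_comp F_meas); exact: pair2_measurable.
have -> : run_mean (fun k => a k.+1 - b k.+1) = fun n =>
    run_mean (fun k => F (X k.+1 w, th k.+1 w) + kappa * V (X k.+1 w) -
      \int[piT (th k.+1 w)]_y (F (y, th k.+1 w) + kappa * V y)) n +
    (- kappa) * run_mean (fun k => V (X k.+1 w) - \int[piT (th k.+1 w)]_y V y) n.
  apply/funext => m; rewrite -run_meanZ -run_meanD; congr run_mean.
  apply/funext => k; rewrite /a /b.
  rewrite (RintegralD measurableT (piF _) (integrable_EFinZ kappa (piV _))).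
  rewrite RintegralZl//; last exact: piV.
  by ring.
suff : (fun n => run_mean (fun k => F (X k.+1 w, th k.+1 w) + kappa * V (X k.+1 w) -
      \int[piT (th k.+1 w)]_y (F (y, th k.+1 w) + kappa * V y)) n +
    (- kappa) * run_mean (fun k => V (X k.+1 w) - \int[piT (th k.+1 w)]_y V y) n)
    @ \oo --> 0 + (- kappa) * (0 : R) by rewrite mulr0 addr0.
exact: (cvgD cvg1 (cvgM (cvg_cst (- kappa)) cvg2)).
Qed.
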